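(* Let $n\ge1$ and $l\ge 2$ be integers, $W=S_n\ltimes(\mathbb{Z}/l\mathbb{Z})^n$, and let $r$ be a positive integer not divisible by $l$. Write $r=(p-1)l+q$ with $p$ a positive integer and $q$ an integer with $1\le q\le l-1$. Let $\varepsilon$ be a primitive $l$-th root of unity, and let $E_r$ be the affine hyperplane of parameters $c=(k,c_1,\dots,c_{l-1})\in\mathbb{C}^l$ satisfying $$l(n-1)k+2\sum_{j=1}^{l-1}c_j\frac{1-\varepsilon^{-jq}}{1-\varepsilon^{-j}}=r .$$ (i) For every $c\in E_r$ there exists a lowest weight module $Y_c$ over the rational Cherednik algebra $H_c(n,l)=H_c(W)$ with trivial lowest weight (i.e. a quotient of the polynomial representation $M_c$) which is isomorphic to $U_r^{\otimes n}$ as a graded $W$-module. (ii) For generic $c\in E_r$, $Y_c$ is irreducible.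
   Context: $W=S_n\ltimes(\mathbb{Z}/l\mathbb{Z})^n$ acts on $\mathfrak{h}=\mathbb{C}^n$; its set $S$ of complex reflections consists of $$s_i^m(x_1,\dots,x_i,\dots,x_n)=(x_1,\dots,\varepsilon^mx_i,\dots,x_n),\quad 1\le m<l,$$ $$\sigma_{i,j}^{(m)}(x_1,\dots,x_i,\dots,x_j,\dots,x_n)=(x_1,\dots,\varepsilon^mx_j,\dots,\varepsilon^{-m}x_i,\dots,x_n),\quad 0\le m<l,\ i<j.$$ The parameter $c=(k,c_1,\dots,c_{l-1})$ is identified with the $W$-invariant function $c:S\to\mathbb{C}$ with $c(s_i^m)=c_m$ and $c(\sigma_{i,j}^{(m)})=k$. For $s\in S$ let $\alpha_s\in\mathfrak{h}^*$ be a nonzero linear function vanishing on the reflection hyperplane of $s$, and $\alpha_s^\vee\in\mathfrak{h}$ the element vanishing on the reflection hyperplane of $s$ in $\mathfrak{h}^*$, with $(\alpha_s^\vee,\alpha_s)=2$; let $\lambda_s$ be the nontrivial eigenvalue of $s$ on $\mathfrak{h}^*$. The rational Cherednik algebra $H_c(n,l)=H_c(W)$ is generated by $g\in W$, $x\in\mathfrak{h}^*$, $y\in\mathfrak{h}$ with relations $gxg^{-1}=x^g$, $gyg^{-1}=y^g$, $[x,x']=0$, $[y,y']=0$, $[y,x]=(y,x)-\sum_{s\in S}c_s(y,\alpha_s)(\alpha_s^\vee,x)s$. Its polynomial representation $M_c$ is the space $\mathbb{C}[\mathfrak{h}]=\mathbb{C}[x_1,\dots,x_n]$, where $W$ and $\mathfrak{h}^*$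 act in the obvious way (natural action on functions, and multiplication) and $y\in\mathfrak{h}$ acts by the Dunkl operator $\partial_y-\sum_{s\in S}\frac{2c_s}{1-\lambda_s}\frac{(\alpha_s,y)}{\alpha_s}(1-s)$. Quotients of $M_c$ are graded by polynomial degree. $U_r=\mathbb{C}[u]/(u^r)$, graded by degree in $u$, is a representation of $\mathbb{Z}/l\mathbb{Z}$ by $m\circ u^j=\varepsilon^{-mj}u^j$; $U_r^{\otimes n}$ is then a graded representation of $W$ ($S_n$ permutes the factors, and the $i$-th copy of $\mathbb{Z}/l\mathbb{Z}$, generated by $s_i$, acts in the $i$-th factor). ''Generic $c\in E_r$'' means all $c$ in some nonempty Zariski open subset of $E_r$. *)

(* Defs.v *)
From HB Require Import structures.
From mathcomp Require Import all_boot all_order all_fingroup all_algebra.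
From mathcomp Require Import generic_quotient ring_quotient.
From mathcomp Require Import boolp classical_sets reals complex.
From mathcomp Require Import mpoly.
From mathcomp Require monalg.

Set Implicit Arguments.
Unset Strict Implicit.
Unset Printing Implicit Defensive.

Import GRing.Theory.
Local Open Scope ring_scope.

Section PresentedAlgebra.
Import monalg.
Local Open Scope quotient_scope.

Variables (C : fieldType) (X : choiceType).

Definition free_alg : lalgType C := {malg C[{fmonom X}]}.

Definition free_gen (x : X) : free_alg := mkmalgU (fmu x) 1.

Variable rel : free_alg -> free_alg -> Prop.

(* The smallest two-sided ideal containing [u - v] for all [rel u v]. *)
Definition rel_ideal : {pred free_alg} := fun f => `[<
  forall I : free_alg -> Prop,
    I 0 -> (forall u v, I u -> I v -> I (u + v)) ->
    (forall a u b, I u -> I (a * u * b)) ->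
    (forall u v, rel u v -> I (u - v)) -> I f >].

Lemma rel_ideal_zmod_closed : zmod_closed rel_ideal.
Proof.
split=> [|u v /asboolP Iu /asboolP Iv]; apply/asboolP => I I0 ID IM IR //.
have Iu' : I u := Iu I I0 ID IM IR.
have Iv' : I (-1 * v * 1) := IM _ _ _ (Iv I I0 ID IM IR).
by rewrite mulN1r mulr1 in Iv'; exact: ID.
Qed.
HB.instance Definition _ :=
  GRing.isZmodClosed.Build free_alg rel_ideal rel_ideal_zmod_closed.

Lemma rel_idealM a u b : u \in rel_ideal -> a * u * b \in rel_ideal.
Proof.
move=> /asboolP Iu; apply/asboolP => I I0 ID IM IR.
exact: IM _ _ _ (Iu I I0 ID IM IR).
Qed.

Definition pres_alg : Type := Quotient.quot rel_ideal.
HB.instance Definition _ := ZmodQuotient.on pres_alg.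

Definition pres_proj (u : free_alg) : pres_alg := \pi_pres_alg u.

Lemma pres_proj_eq u v : pres_proj u = pres_proj v <-> u - v \in rel_ideal.
Proof. by split=> [/eqP|H]; [|apply/eqP]; rewrite piE. Qed.

Let one : pres_alg := pres_proj 1.
Let mul (x y : pres_alg) : pres_alg := pres_proj (repr x * repr y).

Let projM u v : pres_proj (u * v) = mul (pres_proj u) (pres_proj v).
Proof.
apply/pres_proj_eq; set u' := repr _; set v' := repr _.
have Hu : u - u' \in rel_ideal by apply/pres_proj_eq; rewrite /pres_proj reprK.
have Hv : v - v' \in rel_ideal by apply/pres_proj_eq; rewrite /pres_proj reprK.
have -> : u * v - u' * v' = 1 * (u - u') * v + u' * (v - v') * 1.
  by rewrite mul1r mulr1 mulrBl mulrBr addrA subrK.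
by rewrite rpredD // rel_idealM.
Qed.

Let projK (x : pres_alg) : pres_proj (repr x) = x.
Proof. exact: reprK. Qed.

Let projD u v : pres_proj (u + v) = pres_proj u + pres_proj v.
Proof. exact: raddfD. Qed.

Let mulA : associative mul.
Proof.
by move=> x y z; rewrite -[x]projK -[y]projK -[z]projK -!projM mulrA.
Qed.
Let mul1 : left_id one mul.
Proof. by move=> x; rewrite -[x]projK -projM mul1r. Qed.
Let mulr1' : right_id one mul.
Proof. by move=> x; rewrite -[x]projK -projM mulr1. Qed.
Let mulDl : left_distributive mul +%R.
Proof.
by move=> x y z; rewrite -[x]projK -[y]projK -[z]projK -projD -!projM mulrDl
  projD.
Qed.
Let mulDr : right_distributive mul +%R.
Proof.
by move=> x y z; rewrite -[x]projK -[y]projK -[z]projK -projD -!projM mulrDr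
  projD.
Qed.

(* Nothing is claimed about [1 != 0], hence [pzRing]. *)
HB.instance Definition _ :=
  GRing.Zmodule_isPzRing.Build pres_alg mulA mul1 mulr1' mulDl mulDr.

Lemma pres_proj_zmod_morphism : zmod_morphism pres_proj.
Proof. by move=> u v; rewrite /pres_proj raddfB. Qed.
HB.instance Definition _ :=
  GRing.isZmodMorphism.Build free_alg pres_alg pres_proj
    pres_proj_zmod_morphism.

Lemma pres_proj_monoid_morphism : monoid_morphism pres_proj.
Proof. by split=> [|u v]; rewrite ?projM. Qed.
HB.instance Definition _ :=
  GRing.isMonoidMorphism.Build free_alg pres_alg pres_proj
    pres_proj_monoid_morphism.

Lemma pres_proj_rel u v : rel u v -> pres_proj u = pres_proj v.
Proof. by move=> Ruv; apply/pres_proj_eq/asboolP => I _ _ _; apply. Qed.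

(* The structure map [C -> pres_alg]; through it every [pres_alg]-module is a
   [C]-vector space. *)
Definition pres_scalar (a : C) : pres_alg := pres_proj a%:A.
Definition pres_gen (x : X) : pres_alg := pres_proj (free_gen x).

End PresentedAlgebra.

Definition irreducible_module (A : pzRingType) (V : lmodType A) : Prop :=
  (exists v : V, v != 0) /\
  (forall S : {pred V}, submod_closed S -> S =i pred1 0 \/ S =i predT).

(* [CycWreath w a] stands for the linear map [diag(eps^a) P_w], where
   [P_w e_j = e_(w j)]; see [refl_rep].  Note that permutations compose from
   left to right in MathComp: [P_w P_w' = P_(w' * w)].  Since ['Z_l] is Z/l only
   for [1 < l], everything below is meant for such [l]. *)
Record cyc_wreath (n l : nat) : Type :=
  CycWreath { cw_perm : 'S_n; cw_exp : {ffun 'I_n -> 'Z_l} }.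

Section CycWreath.
Variables n l : nat.
Local Notation W := (cyc_wreath n l).

Definition cw_to_pair (g : W) := (cw_perm g, cw_exp g).
Definition cw_of_pair (u : 'S_n * {ffun 'I_n -> 'Z_l}) : W :=
  CycWreath u.1 u.2.
Lemma cw_to_pairK : cancel cw_to_pair cw_of_pair.
Proof. by case. Qed.
HB.instance Definition _ := Finite.copy W (can_type cw_to_pairK).

Definition cw_one : W := CycWreath 1%g [ffun=> 0].
Definition cw_mul (g h : W) : W :=
  CycWreath (cw_perm h * cw_perm g)%g
    [ffun i => cw_exp g i + cw_exp h ((cw_perm g)^-1%g i)].
Definition cw_inv (g : W) : W :=
  CycWreath (cw_perm g)^-1%g [ffun i => - cw_exp g (cw_perm g i)].

Lemma cw_mulA : associative cw_mul.
Proof.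
move=> [w a] [w' a'] [w'' a'']; congr CycWreath => /=; first by rewrite mulgA.
by apply/ffunP=> i; rewrite !ffunE /= invMg permM addrA.
Qed.
Lemma cw_mul1 : left_id cw_one cw_mul.
Proof.
move=> [w a]; congr CycWreath => /=; first by rewrite mulg1.
by apply/ffunP=> i; rewrite !ffunE /= invg1 perm1 add0r.
Qed.
Lemma cw_mulV : left_inverse cw_one cw_inv cw_mul.
Proof.
move=> [w a]; congr CycWreath => /=; first by rewrite mulgV.
by apply/ffunP=> i; rewrite !ffunE /= invgK addNr.
Qed.
HB.instance Definition _ :=
  Finite_isGroup.Build W cw_mulA cw_mul1 cw_mulV.

End CycWreath.

Section Cherednik.
Variables (C : fieldType) (n l : nat) (eps : C).
Local Notation W := (cyc_wreath n l).
Local Notation h := 'cV[C]_n.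
Local Notation hdual := 'rV[C]_n.
Local Notation P := {mpoly C[n]}.

Definition pairing (x : hdual) (y : h) : C := (x *m y) 0 0.

Definition refl_rep (g : W) : 'M[C]_n :=
  \matrix_(i, j) (if i == cw_perm g j then eps ^+ (cw_exp g i : nat) else 0).

Definition act_h (g : W) (y : h) : h := refl_rep g *m y.
Definition act_hdual (g : W) (x : hdual) : hdual := x *m refl_rep g^-1%g.

(* Coordinate form of the natural action [(g f)(v) = f(g^-1 v)]. *)
Definition lin_form (x : hdual) : P := \sum_i x 0 i *: 'X_i.
Definition act_poly (g : W) (f : P) : P :=
  f \mPo [tuple lin_form (row i (refl_rep g^-1%g)) | i < n].

(* [inl (i, m)] is [s_i^m], with [m != 0], and [inr (i, j, m)] is
   [sigma_(i,j)^(m)], with [i < j]. *)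
Definition refl_index : finType := ('I_n * 'Z_l + 'I_n * 'I_n * 'Z_l)%type.

Definition is_refl (s : refl_index) : bool :=
  match s with
  | inl (_, m) => m != 0
  | inr (i, j, _) => (i < j)%N
  end.

Definition refl (s : refl_index) : W :=
  match s with
  | inl (i, m) => CycWreath 1%g [ffun k => if k == i then m else 0]
  | inr (i, j, m) =>
      CycWreath (tperm i j)
        [ffun k => if k == i then m else if k == j then - m else 0]
  end.

Definition refl_root (s : refl_index) : hdual :=
  match s with
  | inl (i, _) => delta_mx 0 i
  | inr (i, j, m) => delta_mx 0 i - eps ^+ (m : nat) *: delta_mx 0 j
  end.

Definition refl_coroot (s : refl_index) : h :=
  match s with
  | inl (i, _) => 2%:R *: delta_mx i 0
  | inr (i, j, m) => delta_mx i 0 - eps ^- (m : nat) *: delta_mx j 0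
  end.

Definition refl_eigenvalue (s : refl_index) : C :=
  match s with
  | inl (_, m) => eps ^- (m : nat)
  | inr _ => - 1
  end.

(* The parameter [(k, c_1, ..., c_(l-1))]: entry [0] of [c] is [k]. *)
Variable c : l.-tuple C.

Definition refl_param (s : refl_index) : C :=
  match s with
  | inl (_, m) => c`_m
  | inr _ => c`_0
  end.

Definition cherednik_gen : choiceType := (W + hdual + h)%type.

Local Notation free := (free_alg C cherednik_gen).
Definition genW (g : W) : free := free_gen C (inl (inl g) : cherednik_gen).
Definition genX (x : hdual) : free := free_gen C (inl (inr x) : cherednik_gen).
Definition genY (y : h) : free := free_gen C (inr y : cherednik_gen).

(* The first four relations make [W -> H_c] a group morphism and
   [h^* -> H_c], [h -> H_c] linear. *)
Inductive cherednik_rel : free -> free -> Prop :=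
| rel_W1 : cherednik_rel (genW 1%g) 1
| rel_WM g g' : cherednik_rel (genW (g * g')%g) (genW g * genW g')
| rel_Xlin a x x' : cherednik_rel (genX (a *: x + x')) (a *: genX x + genX x')
| rel_Ylin a y y' : cherednik_rel (genY (a *: y + y')) (a *: genY y + genY y')
| rel_WX g x :
    cherednik_rel (genW g * genX x * genW g^-1%g) (genX (act_hdual g x))
| rel_WY g y :
    cherednik_rel (genW g * genY y * genW g^-1%g) (genY (act_h g y))
| rel_XX x x' : cherednik_rel (genX x * genX x') (genX x' * genX x)
| rel_YY y y' : cherednik_rel (genY y * genY y') (genY y' * genY y)
| rel_YX y x :
    cherednik_rel (genY y * genX x - genX x * genY y)
      ((pairing x y)%:A
       - \sum_(s : refl_index | is_refl s)
           (refl_param s * pairing (refl_root s) y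
              * pairing x (refl_coroot s)) *: genW (refl s)).

Definition cherednik : pzRingType := pres_alg cherednik_rel.

Definition chW (g : W) : cherednik := pres_proj cherednik_rel (genW g).
Definition chX (x : hdual) : cherednik := pres_proj cherednik_rel (genX x).
Definition chY (y : h) : cherednik := pres_proj cherednik_rel (genY y).
Definition chC (a : C) : cherednik := pres_scalar cherednik_rel a.

(* [0] if [a] does not divide [f]; this does not happen in the Dunkl operators,
   see [dunkl_divisible]. *)
Definition mpoly_quot (f a : P) : P := xget 0 [set q | f = a * q].

Definition dunkl (y : h) (f : P) : P :=
  \sum_i y i 0 *: f^`M(i)
  - \sum_(s : refl_index | is_refl s)
      (2%:R * refl_param s / (1 - refl_eigenvalue s)
         * pairing (refl_root s) y)
      *: mpoly_quot (f - act_poly (refl s) f) (lin_form (refl_root s)).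

(* [pi] is a surjective morphism of H_c-modules from the polynomial
   representation M_c, i.e. [P] with the action of the generators of H_c spelled
   out here, onto [Y]. *)
Definition poly_rep_quotient (Y : lmodType cherednik) (pi : P -> Y) : Prop :=
  [/\ forall a f f', pi (a *: f + f') = chC a *: pi f + pi f',
      forall g f, pi (act_poly g f) = chW g *: pi f,
      forall x f, pi (lin_form x * f) = chX x *: pi f,
      forall y f, pi (dunkl y f) = chY y *: pi f
    & forall v, exists f, pi f = v].

(* [T J] is the coordinate of [T] along u^(J 0) (x) ... (x) u^(J (n-1)), where
   u^0, ..., u^(r-1) is the basis of U_r = C[u]/(u^r). *)
Definition U_tensor (r : nat) : lmodType C := {ffun {ffun 'I_n -> 'I_r} -> C^o}.

(* [P_w] sends v_1 (x) ... (x) v_n to the tensor whose [w i]-th factor is v_i,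
   and then [a i] acts in the [i]-th factor by u^j |-> eps^(- a i * j) u^j. *)
Definition U_tensor_act r (g : W) (T : U_tensor r) : U_tensor r :=
  [ffun J : {ffun 'I_n -> 'I_r} =>
     (\prod_i eps ^- ((cw_exp g i : nat) * J i)) *: T [ffun i => J (cw_perm g i)]].

Definition U_tensor_homog r (d : nat) (T : U_tensor r) : Prop :=
  forall J, T J != 0 -> (\sum_i (J i : nat))%N = d.

(* The degree [d] part of [Y] is the image of the degree [d] polynomials. *)
Definition graded_W_iso (Y : lmodType cherednik) (pi : P -> Y) r
    (phi : Y -> U_tensor r) : Prop :=
  [/\ forall a v v', phi (chC a *: v + v') = a *: phi v + phi v',
      bijective phi,
      forall g v, phi (chW g *: v) = U_tensor_act g (phi v)
    & forall d v,
        (exists2 f, f \is d.-homog & pi f = v) <-> U_tensor_homog d (phi v)].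

Definition param_hyperplane (r q : nat) : Prop :=
  l%:R * (n%:R - 1) * c`_0
  + 2%:R * \sum_(1 <= j < l) c`_j * ((1 - eps ^- (j * q)) / (1 - eps ^- j))
  = r%:R.

End Cherednik.

Section CherednikFacts.
Variables (C : fieldType) (n l : nat) (eps : C).
Hypotheses (hl : (1 < l)%N) (heps : l.-primitive_root eps).
Hypothesis two_neq0 : 2%:R != 0 :> C.
Local Notation W := (cyc_wreath n l).

Lemma eps_neq0 : eps != 0.
Proof.
apply/eqP => e0; have := prim_expr_order heps; rewrite e0 expr0n.
by rewrite gtn_eqF ?(ltnW hl) // => /eqP; rewrite eq_sym oner_eq0.
Qed.

Lemma eps_ZpD (a b : 'Z_l) :
  eps ^+ ((a + b)%R : nat) = eps ^+ (a : nat) * eps ^+ (b : nat).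
Proof.
rewrite -exprD -(prim_expr_mod heps (a + b)) /=.
by congr (_ ^+ (_ %% _)); rewrite Zp_cast.
Qed.

Lemma eps_ZpN (a : 'Z_l) : eps ^+ ((- a)%R : nat) = eps ^- (a : nat).
Proof.
have H : eps ^+ ((- a)%R : nat) * eps ^+ (a : nat) = 1.
  by rewrite -eps_ZpD addNr.
by apply: (mulIf (expf_neq0 a eps_neq0)); rewrite H mulVf ?expf_neq0 ?eps_neq0.
Qed.

Lemma eps_Zp_neq1 (m : 'Z_l) : m != 0 -> eps ^+ (m : nat) != 1.
Proof.
move=> m0; rewrite -(expr0 eps) (eq_prim_root_expr heps) eqn_mod_dvd //.
rewrite subn0 gtnNdvd // ?lt0n //.
by have := ltn_ord m; rewrite [X in (_ < X)%N]Zp_cast.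
Qed.

Lemma refl_rep1 : refl_rep eps (1%g : W) = 1%:M.
Proof.
apply/matrixP=> i j; rewrite !mxE /= perm1 ffunE.
by case: eqP.
Qed.

Lemma refl_repM (g g' : W) :
  refl_rep eps (g * g')%g = refl_rep eps g *m refl_rep eps g'.
Proof.
apply/matrixP=> i j; rewrite !mxE /=.
rewrite (bigD1 (cw_perm g' j)) //= !mxE eqxx big1 ?addr0 => [|k kj]; last first.
  by rewrite !mxE (negPf kj) mulr0.
rewrite permM; case: eqP => [->|_]; last by rewrite mul0r.
by rewrite ffunE /= permK eps_ZpD.
Qed.

(* The textbook formula s x = x - (1 - lambda_s) / 2 * (alpha_s^vee, x) alpha_s,
   here in matrix form. *)
Lemma refl_rep_reflV (s : refl_index n l) : is_refl s ->
  refl_rep eps (refl s)^-1%g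
  = 1%:M - ((1 - refl_eigenvalue eps s) / 2%:R)
             *: (refl_coroot eps s *m refl_root eps s).
Proof.
have d2 (k k' j : 'I_n) : [&& k == j & k' == j] = (k == k') && (k == j).
  by apply/andP/andP=> -[/eqP-> /eqP->].
case: s => [[i m]|[[i j] m]] /= Hs.
- apply/matrixP=> k k'; rewrite !mxE /= big_ord1 !mxE /= ffunE invg1 !perm1 /=.
  rewrite ffunE !eqxx !andbT /=.
  rewrite [2%:R * _]mulrC !mulrA -[_ / _ * _]mulrA [2%:R^-1 * _]mulrC.
  have [<-|kk'] := eqVneq k k'.
    case: eqP => _.
      by rewrite [LHS](eps_ZpN m) !mulr1 mul1r mulfVK // opprB addrC subrK.
    by rewrite [LHS](eps_ZpN 0) invr1 !(mulr0, mul0r) subr0.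
  case: (k =P i) => [ki|_]; last by rewrite !(mulr0, mul0r) subr0.
  by rewrite -ki eq_sym (negPf kk') !(mulr0, mul0r) subr0.
- have ij : i != j by rewrite neq_ltn Hs.
  have ji : j == i = false by rewrite eq_sym (negPf ij).
  have ijF := negPf ij.
  have em0 : eps ^+ (m : nat) != 0 by rewrite expf_neq0 ?eps_neq0.
  have E k : eps ^+ (cw_exp (refl (inr (i, j, m) : refl_index n l))^-1%g k : nat)
      = if k == i then eps ^+ m else if k == j then eps ^- m else 1.
    rewrite [cw_exp _ _]ffunE /= ffunE.
    case: tpermP => [->|->|/eqP ki /eqP kj].
    - by rewrite ji !eqxx [LHS](eps_ZpN (- m)) eps_ZpN invrK.
    - by rewrite ji !eqxx [LHS](eps_ZpN m).
    - by rewrite (negPf ki) (negPf kj) [LHS](eps_ZpN 0) invr1.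
  rewrite opprK divff // scale1r.
  apply/matrixP=> k k'; rewrite !mxE /= big_ord1 !mxE /= E tpermV.
  rewrite !eqxx !andbT /=.
  case: (tpermP i j k') => [->|->|/eqP k'i /eqP k'j].
  + rewrite eqxx ijF mulr0 subr0 mulr1.
    have [->|kj] := eqVneq k j; first by rewrite ji mulr1 !sub0r opprK.
    by case: eqP => _; rewrite mulr0 subr0 subrr.
  + rewrite eqxx ji sub0r mulr1.
    have [->|ki] := eqVneq k i.
      by rewrite ijF mulr0 subr0 mul1r sub0r opprK.
    case: eqP => _; last by rewrite mulr0 subr0 mul0r subr0.
    by rewrite sub0r mulr1 mulrNN mulVf // subrr.
  + rewrite (negPf k'i) (negPf k'j) mulr0 subrr mulr0 subr0.
    by case: eqP => // ->; rewrite (negPf k'i) (negPf k'j).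
Qed.

Lemma act_hdual_refl (s : refl_index n l) (x : 'rV[C]_n) : is_refl s ->
  act_hdual eps (refl s) x
  = x - ((1 - refl_eigenvalue eps s) / 2%:R * pairing x (refl_coroot eps s))
          *: refl_root eps s.
Proof.
move=> Hs; rewrite /act_hdual refl_rep_reflV // mulmxBr mulmx1 -scalemxAr.
rewrite mulmxA [x *m refl_coroot eps s]mx11_scalar mul_scalar_mx scalerA.
by rewrite -/(pairing _ _).
Qed.

Lemma pairing_root_coroot (s : refl_index n l) : is_refl s ->
  pairing (refl_root eps s) (refl_coroot eps s) = 2%:R.
Proof.
have em0 k : eps ^+ k != 0 by rewrite expf_neq0 ?eps_neq0.
case: s => [[i m]|[[i j] m]] /= Hs; rewrite /pairing.
  by rewrite -scalemxAr mul_delta_mx !mxE !eqxx mulr1.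
have ij : i != j by rewrite neq_ltn Hs.
rewrite mulmxBl !mulmxBr -!scalemxAl -!scalemxAr !mul_delta_mx_cond.
rewrite !eqxx (negPf ij) eq_sym (negPf ij) !mulr0n !mulr1n !scaler0 subr0 sub0r.
by rewrite scalerA mulrC mulVf // !mxE eqxx mulr1 opprK -mulr2n.
Qed.

Lemma refl_root_neq0 (s : refl_index n l) : is_refl s -> refl_root eps s != 0.
Proof.
move=> Hs; apply/eqP => r0; have := pairing_root_coroot Hs.
by rewrite r0 /pairing mul0mx mxE => /esym/eqP; rewrite (negPf two_neq0).
Qed.

Lemma refl_eigenvalue_neq1 (s : refl_index n l) :
  is_refl s -> refl_eigenvalue eps s != 1.
Proof.
case: s => [[i m]|[[i j] m]] /= Hs; first by rewrite invr_eq1 eps_Zp_neq1.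
by rewrite -subr_eq0 -opprD oppr_eq0 -mulr2n.
Qed.

Lemma act_hdual_root (s : refl_index n l) : is_refl s ->
  act_hdual eps (refl s) (refl_root eps s)
  = refl_eigenvalue eps s *: refl_root eps s.
Proof.
move=> Hs; rewrite act_hdual_refl // pairing_root_coroot // divfK //.
by rewrite -{1}[refl_root eps s]scale1r -scalerBl opprB addrC subrK.
Qed.

Lemma refl_hyperplane (s : refl_index n l) (y : 'cV[C]_n) : is_refl s ->
  act_h eps (refl s) y = y <-> pairing (refl_root eps s) y = 0.
Proof.
move=> Hs; set g := refl s.
have E : act_h eps g y = y <-> refl_rep eps g^-1%g *m y = y.
  have gV : refl_rep eps g^-1%g *m refl_rep eps g = 1%:M.
    by rewrite -refl_repM mulVg refl_rep1.
  have gVr : refl_rep eps g *m refl_rep eps g^-1%g = 1%:M.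
    by rewrite -refl_repM mulgV refl_rep1.
  split=> H; first by rewrite -{1}H mulmxA gV mul1mx.
  by rewrite /act_h -{1}H mulmxA gVr mul1mx.
apply: (iff_trans E).
have cr0 : refl_coroot eps s != 0.
  apply/eqP => r0; have := pairing_root_coroot Hs.
  by rewrite r0 /pairing mulmx0 mxE => /esym/eqP; rewrite (negPf two_neq0).
rewrite refl_rep_reflV // mulmxBl mul1mx -scalemxAl -mulmxA.
rewrite [refl_root eps s *m y]mx11_scalar mul_mx_scalar scalerA.
have t0 : (1 - refl_eigenvalue eps s) / 2%:R != 0.
  by rewrite mulf_neq0 ?invr_eq0 // subr_eq0 eq_sym refl_eigenvalue_neq1.
split=> [/eqP|]; last by rewrite /pairing => ->; rewrite mulr0 scale0r subr0.
rewrite -subr_eq0 addrAC subrr sub0r oppr_eq0 scaler_eq0 (negPf cr0) orbF.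
by rewrite mulf_eq0 (negPf t0) => /eqP.
Qed.

Lemma refl_dual_hyperplane (s : refl_index n l) (x : 'rV[C]_n) : is_refl s ->
  act_hdual eps (refl s) x = x <-> pairing x (refl_coroot eps s) = 0.
Proof.
move=> Hs; rewrite act_hdual_refl //.
have t0 : (1 - refl_eigenvalue eps s) / 2%:R != 0.
  by rewrite mulf_neq0 ?invr_eq0 // subr_eq0 eq_sym refl_eigenvalue_neq1.
split=> [/eqP|->]; last by rewrite mulr0 scale0r subr0.
rewrite -subr_eq0 addrAC subrr sub0r oppr_eq0 scaler_eq0.
by rewrite (negPf (refl_root_neq0 Hs)) orbF mulf_eq0 (negPf t0) => /eqP.
Qed.

Lemma lin_formE (x : 'rV[C]_n) (i : 'I_n) : (lin_form x)@_U_(i) = x 0 i.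
Proof.
rewrite raddf_sum /= (bigD1 i) //= mcoeffZ mcoeffX eqxx mulr1.
rewrite big1 ?addr0 // => j ji; rewrite mcoeffZ mcoeffX.
by rewrite eq_mnm1 (negPf ji) mulr0.
Qed.

Lemma mpoly_quotK (f a : {mpoly C[n]}) :
  (exists q, f = a * q) -> f = a * mpoly_quot f a.
Proof.
by move=> [q fq]; rewrite /mpoly_quot; case: xgetP => [x _ //|/(_ q)].
Qed.

Lemma dunkl_divisible (s : refl_index n l) (f : {mpoly C[n]}) : is_refl s ->
  f - act_poly eps (refl s) f
  = lin_form (refl_root eps s)
      * mpoly_quot (f - act_poly eps (refl s) f) (lin_form (refl_root eps s)).
Proof.
move=> Hs; apply: mpoly_quotK; set a := lin_form _.
pose D (f : {mpoly C[n]}) := exists q, f - act_poly eps (refl s) f = a * q.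
have D1 : D 1 by exists 0; rewrite /act_poly rmorph1 subrr mulr0.
have DM u v : D u -> D v -> D (u * v).
  move=> [q Hq] [q' Hq']; exists (q * v + act_poly eps (refl s) u * q').
  rewrite mulrDr mulrA -Hq mulrCA -Hq' /act_poly rmorphM /=.
  by rewrite mulrBl mulrBr addrA subrK.
have DX i : D 'X_i.
  exists (((1 - refl_eigenvalue eps s) / 2%:R
             * pairing (delta_mx 0 i) (refl_coroot eps s))%:MP).
  rewrite /act_poly comp_mpolyXU -tnth_nth tnth_mktuple rowE.
  have := act_hdual_refl (delta_mx 0 i) Hs; rewrite /act_hdual => ->.
  rewrite [RHS]mulrC mul_mpolyC.
  have -> : lin_form (delta_mx 0 i - ((1 - refl_eigenvalue eps s) / 2%:R
      * pairing (delta_mx 0 i) (refl_coroot eps s)) *: refl_root eps s)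
    = 'X_i - ((1 - refl_eigenvalue eps s) / 2%:R
      * pairing (delta_mx 0 i) (refl_coroot eps s)) *: a.
    rewrite /a /lin_form; set t := _ * pairing _ _.
    have -> : 'X_i = \sum_j (delta_mx 0 i : 'rV[C]_n) 0 j *: 'X_j :> {mpoly C[n]}.
      rewrite (bigD1 i) //= !mxE !eqxx scale1r big1 ?addr0 // => j ji.
      by rewrite !mxE (negPf ji) andbF scale0r.
    rewrite scaler_sumr -sumrB; apply: eq_bigr => j _.
    by rewrite !mxE scalerBl scalerA.
  by rewrite opprB addrC subrK.
elim/mpolyind: f => [|c m f _ _ [q Hq]].
  by exists 0; rewrite /act_poly raddf0 subrr mulr0.
have [q' Hq'] : D 'X_[m].
  rewrite mpolyXE_id; elim/big_ind: _ => // i _.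
  by elim: (m i) => [|k IH]; rewrite ?expr0 // exprS; apply: DM.
exists (c *: q' + q); rewrite mulrDr -scalerAr -Hq -Hq' /act_poly.
by rewrite raddfD /= linearZ /= scalerBr opprD addrACA.
Qed.

End CherednikFacts.

Definition zariski_open_in (C : fieldType) (l : nat) (E U : set (l.-tuple C)) :
    Prop :=
  exists F : set {mpoly C[l]},
    U = [set c | E c /\ exists2 f, F f & f.@[tnth c] != 0]%classic.

(* Main.v *)
(* For [c] in [E_r] let Phi(t) = prod_j (1 - x_j^l t)^k.  The coefficient f_i of
   t^(p-1) in x_i^q Phi(t) / (1 - x_i^l t) is killed by all Dunkl operators, so
   the f_i generate a [W]- and Dunkl-stable ideal of [C[x_1, ..., x_n]].  At a
   suitable point [c0] of [E_r] with [k = 0], one has f_i = x_i^r, and the matrix [gram c0]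
   of constant terms of D^J' x^J, for exponents J, J' less than [r], is diagonal
   and invertible.  On the line from any [c] in [E_r] to [c0], the ideal therefore
   has, for all but finitely many parameters, the span of these monomials as a
   complement, which is U_r^(x)n as a graded [W]-module.  The limit of these
   ideals at [c] is again stable and of the same codimension; the graded
   [W]-module structure of the quotient is preserved since finite group
   representations do not deform.
   If [det (gram c)] is nonzero, then every nonzero element of the quotient is
   sent by some word in the Dunkl operators to a nonzero multiple of the image of
   [1]; hence the quotient is irreducible. *)
From HB Require Import structures.
Require Import Defs.
From mathcomp Require Import all_boot all_order all_fingroup all_algebra.
From mathcomp Require Import generic_quotient.
From mathcomp Require Import boolp classical_sets reals complex.
From mathcomp Require Import mpoly ring zify.

Set Implicit Arguments.
Unset Strict Implicit.
Unset Printing Implicit Defensive.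

Import GRing.Theory Num.Theory.
Local Open Scope ring_scope.
Local Notation ev t := (map_mx (horner_eval t)).

(** The obstacle is that at special parameters the $f_i$ generate too small an ideal. For $n=1$,
    $f_1$ is the coefficient of $t^{p-1}$ in $x_1^q(1-x_1^lt)^{k-1}$, which is $0$ if $k=1$ and
    $p\ge2$, while $E_r$ then puts no condition on $k$. So the kernel at such $c$ is not given by
    generators. It is reached through equations instead: generically the ideal is the common kernel
    of the $r^n$ forms sending $f$ to the constant term of $D^Jf$, that is, of a matrix polynomial
    in the line parameter $t$. Its rank may drop at $t=0$; rows are then divided by $t$ until it
    does not. Stability passes to the limit because the Dunkl operators are affine in the parameter.
    The base point has $k=0$ because the variables then separate, and each Dunkl operator just
    lowers one exponent of a monomial. Irreducibility is proved for every quotient of $M_c$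
    isomorphic to $U_r^{\otimes n}$ as a graded $W$-module, so it is independent of how the limit
    was built. *)

Lemma mpoly_mulX_ind (n : nat) (C : nzRingType) (Q : {mpoly C[n]} -> Prop) :
  (forall a f g, Q f -> Q g -> Q (a *: f + g)) -> Q 1 ->
  (forall i f, Q f -> Q ('X_i * f)) -> forall f, Q f.
Proof.
move=> QD Q1 QX.
have Q0 : Q 0 by have := QD (-1) _ _ Q1 Q1; rewrite scaleN1r addNr.
elim/mpolyind=> // c m f _ _ Qf; apply: QD => //.
rewrite mpolyXE_id.
elim: (index_enum _) => [|i s IHs]; rewrite ?big_nil ?big_cons //.
by elim: (m i) => [|k IH]; rewrite ?expr0 ?mul1r // exprS -mulrA; apply: QX.
Qed.

(** * Dunkl operators *)

Section LinForm.
Variables (C : fieldType) (n : nat).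
Implicit Types (x : 'rV[C]_n).

Lemma lin_form_is_linear : linear (@lin_form C n).
Proof.
move=> a x x'; rewrite /lin_form scaler_sumr -big_split /=; apply: eq_bigr => i _.
by rewrite !mxE scalerDl scalerA.
Qed.
HB.instance Definition _ := GRing.isLinear.Build C 'rV[C]_n {mpoly C[n]} _
  (@lin_form C n) lin_form_is_linear.

Lemma lin_form_delta i : lin_form (delta_mx 0 i : 'rV[C]_n) = 'X_i.
Proof.
rewrite /lin_form (bigD1 i) //= !mxE !eqxx scale1r big1 ?addr0 // => j ji.
by rewrite !mxE (negPf ji) scale0r.
Qed.

Lemma lin_form_eq0 x : (lin_form x == 0) = (x == 0).
Proof.
apply/eqP/eqP=> [H|->]; last by rewrite raddf0.
by apply/rowP=> i; rewrite mxE -lin_formE H mcoeff0.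
Qed.

Lemma mderiv_lin_form x i : (lin_form x)^`M(i) = (x 0 i)%:MP.
Proof.
rewrite /lin_form linear_sum /= (bigD1 i) //= big1 ?addr0 => [|j ji].
  rewrite linearZ /= mderivX mnm1E eqxx scale1r -alg_mpolyC -mpolyX0.
  by congr (_ *: 'X_[_]); apply/mnmP=> j; rewrite mnmBE subnn mnm0E.
by rewrite linearZ /= mderivX mnm1E (negPf ji) scale0r scaler0.
Qed.

Lemma pairingPl a x x' y :
  pairing (a *: x + x') y = a * pairing x y + pairing x' y.
Proof. by rewrite /pairing mulmxDl -scalemxAl !mxE. Qed.
Lemma pairingDr x y y' : pairing x (y + y') = pairing x y + pairing x y'.
Proof. by rewrite /pairing mulmxDr !mxE. Qed.
Lemma pairingZr a x y : pairing x (a *: y) = a * pairing x y.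
Proof. by rewrite /pairing -scalemxAr !mxE. Qed.
Lemma pairing_delta i j : pairing (delta_mx 0 i) (delta_mx j 0 : 'cV[C]_n) = (i == j)%:R.
Proof.
by rewrite /pairing mul_delta_mx_cond mulrb; case: eqP; rewrite !mxE ?eqxx.
Qed.

End LinForm.

(* [act_poly], [dunkl] and the divided differences are locked: otherwise
   unification unfolds them down to the coefficients of polynomials. *)
Section Locked.
Variables (C : fieldType) (n l : nat) (eps : C).
Local Notation P := {mpoly C[n]}.

Definition wact (g : cyc_wreath n l) : P -> P := locked (act_poly eps g).
Lemma wactE g f : wact g f = act_poly eps g f.
Proof. by rewrite /wact -lock. Qed.

Definition dk (c : l.-tuple C) (y : 'cV[C]_n) : P -> P := locked (dunkl eps c y).
Lemma dkE c y f : dk c y f = dunkl eps c y f.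
Proof. by rewrite /dk -lock. Qed.

Definition dquot (s : refl_index n l) : P -> P := locked (fun f =>
  mpoly_quot (f - act_poly eps (refl s) f) (lin_form (refl_root eps s))).

End Locked.

Section Dunkl.
Variables (C : numFieldType) (n l : nat) (eps : C).
Hypotheses (hl : (1 < l)%N) (heps : l.-primitive_root eps).
Local Notation W := (cyc_wreath n l).
Local Notation P := {mpoly C[n]}.
Local Notation act := (wact eps).
Implicit Types (g h : W) (f : P).

Let two_neq0 : 2%:R != 0 :> C. Proof. by rewrite pnatr_eq0. Qed.

Lemma wactP g a f f' : act g (a *: f + f') = a *: act g f + act g f'.
Proof. by rewrite !wactE /act_poly comp_mpolyD comp_mpolyZ. Qed.
HB.instance Definition _ g := GRing.isLinear.Build C P P _
  (@wact C n l eps g) (wactP g).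
Lemma wact_is_monoid_morphism g : monoid_morphism (@wact C n l eps g).
Proof. by split=> [|f f']; rewrite !wactE /act_poly ?rmorph1 ?rmorphM. Qed.
HB.instance Definition _ g := GRing.isMonoidMorphism.Build P P
  (@wact C n l eps g) (wact_is_monoid_morphism g).

Lemma wact_lin g (x : 'rV[C]_n) :
  act g (lin_form x) = lin_form (act_hdual eps g x).
Proof.
rewrite wactE /lin_form /act_poly linear_sum /=.
under eq_bigr => i _ do rewrite comp_mpolyZ comp_mpolyXU -tnth_nth
  tnth_mktuple -/(lin_form _) -linearZ /=.
rewrite -linear_sum -/(lin_form _); congr lin_form.
by rewrite /act_hdual mulmx_sum_row.
Qed.

Lemma act_hdualM g h (x : 'rV[C]_n) :
  act_hdual eps (g * h)%g x = act_hdual eps g (act_hdual eps h x).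
Proof. by rewrite /act_hdual invMg (refl_repM hl heps) mulmxA. Qed.

Lemma act_hdual1 (x : 'rV[C]_n) : act_hdual eps (1%g : W) x = x.
Proof. by rewrite /act_hdual invg1 refl_rep1 mulmx1. Qed.

Lemma wactM g h f : act (g * h)%g f = act g (act h f).
Proof.
elim/mpoly_mulX_ind: f => [a f f' IH IH'||i f IH].
- by rewrite !wactP IH IH'.
- by rewrite !rmorph1.
- by rewrite !rmorphM /= IH -lin_form_delta !wact_lin act_hdualM.
Qed.

Lemma wact1 f : act (1%g : W) f = f.
Proof.
elim/mpoly_mulX_ind: f => [a f f' IH IH'||i f IH].
- by rewrite !wactP IH IH'.
- by rewrite !rmorph1.
- by rewrite !rmorphM /= IH -lin_form_delta !wact_lin act_hdual1.
Qed.

Lemma wactVK g : cancel (act g^-1%g) (act g).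
Proof. by move=> f; rewrite -wactM mulgV wact1. Qed.

Lemma wactX g i :
  act g 'X_i = eps ^- (cw_exp g (cw_perm g i)) *: 'X_(cw_perm g i).
Proof.
rewrite -lin_form_delta wact_lin /act_hdual -rowE.
rewrite (_ : row i _ = eps ^- (cw_exp g (cw_perm g i)) *: delta_mx 0 (cw_perm g i)).
  by rewrite linearZ /= lin_form_delta.
apply/rowP=> j; rewrite !mxE /= ffunE [in LHS]eq_sym.
rewrite (can2_eq (permKV _) (permK _)).
by case: eqP => _; rewrite ?mulr0 // mulr1 (eps_ZpN hl heps).
Qed.

Local Notation dquot := (dquot eps).
Section Reflection.
Variable s : refl_index n l.
Hypothesis hs : is_refl s.

Lemma dquotE f : f - act (refl s) f = lin_form (refl_root eps s) * dquot s f.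
Proof. by rewrite wactE /dquot -lock; apply: dunkl_divisible. Qed.

Lemma root_form_neq0 : lin_form (refl_root eps s) != 0 :> P.
Proof. by rewrite lin_form_eq0 (refl_root_neq0 hl heps). Qed.

Lemma dquot_unique f q :
  f - act (refl s) f = lin_form (refl_root eps s) * q -> dquot s f = q.
Proof. by rewrite dquotE; apply: mulfI root_form_neq0 _ _. Qed.

Lemma dquotP a f f' : dquot s (a *: f + f') = a *: dquot s f + dquot s f'.
Proof.
apply: dquot_unique; rewrite mulrDr -scalerAr -!dquotE wactP.
by rewrite scalerBr opprD addrACA.
Qed.

Lemma dquotM f f' :
  dquot s (f * f') = f * dquot s f' + dquot s f * act (refl s) f'.
Proof.
apply: dquot_unique; rewrite mulrDr mulrCA -dquotE mulrA -dquotE rmorphM /=.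
by ring.
Qed.

Lemma dquot_lin (x : 'rV[C]_n) : dquot s (lin_form x)
  = ((1 - refl_eigenvalue eps s) / 2%:R * pairing x (refl_coroot eps s))%:MP.
Proof.
apply: dquot_unique; rewrite wact_lin act_hdual_refl //.
by rewrite linearB linearZ /= opprB addrC subrK [RHS]mulrC mul_mpolyC.
Qed.

Lemma dquot_inv f : act (refl s) f = f -> dquot s f = 0.
Proof. by move=> H; apply: dquot_unique; rewrite H subrr mulr0. Qed.

End Reflection.

Variable c : l.-tuple C.

Definition refl_weight (s : refl_index n l) : C :=
  2%:R * refl_param c s / (1 - refl_eigenvalue eps s).

Local Notation D := (dk eps c).

Lemma dk_sumE y f : D y f
  = \sum_i y i 0 *: f^`M(i)
    - \sum_(s | is_refl s) (refl_weight s * pairing (refl_root eps s) y) *: dquot s f.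
Proof.
rewrite dkE /dunkl; congr (_ - _); apply: eq_bigr => s hs.
by rewrite /Defs.refl /refl_weight /dquot -lock.
Qed.

Lemma dkP y a f f' : D y (a *: f + f') = a *: D y f + D y f'.
Proof.
rewrite !dk_sumE.
under eq_bigr => i _ do rewrite linearP /= scalerDr scalerA [_ * a]mulrC -(scalerA a).
under [X in _ - X]eq_bigr => s hs do
  rewrite dquotP // scalerDr scalerA [_ * a]mulrC -(scalerA a).
by rewrite !big_split /= -!scaler_sumr scalerBr opprD addrACA.
Qed.

Lemma dk0 (y : 'cV[C]_n) : D y 0 = 0.
Proof. by have := dkP y (-1) 0 0; rewrite scaler0 addr0 scaleN1r addNr. Qed.
Lemma dkD (y : 'cV[C]_n) : {morph D y : f f' / f + f'}.
Proof. by move=> f f'; rewrite -[f in LHS]scale1r dkP scale1r. Qed.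
Lemma dkZ (y : 'cV[C]_n) a : {morph D y : f / a *: f}.
Proof. by move=> f; rewrite -[_ *: _ in LHS]addr0 dkP dk0 addr0. Qed.
Lemma dkB (y : 'cV[C]_n) : {morph D y : f f' / f - f'}.
Proof. by move=> f f'; rewrite -scaleN1r dkD dkZ scaleN1r. Qed.
Lemma dk_sum (y : 'cV[C]_n) I (r : seq I) (Q : pred I) F :
  D y (\sum_(i <- r | Q i) F i) = \sum_(i <- r | Q i) D y (F i).
Proof. exact: (big_morph (D y) (dkD y) (dk0 y)). Qed.

Lemma dkDl a y y' f :
  D (a *: y + y') f = a *: D y f + D y' f.
Proof.
rewrite !dk_sumE.
under eq_bigr => i _ do rewrite !mxE scalerDl -scalerA.
under [X in _ - X]eq_bigr => s hs do
  rewrite pairingDr pairingZr mulrDr mulrCA scalerDl -(scalerA a).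
by rewrite !big_split /= -!scaler_sumr scalerBr opprD addrACA.
Qed.

Lemma dkZl a y f : D (a *: y) f = a *: D y f.
Proof.
have D0 : D 0 f = 0.
  by have := dkDl (-1) 0 0 f; rewrite scaler0 addr0 scaleN1r addNr.
by have := dkDl a y 0 f; rewrite addr0 D0 addr0.
Qed.

Lemma dk1 (y : 'cV[C]_n) : D y 1 = 0.
Proof.
rewrite dk_sumE big1 ?sub0r => [|i _].
  by rewrite big1 ?oppr0 // => s hs; rewrite dquot_inv ?scaler0 ?rmorph1.
by rewrite -mpolyC1 mderivC scaler0.
Qed.

(** The reflection term of $[y,x]$ in the relations of $H_c$, as an operator on polynomials. *)
Definition refl_op (x : 'rV[C]_n) (y : 'cV[C]_n) f : P :=
  \sum_(s | is_refl s) (refl_param c s * pairing (refl_root eps s) y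
    * pairing x (refl_coroot eps s)) *: act (refl s) f.

(** The factor $(1-\lambda_s)/2$ in the divided difference of a linear form cancels
    $2/(1-\lambda_s)$ in the Dunkl operator; what remains is the commutation relation of $H_c$. *)
Lemma dk_mul_lin x y f : D y (lin_form x * f)
  = lin_form x * D y f + pairing x y *: f - refl_op x y f.
Proof.
rewrite !dk_sumE /refl_op mulrBr !mulr_sumr.
under [X in X - _]eq_bigr => i _ do rewrite mderivM scalerDr addrC scalerAr.
rewrite big_split /= -!addrA; congr (_ + _).
have -> : \sum_i y i 0 *: ((lin_form x)^`M(i) * f) = pairing x y *: f.
  rewrite /pairing mxE scaler_suml; apply: eq_bigr => i _.
  by rewrite mderiv_lin_form mul_mpolyC scalerA mulrC.
rewrite [RHS]addrCA -opprD; congr (_ - _).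
rewrite -big_split /=; apply: eq_bigr => s hs.
rewrite -scalerAr dquotM // scalerDr; congr (_ + _).
rewrite dquot_lin // mul_mpolyC scalerA; congr (_ *: _).
have := refl_eigenvalue_neq1 hl heps two_neq0 hs; rewrite eq_sym -subr_eq0 => e0.
by rewrite /refl_weight; field.
Qed.

Lemma dk_mulX i y f : D y ('X_i * f)
  = 'X_i * D y f + y i 0 *: f - refl_op (delta_mx 0 i) y f.
Proof.
by rewrite -lin_form_delta dk_mul_lin /pairing -rowE mxE.
Qed.

End Dunkl.

(** * Conjugation of reflections *)

Section ReflConj.
Variables n l : nat.
Local Notation W := (cyc_wreath n l).
Implicit Types (g : W) (s : refl_index n l).

(** The index of $gsg^{-1}$. The images of $i<j$ may come in decreasing order; the pair is then
    exchanged and the exponent negated, which names the same reflection. *)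
Definition refl_conj g s : refl_index n l :=
  match s with
  | inl (i, m) => inl (cw_perm g i, m)
  | inr (i, j, m) =>
      let i' := cw_perm g i in let j' := cw_perm g j in
      let m' := m + cw_exp g i' - cw_exp g j' in
      if (i' < j')%N then inr (i', j', m') else inr (j', i', - m')
  end.

Lemma refl_swap (i j : 'I_n) (m : 'Z_l) : i != j ->
  refl (inr (j, i, - m)) = refl (inr (i, j, m)) :> W.
Proof.
move=> ij; congr CycWreath; first by rewrite tpermC.
apply/ffunP=> k; rewrite !ffunE opprK.
by case: eqP => // ->; rewrite eq_sym (negPf ij).
Qed.

Lemma is_refl_conj g s : is_refl s -> is_refl (refl_conj g s).
Proof.
case: s => [[i m]|[[i j] m]] //= ij; case: ifP => //= /negbT.
rewrite -leqNgt leq_eqVlt => /orP[/eqP/val_inj/perm_inj ji|//].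
by rewrite ji ltnn in ij.
Qed.

Lemma refl_conjM g s : is_refl s ->
  (refl (refl_conj g s) * g = g * refl s)%g.
Proof.
case: s => [[i m]|[[i j] m]] /= hs.
  congr CycWreath => /=; first by rewrite mulg1 mul1g.
  apply/ffunP=> k; rewrite !ffunE /= invg1 perm1 addrC; congr (_ + _).
  by rewrite (can2_eq (permKV _) (permK _)).
set i' := cw_perm g i; set j' := cw_perm g j; set m' := _ - _.
have ij' : i' != j' by rewrite (inj_eq perm_inj) neq_ltn hs.
suff H : (refl (inr (i', j', m')) * g = g * refl (inr (i, j, m)))%g.
  by case: ifP => _ //; rewrite refl_swap.
congr CycWreath => /=; first by rewrite -tpermJ conjgE mulKVg.
apply/ffunP=> k; rewrite !ffunE /= tpermV !(can2_eq (permKV _) (permK _)) -/i' -/j'.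
case: tpermP => [->|->|/eqP/negPf-> /eqP/negPf->]; last by rewrite addrC.
  by rewrite eqxx /m' subrK addrC.
by rewrite [j' == i']eq_sym (negPf ij') eqxx /m' opprB opprD addrA subrK.
Qed.

Lemma refl_inj s s' : is_refl s -> is_refl s' -> refl s = refl s' :> W -> s = s'.
Proof.
case: s => [[i m]|[[i j] m]]; case: s' => [[i' m']|[[i' j'] m']] /= hs hs' H.
- have := congr1 (fun g : W => cw_exp g i) H; rewrite /= !ffunE eqxx.
  by case: eqP => [-> ->|_ m0] //; rewrite m0 eqxx in hs.
- have := congr1 (fun g : W => cw_perm g i') H; rewrite /= perm1 tpermL => ij.
  by rewrite ij ltnn in hs'.
- have := congr1 (fun g : W => cw_perm g i) H; rewrite /= perm1 tpermL => ij.
  by rewrite ij ltnn in hs.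
- have Hi := congr1 (fun g : W => cw_perm g i) H.
  have Hj := congr1 (fun g : W => cw_perm g j) H.
  have Hm := congr1 (fun g : W => cw_exp g i) H.
  move: Hi Hj Hm; rewrite /= !ffunE eqxx tpermL tpermR.
  case: tpermP => [ii'|ij'|_ _ ji]; last by rewrite ji ltnn in hs.
    by move=> -> _; rewrite -ii' eqxx => ->.
  by move=> ji'; rewrite ij' ji' in hs; have := ltn_trans hs hs'; rewrite ltnn.
Qed.

(** Both indices name the same element of $W$, so [refl_inj] spares any tracking of orders and
    exponents. *)
Lemma refl_conjK g s : is_refl s -> refl_conj g (refl_conj g^-1%g s) = s.
Proof.
move=> hs; apply: refl_inj => //; first by do 2!apply: is_refl_conj.
apply: (mulIg g); rewrite refl_conjM ?is_refl_conj //.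
by apply: (mulgI g^-1%g); rewrite mulKg mulgA -refl_conjM // mulgKV.
Qed.

Lemma refl_conj_reindex (V : nmodType) g (F : refl_index n l -> V) :
  \sum_(s | is_refl s) F s = \sum_(s | is_refl s) F (refl_conj g s).
Proof.
rewrite (reindex_onto (refl_conj g) (refl_conj g^-1%g)); last first.
  by move=> s; apply: refl_conjK.
apply: eq_bigl => s; apply/andP/idP => [[hs /eqP<-]|hs].
  exact: is_refl_conj.
by have := refl_conjK g^-1%g hs; rewrite invgK is_refl_conj // => ->.
Qed.

End ReflConj.

Section DunklEquiv.
Variables (C : numFieldType) (n l : nat) (eps : C).
Hypotheses (hl : (1 < l)%N) (heps : l.-primitive_root eps).
Variable c : l.-tuple C.
Local Notation W := (cyc_wreath n l).
Local Notation P := {mpoly C[n]}.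
Local Notation act := (wact eps).
Local Notation D := (dk eps c).
Implicit Types (g h : W) (f : P) (x : 'rV[C]_n) (y : 'cV[C]_n).

Let two_neq0 : 2%:R != 0 :> C. Proof. by rewrite pnatr_eq0. Qed.

Lemma refl_weight_conj g s :
  refl_weight eps c (refl_conj g s) = refl_weight eps c s :> C.
Proof.
by case: s => [[i m]|[[i j] m]] //=; rewrite /refl_weight; case: ifP.
Qed.

(** Roots and coroots are permuted by $W$ only up to scalars. Expressing their product through
    $x-sx$ removes the scalars, so that conjugation by $g$ becomes a mere reindexing. *)
Lemma refl_opE x y f : refl_op eps c x y f
  = \sum_(s | is_refl s) (refl_weight eps c s
      * pairing (x - act_hdual eps (refl s : W) x) y) *: act (refl s) f.
Proof.
rewrite /refl_op; apply: eq_bigr => s hs; congr (_ *: _).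
rewrite act_hdual_refl // opprB addrC subrK.
have -> : forall a (z : 'rV[C]_n), pairing (a *: z) y = a * pairing z y.
  by move=> a z; rewrite /pairing -scalemxAl mxE.
have := refl_eigenvalue_neq1 hl heps two_neq0 hs; rewrite eq_sym -subr_eq0 => e0.
by rewrite /refl_weight; field.
Qed.

Lemma pairing_act g x y : pairing (act_hdual eps g x) (act_h eps g y) = pairing x y.
Proof.
rewrite /pairing /act_hdual /act_h -mulmxA [X in x *m X]mulmxA.
by rewrite -(refl_repM hl heps) mulVg refl_rep1 mul1mx.
Qed.

Lemma act_refl_op g x y f :
  act g (refl_op eps c x y f)
  = refl_op eps c (act_hdual eps g x) (act_h eps g y) (act g f).
Proof.
rewrite !refl_opE [RHS](refl_conj_reindex g) linear_sum; apply: eq_bigr => s hs.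
rewrite linearZ /= refl_weight_conj -!(wactM hl heps) refl_conjM //.
rewrite -(act_hdualM hl heps) refl_conjM // (act_hdualM hl heps) -(pairing_act g).
by rewrite /act_hdual mulmxBl.
Qed.

(** Both sides agree on $1$ and obey the same commutation rule with linear forms, because [refl_op]
    is equivariant; no divided difference has to be conjugated. *)
Lemma wact_dk g y f : act g (D y f) = D (act_h eps g y) (act g f).
Proof.
elim/mpoly_mulX_ind: f => [a f f' IH IH'||i f IH].
- by rewrite dkP // !wactP dkP // IH IH'.
- by rewrite rmorph1 !dk1 // linear0.
rewrite -lin_form_delta dk_mul_lin // rmorphM /= wact_lin.
rewrite dk_mul_lin // linearB linearD linearZ /= rmorphM /= wact_lin IH.
by rewrite act_refl_op pairing_act.
Qed.

(** The operator $1-s$ has rank one, so [v] does not depend on the vector. In [dkC] this makes the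
    reflection terms symmetric in the two directions. *)
Lemma act_h_refl s y : is_refl s ->
  exists v : 'cV[C]_n, forall y, y - act_h eps (refl s : W) y
                                 = pairing (refl_root eps s) y *: v.
Proof.
move=> hs; pose a := (1 - refl_eigenvalue eps s) / 2%:R.
exists (- a *: act_h eps (refl s : W) (refl_coroot eps s)) => z.
have H : refl_rep eps (refl s : W) *m refl_rep eps (refl s)^-1%g = 1%:M.
  by rewrite -(refl_repM hl heps) mulgV refl_rep1.
rewrite (refl_rep_reflV hl heps) // mulmxBr mulmx1 -scalemxAr mulmxA in H.
rewrite -{1}[z]mul1mx -H mulmxBl /act_h addrC addKr -scalemxAl -mulmxA.
rewrite !mulmxA -[_ *m z]mulmxA [refl_root eps s *m z]mx11_scalar mul_mx_scalar.
rewrite -/(pairing _ _) /a.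
by rewrite !scalerA mulrN scaleNr mulrC.
Qed.

(* [[D y, D y']] kills [1] and commutes with the multiplications by linear forms. *)
Lemma dkC y y' f : D y (D y' f) = D y' (D y f).
Proof.
elim/mpoly_mulX_ind: f => [a f f' IH IH'||i f IH].
- by rewrite !dkP // IH IH'.
- by rewrite !dk1 // !dk0.
rewrite -lin_form_delta; set x := delta_mx _ _.
rewrite !dk_mul_lin // !(dkB, dkD, dkZ) // !dk_mul_lin // IH.
apply/eqP; rewrite -subr_eq0; apply/eqP.
pose E y y' := D y (refl_op eps c x y' f) - refl_op eps c x y' (D y f).
transitivity (E y' y - E y y'); first by rewrite /E; ring.
suff -> : E y' y = E y y' by rewrite subrr.
have EE u v : E u v = \sum_(s | is_refl s) (refl_param c s
    * pairing (refl_root eps s) v * pairing x (refl_coroot eps s))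
      *: D (u - act_h eps (refl s : W) u) (act (refl s) f).
  rewrite /E /refl_op dk_sum // -sumrB; apply: eq_bigr => s _.
  rewrite dkZ // wact_dk -scalerBr addrC -scaleN1r; congr (_ *: _).
  by rewrite -dkDl // scaleN1r addrC.
rewrite !EE; apply: eq_bigr => s hs; have [v Hv] := act_h_refl y hs.
by rewrite !Hv !dkZl // !scalerA; congr (_ *: _); ring.
Qed.

End DunklEquiv.

(** * Modules over a presented algebra *)

Section PresentedModule.
Import monalg.
Variables (C : fieldType) (X : choiceType) (I : finType).
Local Notation V := {ffun I -> C^o}.
Local Notation free := (free_alg C X).
Variable op : X -> V -> V.
Hypothesis opP : forall x a u v, op x (a *: u + v) = a *: op x u + op x v.

Definition word_act (w : fmonom X) (v : V) : V := foldr op v w.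

Lemma word_actP w a u v :
  word_act w (a *: u + v) = a *: word_act w u + word_act w v.
Proof. by rewrite /word_act; elim: (w : seq X) => //= x s ->. Qed.

Lemma word_actM (w w' : fmonom X) v :
  word_act (mmul w w') v = word_act w (word_act w' v).
Proof. by rewrite /word_act fmM foldr_cat. Qed.

Definition free_act (u : free) : V -> V := locked (fun v : V =>
  [ffun i => mmap idfun (fun w => word_act w v i : C) u]).

Lemma free_actDl a u u' v :
  free_act (a *: u + u') v = a *: free_act u v + free_act u' v.
Proof.
rewrite /free_act -!lock; apply/ffunP=> i; rewrite !ffunE mmapD; congr (_ + _).
rewrite (mmapEw (msuppZ_le a u)) mmapE [RHS]mulr_sumr.
by apply: eq_bigr => w _; rewrite mcoeffZ mulrA.
Qed.

Lemma free_actU a w v : free_act (mkmalgU w a) v = a *: word_act w v.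
Proof. by rewrite /free_act -!lock; apply/ffunP=> i; rewrite !ffunE mmapU. Qed.

Lemma free_act0l v : free_act 0 v = 0.
Proof. by rewrite /free_act -!lock; apply/ffunP=> i; rewrite !ffunE mmap0. Qed.

Lemma free_actD u u' v : free_act (u + u') v = free_act u v + free_act u' v.
Proof. by rewrite -[u in LHS]scale1r free_actDl scale1r. Qed.

Lemma free_actZ a u v : free_act (a *: u) v = a *: free_act u v.
Proof. by have := free_actDl a u 0 v; rewrite free_act0l !addr0. Qed.

Lemma free_actB u u' v : free_act (u - u') v = free_act u v - free_act u' v.
Proof. by rewrite addrC -scaleN1r free_actDl scaleN1r addrC. Qed.

Lemma free_act_sum J (s : seq J) (Q : pred J) F v :
  free_act (\sum_(j <- s | Q j) F j) v = \sum_(j <- s | Q j) free_act (F j) v.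
Proof.
by apply: (big_morph (free_act^~ v)) => [u u'|]; [apply: free_actD|apply: free_act0l].
Qed.

Lemma free_ind (Q : free -> Prop) : Q 0 ->
  (forall a w u, Q u -> Q (mkmalgU w a + u)) -> forall u, Q u.
Proof.
move=> Q0 QD u; rewrite (monalgE u).
by elim: (X in \sum_(k <- X) _) => [|k s IH]; rewrite ?big_nil ?big_cons //;
  apply: QD.
Qed.

Lemma free_actDr u a v v' :
  free_act u (a *: v + v') = a *: free_act u v + free_act u v'.
Proof.
elim/free_ind: u => [|b w u IH]; first by rewrite !free_act0l scaler0 addr0.
rewrite !free_actD IH !free_actU word_actP !scalerDr.
by rewrite !scalerA [b * a]mulrC addrACA.
Qed.

Lemma free_act0r u : free_act u 0 = 0.
Proof.
by have := free_actDr u (-1) 0 0; rewrite scaler0 addr0 scaleN1r addNr.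
Qed.

Lemma free_actZr u a v : free_act u (a *: v) = a *: free_act u v.
Proof. by have := free_actDr u a v 0; rewrite free_act0r !addr0. Qed.

Lemma word_actZ w a v : word_act w (a *: v) = a *: word_act w v.
Proof. by have := free_actZr (mkmalgU w 1) a v; rewrite !free_actU !scale1r. Qed.

Lemma free_actM u u' v : free_act (u * u') v = free_act u (free_act u' v).
Proof.
elim/free_ind: u => [|a w u IH]; first by rewrite mul0r !free_act0l.
rewrite mulrDl !free_actD; congr (_ + _); last exact: IH.
elim/free_ind: u' {IH} => [|b w' u' IH].
  by rewrite mulr0 free_act0l free_act0r.
have := free_actDr (mkmalgU w a) 1 (free_act (mkmalgU w' b) v) (free_act u' v).
rewrite mulrDr !free_actD !scale1r => ->; congr (_ + _); last exact: IH.
by rewrite malgM_def fgmulUU !free_actU word_actM word_actZ scalerA.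
Qed.

Lemma free_act_gen x v : free_act (free_gen C x) v = op x v.
Proof. by rewrite /free_gen free_actU scale1r /word_act fmU. Qed.

Lemma free_act1 v : free_act 1 v = v.
Proof.
by rewrite free_actU scale1r /word_act fm1.
Qed.

Variable rel : free -> free -> Prop.
Hypothesis op_rel : forall u u', rel u u' -> free_act u =1 free_act u'.

(** The elements acting by zero form a two-sided ideal containing the relations, hence contain the
    smallest such ideal; so the action is independent of the representative. *)
Lemma free_act_repr u v : free_act (repr (pres_proj rel u)) v = free_act u v.
Proof.
have /pres_proj_eq/asboolP : pres_proj rel (repr (pres_proj rel u)) = pres_proj rel u.
  exact: reprK.
move=> /(_ (fun u => forall v, free_act u v = 0)) H.
apply/eqP; rewrite -subr_eq0 -free_actB; apply/eqP; apply: H => {u v}.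
- exact: free_act0l.
- by move=> u u' H H' v; rewrite free_actD H H' addr0.
- by move=> a u b H v; rewrite !free_actM H free_act0r.
- by move=> u u' /op_rel H v; rewrite free_actB H subrr.
Qed.

End PresentedModule.

Section PresentedModuleType.
Variables (C : fieldType) (X : choiceType) (I : finType).
Variables (op : X -> {ffun I -> C^o} -> {ffun I -> C^o})
  (opP : forall x a u v, op x (a *: u + v) = a *: op x u + op x v)
  (rel : free_alg C X -> free_alg C X -> Prop)
  (op_rel : forall u u', rel u u' -> free_act op u =1 free_act op u').

(** The two hypotheses are arguments of the type so that a module structure depending on them can be
    attached to it. *)
Definition pres_mod of (forall x a u v, op x (a *: u + v) = a *: op x u + op x v)
  & (forall u u', rel u u' -> free_act op u =1 free_act op u') : Type :=
  {ffun I -> C^o}.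
Local Notation M := (pres_mod opP op_rel).
HB.instance Definition _ := GRing.Zmodule.on M.

Definition pres_mod_scale (a : pres_alg rel) (v : M) : M := free_act op (repr a) v.

Lemma pres_mod_scaleE u (v : M) : pres_mod_scale (pres_proj rel u) v = free_act op u v.
Proof. exact: (free_act_repr opP op_rel). Qed.

Let projK (a : pres_alg rel) : pres_proj rel (repr a) = a.
Proof. exact: reprK. Qed.

Let scaleA a b v : pres_mod_scale a (pres_mod_scale b v) = pres_mod_scale (a * b) v.
Proof.
rewrite -(projK a) -(projK b) -rmorphM !pres_mod_scaleE.
exact/esym/(free_actM opP).
Qed.
Let scale1 : left_id 1 pres_mod_scale.
Proof. by move=> v; rewrite -(rmorph1 (pres_proj rel)) pres_mod_scaleE free_act1. Qed.
Let scaleDr : right_distributive pres_mod_scale +%R.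
Proof.
move=> a v v'; have := free_actDr opP (repr a) 1 v v'.
by rewrite !scale1r.
Qed.
Let scaleDl v : {morph pres_mod_scale^~ v : a b / a + b}.
Proof.
move=> a b; rewrite -(projK a) -(projK b) -rmorphD !pres_mod_scaleE.
exact: free_actD.
Qed.
HB.instance Definition _ := GRing.Zmodule_isLmodule.Build (pres_alg rel) M
  scaleA scale1 scaleDr scaleDl.

Lemma pres_gen_scale x (v : M) : pres_gen rel x *: v = op x v.
Proof. by rewrite [LHS]pres_mod_scaleE free_act_gen. Qed.

Lemma pres_scalar_scale a (v : M) : pres_scalar rel a *: v = a *: (v : {ffun I -> C^o}).
Proof.
rewrite [LHS]pres_mod_scaleE.
have := free_actDl op a 1 0 v.
by rewrite addr0 (free_act0l op v) addr0 (free_act1 op v).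
Qed.

End PresentedModuleType.

(** * From a stable kernel to a module over $H_c$ *)

Section CherednikModule.
Variables (C : numFieldType) (n l r : nat) (eps : C).
Hypotheses (hl : (1 < l)%N) (heps : l.-primitive_root eps).
Variable c : l.-tuple C.
Local Notation W := (cyc_wreath n l).
Local Notation P := {mpoly C[n]}.
Local Notation V := (U_tensor C n r).
Local Notation act := (wact eps).
Local Notation D := (dk eps c).

(** On [V] only the action of $W$ is given in advance. Linear forms and Dunkl operators are asked to
    preserve the kernel, and their action on [V] is then induced. *)
Definition quotient_map (pi : P -> V) : Prop :=
  [/\ forall a f f', pi (a *: f + f') = a *: pi f + pi f',
      forall (g : W) f, pi (act g f) = U_tensor_act eps g (pi f),
      forall x f, pi f = 0 -> pi (lin_form x * f) = 0,
      forall y f, pi f = 0 -> pi (D y f) = 0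
    & forall v, exists f, pi f = v].

Variable pi : P -> V.
Hypothesis hpi : quotient_map pi.

Let piP a f f' : pi (a *: f + f') = a *: pi f + pi f'.
Proof. by case: hpi. Qed.
Let pi0 : pi 0 = 0.
Proof. by have := piP (-1) 0 0; rewrite scaler0 addr0 scaleN1r addNr. Qed.
Let piZ a f : pi (a *: f) = a *: pi f.
Proof. by have := piP a f 0; rewrite !addr0 pi0 addr0. Qed.
Let piD f f' : pi (f + f') = pi f + pi f'.
Proof. by have := piP 1 f f'; rewrite !scale1r. Qed.
Let piB f f' : pi (f - f') = pi f - pi f'.
Proof. by have := piP (-1) f' f; rewrite !scaleN1r addrC => ->; rewrite addrC. Qed.
Let pi_sum J (s : seq J) (Q : pred J) F :
  pi (\sum_(j <- s | Q j) F j) = \sum_(j <- s | Q j) pi (F j).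
Proof. exact: big_morph. Qed.

Let lift_basis : {f : {ffun 'I_n -> 'I_r} -> P |
  forall J, pi (f J) = [ffun J' => (J' == J)%:R]}.
Proof.
apply: cid; case: hpi => _ _ _ _ surj.
by have [f Hf] := boolp.choice (fun J => surj [ffun J' => (J' == J)%:R]); exists f.
Qed.

(** An arbitrary linear section of [pi]; by [lift_op] the induced operators do not depend on it. *)
Let lift (v : V) : P := \sum_J v J *: sval lift_basis J.

Let lift_linear a u v : lift (a *: u + v) = a *: lift u + lift v.
Proof.
rewrite /lift scaler_sumr -big_split; apply: eq_bigr => J _ /=.
by rewrite !ffunE scalerDl scalerA.
Qed.

Let liftK v : pi (lift v) = v.
Proof.
rewrite /lift pi_sum; apply/ffunP=> J; rewrite sum_ffunE (bigD1 J) //= big1.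
  by rewrite addr0 piZ (svalP lift_basis) !ffunE eqxx [LHS]mulr1.
move=> J' JJ'; rewrite piZ (svalP lift_basis) !ffunE.
by rewrite eq_sym (negPf JJ') [LHS]mulr0.
Qed.

Let lift_op (T : P -> P) : (forall f f', T (f - f') = T f - T f') ->
  (forall f, pi f = 0 -> pi (T f) = 0) ->
  forall f, pi (T (lift (pi f))) = pi (T f).
Proof.
move=> TB T0 f; apply/eqP; rewrite -subr_eq0 -piB -TB T0 //.
by rewrite piB liftK subrr.
Qed.

Definition quot_op (x : cherednik_gen C n l) (v : V) : V :=
  match x with
  | inl (inl g) => U_tensor_act eps g v
  | inl (inr x) => pi (lin_form x * lift v)
  | inr y => pi (D y (lift v))
  end.

Let op_W g f : quot_op (inl (inl g)) (pi f) = pi (act g f).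
Proof. by case: hpi => _ /= ->. Qed.
Let op_X x f : quot_op (inl (inr x)) (pi f) = pi (lin_form x * f).
Proof.
apply: (lift_op (T := fun f => lin_form x * f)) => [f1 f2|]; first exact: mulrBr.
by case: hpi => _ _ hX _ _; apply: hX.
Qed.
Let op_Y y f : quot_op (inr y) (pi f) = pi (D y f).
Proof. by apply: lift_op => [f1 f2|]; [rewrite dkB|case: hpi => _ _ _ hY _; apply: hY]. Qed.

Lemma quot_opP x a u v : quot_op x (a *: u + v) = a *: quot_op x u + quot_op x v.
Proof.
case: x => [[g|x]|y] /=.
- apply/ffunP=> J; rewrite !ffunE scalerDr; congr (_ + _).
  by rewrite !scalerA mulrC.
- by rewrite lift_linear mulrDr -scalerAr piP.
- by rewrite lift_linear dkP // piP.
Qed.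

Let act_W g f : free_act quot_op (@genW C n l g) (pi f) = pi (act g f).
Proof. by rewrite free_act_gen op_W. Qed.
Let act_X x f : free_act quot_op (@genX C n l x) (pi f) = pi (lin_form x * f).
Proof. by rewrite free_act_gen op_X. Qed.
Let act_Y y f : free_act quot_op (@genY C n l y) (pi f) = pi (D y f).
Proof. by rewrite free_act_gen op_Y. Qed.

Lemma quot_op_rel u u' :
  cherednik_rel eps c u u' -> free_act quot_op u =1 free_act quot_op u'.
Proof.
have fM := free_actM quot_opP.
move=> Huu' v; case: hpi => _ _ _ _ /(_ v) [f <-{v}].
case: Huu' => [|g g'|a x x'|a y y'|g x|g y|x x'|y y'|y x].
- by rewrite act_W wact1 free_act1.
- by rewrite fM !act_W (wactM hl heps).
- by rewrite free_actDl !act_X linearP /= mulrDl -scalerAl piP.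
- by rewrite free_actDl !act_Y dkDl piP.
- rewrite !fM act_W act_X act_W act_X rmorphM /= wact_lin.
  by rewrite (wactVK hl heps).
- by rewrite !fM act_W act_Y act_W act_Y (wact_dk hl heps) (wactVK hl heps).
- by rewrite [LHS]fM [RHS]fM !act_X; congr (pi _); exact: mulrCA.
- by rewrite [LHS]fM [RHS]fM !act_Y (dkC hl heps).
- rewrite [LHS]free_actB [RHS]free_actB [X in X - _ = _]fM [X in _ - X = _]fM.
  rewrite act_X !act_Y act_X (dk_mul_lin hl heps) -piB.
  rewrite free_actZ free_act1 free_act_sum.
  have -> : lin_form x * D y f + pairing x y *: f - refl_op eps c x y f
      - lin_form x * D y f = pairing x y *: f - refl_op eps c x y f by ring.
  rewrite piB piZ; congr (_ - _); rewrite pi_sum; apply: eq_bigr => s _.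
  by rewrite free_actZ act_W piZ.
Qed.

Lemma cherednik_quotient :
  (forall d f, f \is d.-homog -> U_tensor_homog d (pi f)) ->
  exists (Y : lmodType (cherednik n eps c)) (piY : P -> Y) (phi : Y -> V),
    poly_rep_quotient piY /\ graded_W_iso piY phi.
Proof.
move=> hgr; exists (pres_mod quot_opP quot_op_rel), pi, id.
have scaleC a (v : pres_mod quot_opP quot_op_rel) : chC n eps c a *: v = a *: (v : V).
  exact: pres_scalar_scale.
split; split.
- by move=> a f f'; rewrite scaleC piP.
- by move=> g f; rewrite -wactE [RHS]pres_gen_scale op_W.
- by move=> x f; rewrite [RHS]pres_gen_scale op_X.
- by move=> y f; rewrite -dkE [RHS]pres_gen_scale op_Y.
- by case: hpi.
- by move=> a v v'; rewrite scaleC.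
- by exists id.
- by move=> g v; rewrite pres_gen_scale.
move=> d v; split=> [[f hf <-]|hv]; first exact: hgr.
case: hpi => _ _ _ _ /(_ v) [f fv].
(* A preimage of a homogeneous [v] may be replaced by its degree [d] component, since the other
   components have images supported in other degrees. *)
exists (pihomog mdeg d f); first exact: pihomogP.
have pi_off e (J : {ffun 'I_n -> 'I_r}) :
    (\sum_i (J i : nat))%N <> e -> pi (pihomog mdeg e f) J = 0.
  by move=> Je; apply/eqP/contraT=> /(hgr e _ (pihomogP _ _ _) J) /Je.
apply/ffunP=> J; have [Jd|/eqP Jd] := eqVneq (\sum_i (J i : nat))%N d; last first.
  by rewrite pi_off //; apply/esym/eqP/contraT=> /hv /Jd.
have := pihomog_partitionE (leq_maxl (msize f) d.+1) => fE.
have piE : pi f J = \sum_(e < maxn (msize f) d.+1) pi (pihomog mdeg e f) J.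
  by rewrite {1}fE pi_sum; exact: sum_ffunE.
rewrite -fv piE (bigD1 (Ordinal (leq_maxr (msize f) d.+1))) //= big1 ?addr0 //.
move=> e ed; apply: pi_off => Je; case/eqP: ed; apply: val_inj => /=.
by rewrite -Je; exact: Jd.
Qed.

End CherednikModule.

(** * Limits of kernels *)

Section PolyGeneric.
Variable C : numFieldType.
Implicit Types p b : {poly C}.

Lemma poly_nonroot p : p != 0 -> exists t, p.[t] != 0.
Proof.
move=> p0; apply: contrapT => H.
pose s : seq C := [seq i%:R | i <- iota 0 (size p)].
have us : uniq s by rewrite map_inj_uniq ?iota_uniq // => i j /eqP; rewrite eqr_nat => /eqP.
have rs : all (root p) s.
  apply/allP=> x _; apply/negPn/negP => px; apply: H; exists x; exact: px.
by have := max_poly_roots p0 rs us; rewrite size_map size_iota ltnn.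
Qed.

Lemma poly_generic_eq0 p b : b != 0 -> (forall t, b.[t] != 0 -> p.[t] = 0) -> p = 0.
Proof.
move=> b0 H; apply/eqP/contraT => p0.
have [t] := poly_nonroot (mulf_neq0 p0 b0).
by rewrite hornerM; have [->|/H->] := eqVneq b.[t] 0; rewrite ?mul0r ?mulr0 eqxx.
Qed.

End PolyGeneric.

Section Saturation.
Variables (C : numFieldType) (m N : nat).
Implicit Types (Q : 'M[{poly C}]_(m, N)).

(* A linear relation between the rows of [Q] at [t = 0] allows to divide one row
   by [t]. *)
Lemma saturation_step Q (S : 'M[{poly C}]_(N, m)) :
  \det (Q *m S) != 0 -> ~~ row_free (ev 0 Q) ->
  exists G Q', [/\ Q = G *m Q', \det G != 0
    & (size (\det (Q' *m S)) < size (\det (Q *m S)))%N].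
Proof.
move=> dQ; rewrite -kermx_eq0 => /rowV0Pn[v /sub_kermxP vQ v0].
have [j0 vj0] : exists j, v 0 j != 0.
  apply/existsP; apply: contraNT v0; rewrite negb_exists => /forallP H.
  by apply/eqP/rowP=> j; rewrite mxE; have := H j; rewrite negbK => /eqP.
pose vp : 'rV[{poly C}]_m := map_mx polyC v.
have vQX j : exists w : {poly C}, (vp *m Q) 0 j = 'X * w.
  have : root ((vp *m Q) 0 j) 0.
    have : ev 0 (vp *m Q) = 0.
      rewrite map_mxM /vp -map_mx_comp map_mx_id ?vQ //.
      by move=> a; rewrite /= /horner_eval hornerC.
    by move=> /matrixP/(_ 0 j); rewrite !mxE => /eqP.
  by case/factor_theorem => w ->; exists w; rewrite subr0 mulrC.
have [w wE] := boolp.choice vQX.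
(* Row [j0] is replaced by the combination [vp *m Q] divided by $t$. Solving for the old row gives
   [G], which is the identity outside row [j0] and has determinant $t/v_{j_0}$. *)
pose Q' : 'M[{poly C}]_(m, N) := \matrix_(i, j) if i == j0 then w j else Q i j.
pose G : 'M[{poly C}]_m := \matrix_(i, j) if i == j0 then
  (v 0 j0)^-1%:P * (if j == j0 then 'X else - vp 0 j) else (i == j)%:R.
have QE : Q = G *m Q'.
  apply/matrixP=> i j; rewrite !mxE; have [->|ij0] := eqVneq i j0; last first.
    rewrite (bigD1 i) //= !mxE (negPf ij0) eqxx mul1r big1 ?addr0 // => k ki.
    by rewrite !mxE (negPf ij0) eq_sym (negPf ki) mul0r.
  have := wE j; rewrite mxE (bigD1 j0) //= => H.
  rewrite (bigD1 j0) //= !mxE !eqxx -mulrA -H.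
  rewrite [X in _ = _ + X](eq_bigr (fun k =>
    - ((v 0 j0)^-1%:P * (vp 0 k * Q k j)))) => [|k kj0]; last first.
    by rewrite !mxE eqxx (negPf kj0); ring.
  rewrite sumrN -mulr_sumr -mulrBr addrK mxE mulrA -polyCM mulVf //.
  by rewrite mul1r.
have dG : \det G = (v 0 j0)^-1 *: 'X.
  rewrite (expand_det_col _ j0) (bigD1 j0) //= big1 ?addr0 => [|i ij0]; last first.
    by rewrite mxE (negPf ij0) mul0r.
  rewrite mxE !eqxx /cofactor -signr_odd addnn odd_double mul1r.
  have -> : row' j0 (col' j0 G) = 1%:M.
    by apply/matrixP=> i j; rewrite !mxE eq_sym (negPf (neq_lift _ _)) (inj_eq lift_inj).
  by rewrite det1 mulr1 mul_polyC.
have dE : \det (Q *m S) = (v 0 j0)^-1 *: ('X * \det (Q' *m S)).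
  by rewrite {1}QE -mulmxA det_mulmx dG scalerAl.
have v0' : (v 0 j0)^-1 != 0 by rewrite invr_eq0.
exists G, Q'; split=> //; first by rewrite dG scaler_eq0 negb_or v0' polyX_eq0.
rewrite dE size_scale // mulrC size_mulX //.
by apply: contraNneq dQ => H; rewrite dE H mulr0 scaler0.
Qed.

(** Each division lowers the degree of $\det(QS)$, so the process stops; [S] is the witness that [Q]
    has full rank generically. *)
Lemma saturation Q (S : 'M[{poly C}]_(N, m)) : \det (Q *m S) != 0 ->
  exists G Q', [/\ Q = G *m Q', \det G != 0 & row_free (ev 0 Q')].
Proof.
have [s] := ubnP (size (\det (Q *m S))); elim: s Q => // s IH Q sQ dQ.
have [rf|nrf] := boolP (row_free (ev 0 Q)).
  by exists 1%:M, Q; rewrite mul1mx det1 oner_neq0.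
have [G [Q' [QE dG sQ']]] := saturation_step dQ nrf.
have dQ' : \det (Q' *m S) != 0.
  by apply: contraNneq dQ; rewrite QE -mulmxA det_mulmx => ->; rewrite mulr0.
have [|G' [Q'' [Q'E dG' rf]]] := IH Q' _ dQ'.
  by apply: leq_trans sQ' _; rewrite -ltnS.
by exists (G *m G'), Q''; split; rewrite -?mulmxA -?Q'E // det_mulmx mulf_neq0.
Qed.

End Saturation.

Lemma linZB (C : pzRingType) (V V' : lmodType C) (h : V -> V') :
  (forall a f g, h (a *: f + g) = a *: h f + h g) ->
  forall a u v, h (a *: u - v) = a *: h u - h v.
Proof.
move=> hP a u v; have h0 : h 0 = 0.
  by have := hP (-1) 0 0; rewrite scaler0 addr0 scaleN1r addNr.
have hN : h (- v) = - h v by have := hP (-1) v 0; rewrite h0 !scaleN1r !addr0.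
by rewrite hP hN.
Qed.

Section Limit.
Variables (C : numFieldType) (V : lmodType C) (m N : nat).
Variables (vec : V -> 'cV[C]_N) (back : 'cV[C]_N -> V).
Hypothesis vecP : forall a f g, vec (a *: f + g) = a *: vec f + vec g.
Hypothesis backP : forall a u v, back (a *: u + v) = a *: back u + back v.
Hypothesis vecK : forall v, vec (back v) = v.
Variable Q : 'M[{poly C}]_(m, N).
Hypothesis rfQ : row_free (ev 0 Q).

Lemma lin_mxP (g : 'cV[C]_N -> 'cV[C]_N) :
  (forall a u v, g (a *: u + v) = a *: g u + g v) ->
  exists M : 'M[C]_N, forall v, g v = M *m v.
Proof.
move=> gP; have g0 : g 0 = 0.
  by have := gP (-1) 0 0; rewrite scaler0 addr0 scaleN1r addNr.
exists (\matrix_(i, j) g (delta_mx j 0) i 0) => v.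
have -> : g v = \sum_j v j 0 *: g (delta_mx j 0).
  rewrite {1}[v]matrix_sum_delta; under eq_bigr => j _ do rewrite big_ord1.
  by elim/big_rec2: _ => // j u w _ <-; rewrite gP.
apply/colP=> i; rewrite summxE mxE; apply: eq_bigr => j _.
by rewrite !mxE mulrC.
Qed.

(* A kernel element [f] at [t = 0] extends to a polynomial family of kernel
   elements, obtained from Cramer's rule. *)
Lemma limit_stable (T0 T1 : V -> V) (b : {poly C}) :
  (forall a f g, T0 (a *: f + g) = a *: T0 f + T0 g) ->
  (forall a f g, T1 (a *: f + g) = a *: T1 f + T1 g) -> b != 0 ->
  (forall t, b.[t] != 0 -> forall f, ev t Q *m vec f = 0 ->
     ev t Q *m vec (T0 f + t *: T1 f) = 0) ->
  forall f, ev 0 Q *m vec f = 0 -> ev 0 Q *m vec (T0 f) = 0.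
Proof.
move=> T0P T1P b0 HT f f0.
have [S QS] := row_freeP rfQ.
pose A := Q *m map_mx polyC S; pose d := \det A.
pose cst k (M : 'M[C]_(k, 1)) : 'M[{poly C}]_(k, 1) := map_mx polyC M.
have evC t k k' (M : 'M[C]_(k, k')) : ev t (map_mx polyC M) = M.
  by rewrite -map_mx_comp map_mx_id // => a; rewrite /= /horner_eval hornerC.
have d1 : d.[0] = 1.
  by rewrite -[LHS]/(horner_eval 0 d) -det_map_mx map_mxM evC QS det1.
(* Cramer's rule with the denominator cleared: [F t] corresponds to $d(t)$ times the projection of
   [f] onto the kernel along the image of [S]. At $t=0$ one has $d=1$, and [Wp] vanishes because [f]
   is in the kernel. *)
pose Wp := map_mx polyC S *m \adj A *m Q *m cst _ (vec f).
pose F t := d.[t] *: f - back (ev t Wp).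
(* [V] may have infinite dimension, but the operators are applied only to [f] and on the image of
   [back], where they are matrices; hence their values on [F t] have coordinates polynomial in
   $t$. *)
have [M0 HM0] : exists M : 'M[C]_N, forall v, vec (T0 (back v)) = M *m v.
  by apply: lin_mxP => a u v; rewrite backP T0P vecP.
have [M1 HM1] : exists M : 'M[C]_N, forall v, vec (T1 (back v)) = M *m v.
  by apply: lin_mxP => a u v; rewrite backP T1P vecP.
have vecB := linZB vecP.
have T0B := linZB T0P.
have T1B := linZB T1P.
have F0 t : ev t Q *m vec (F t) = 0.
  rewrite vecB vecK mulmxBr -scalemxAr /Wp !map_mxM !evC !mulmxA.
  rewrite -[ev t Q *m S](_ : ev t A = _); last by rewrite map_mxM evC.
  rewrite -map_mxM mul_mx_adj map_scalar_mx mul_scalar_mx -scalemxAl.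
  by rewrite subrr.
pose Z := Q *m (d *: cst _ (vec (T0 f)) - map_mx polyC M0 *m Wp
  + 'X *: (d *: cst _ (vec (T1 f)) - map_mx polyC M1 *m Wp)).
have ZE t : ev t Z = ev t Q *m vec (T0 (F t) + t *: T1 (F t)).
  rewrite addrC vecP addrC T0B T1B !vecB HM0 HM1 map_mxM; congr (_ *m _).
  by rewrite /Wp !(map_mxD, map_mxN, map_mxZ, map_mxM, evC) /= /horner_eval hornerX.
have Z0 : Z = 0.
  apply/matrixP=> i j; rewrite [RHS]mxE; apply: (poly_generic_eq0 b0) => t bt.
  have := ZE t; rewrite HT // => /matrixP/(_ i j).
  by rewrite !mxE.
have := ZE 0; rewrite Z0 map_mx0 scale0r addr0 T0B vecB HM0.
rewrite /Wp !map_mxM !evC d1 scale1r -[_ *m vec f]mulmxA f0 !mulmx0 subr0.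
by move=> <-.
Qed.

End Limit.

(** * Singular vectors *)

Section Convolution.
Variable R : comNzRingType.
Implicit Types (a b : nat -> R) (n : nat) (x : R).

(** Sequences stand for power series in $t$, with [conv] as product and [shift] as multiplication by
    $t$; computations with $\Phi(t)$ are carried out in this form. *)
Definition conv a b n : R := \sum_(s < n.+1) a s * b (n - s)%N.
Definition shift a n : R := if n is m.+1 then a m else 0.

Lemma eq_conv a a' b b' n :
  (forall m, (m <= n)%N -> a m = a' m) -> (forall m, (m <= n)%N -> b m = b' m) ->
  conv a b n = conv a' b' n.
Proof.
move=> Ha Hb; apply: eq_bigr => s _.
by rewrite Ha ?Hb ?leq_subr // -ltnS.
Qed.

Lemma convE a b n N : (n < N)%N ->
  conv a b n = ((\poly_(i < N) a i) * (\poly_(i < N) b i))`_n.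
Proof.
move=> nN; rewrite coefM; apply: eq_bigr => s _.
by rewrite !coef_poly !(leq_ltn_trans _ nN) ?leq_subr // -ltnS.
Qed.

Lemma convC a b n : conv a b n = conv b a n.
Proof. by rewrite !(convE _ _ (ltnSn n)) mulrC. Qed.

(** The coefficient at [n] sees only truncations, so this is associativity in the polynomial
    ring. *)
Lemma convA a b d n : conv a (conv b d) n = conv (conv a b) d n.
Proof.
have E u v : \poly_(i < n.+1) conv u v i =
    \poly_(i < n.+1) ((\poly_(i < n.+1) u i) * (\poly_(i < n.+1) v i))`_i.
  by apply/polyP=> i; rewrite !coef_poly; case: ifP => // ni; rewrite (convE u v ni).
have T (p q : {poly R}) : ((\poly_(i < n.+1) p`_i) * q)`_n = (p * q)`_n :> R.
  by rewrite !coefM; apply: eq_bigr => s _; rewrite coef_poly ltn_ord.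
rewrite [LHS]convC !(convE _ _ (ltnSn n)) !E !T.
by congr (_`_n); rewrite mulrC mulrA.
Qed.

Lemma convZl x a b n : conv (fun m => x * a m) b n = x * conv a b n.
Proof. by rewrite /conv mulr_sumr; apply: eq_bigr => s _; rewrite mulrA. Qed.

Lemma convZr x a b n : conv a (fun m => x * b m) n = x * conv a b n.
Proof. by rewrite convC convZl convC. Qed.

Lemma convDl a a' b n : conv (fun m => a m + a' m) b n = conv a b n + conv a' b n.
Proof. by rewrite /conv -big_split; apply: eq_bigr => s _; rewrite mulrDl. Qed.

Lemma convDr a b b' n : conv a (fun m => b m + b' m) n = conv a b n + conv a b' n.
Proof. by rewrite convC convDl ![conv _ a n]convC. Qed.

Lemma conv_suml (I : Type) (r : seq I) (Q : pred I) (F : I -> nat -> R) b n :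
  conv (fun m => \sum_(i <- r | Q i) F i m) b n = \sum_(i <- r | Q i) conv (F i) b n.
Proof. by rewrite exchange_big; apply: eq_bigr => s _; rewrite mulr_suml. Qed.

Lemma conv_sumr (I : Type) (r : seq I) (Q : pred I) (F : I -> nat -> R) b n :
  conv b (fun m => \sum_(i <- r | Q i) F i m) n = \sum_(i <- r | Q i) conv b (F i) n.
Proof. by rewrite convC conv_suml; apply: eq_bigr => i _; rewrite convC. Qed.

Lemma conv_shiftl a b n : conv (shift a) b n = shift (conv a b) n.
Proof.
case: n => [|n]; first by rewrite /conv big_ord1 mul0r.
by rewrite /conv big_ord_recl mul0r add0r; apply: eq_bigr => s _.
Qed.

Lemma conv_shiftr a b n : conv a (shift b) n = shift (conv a b) n.
Proof. by rewrite convC conv_shiftl; case: n => //= n; rewrite convC. Qed.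

Lemma conv_geometric x b n :
  conv (fun e => x ^+ e) b n = b n + x * shift (conv (fun e => x ^+ e) b) n.
Proof.
case: n => [|n]; first by rewrite /conv big_ord1 mul1r mulr0 addr0.
rewrite /conv big_ord_recl mul1r subn0 mulr_sumr; congr (_ + _).
by apply: eq_bigr => s _; rewrite exprS mulrA.
Qed.

End Convolution.

Section SumMultiples.
Variables (V : nmodType) (l : nat).
Hypothesis hl : (0 < l)%N.

(** For $0<q\le l$ the largest multiple of $l$ below $q+le$ is $le$. *)
Lemma sum_multiples q e (F : nat -> V) : (0 < q <= l)%N ->
  \sum_(0 <= u < q + l * e | (l %| u)%N) F u = \sum_(b < e.+1) F (l * b)%N.
Proof.
move=> /andP[q0 ql].
have Z a u v : (l * a < u)%N -> (v <= l * a.+1)%N ->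
    \sum_(u <= w < v | (l %| w)%N) F w = 0.
  move=> au va; rewrite big_nat_cond big_pred0 // => w; apply/negP.
  case/andP=> /andP[uw wv] /dvdnP[d wd].
  have := leq_trans au uw; rewrite wd mulnC ltn_pmul2r // => ad.
  have := leq_trans wv va; rewrite wd mulnC ltn_pmul2l // ltnS.
  by rewrite leqNgt ad.
elim: e => [|e IH].
  rewrite muln0 addn0 big_ord1 muln0 big_ltn_cond // dvdn0 (Z 0%N) ?addr0 //.
    by rewrite muln0.
  by rewrite muln1.
have h1 : (q + l * e <= l * e.+1)%N by rewrite mulnS leq_add2r.
have h2 : (l * e.+1 < q + l * e.+1)%N by rewrite -[X in (X < _)%N]add0n ltn_add2r.
rewrite big_ord_recr /= -IH.
rewrite (@big_cat_nat _ _ _ (q + l * e)) //=; last by rewrite (leq_trans h1) // ltnW.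
congr (_ + _); rewrite (@big_cat_nat _ _ _ (l * e.+1)) //=; last by rewrite ltnW.
rewrite (Z e) ?add0r //; last by rewrite -[X in (X < _)%N]add0n ltn_add2r.
rewrite big_ltn_cond // dvdn_mulr // (Z e.+1) ?addr0 //.
by rewrite [(l * e.+2)%N]mulnS leq_add2r.
Qed.

End SumMultiples.

(** * The coefficients of $\Phi(t)$ and their derivatives *)

Section Newton.
Variables (C : numFieldType) (n l : nat) (k : C).
Local Notation P := {mpoly C[n]}.

Definition power_sum (s : nat) : P := \sum_j ('X_j ^+ l) ^+ s.

(** The list holds the coefficients of index [b] down to [0], since the recursion for the next one
    refers to all of them. *)
Fixpoint newton_seq b : seq P :=
  if b is b'.+1 then
    - (k / b%:R) *: (\sum_(s < b) power_sum s.+1 * (newton_seq b')`_s) :: newton_seq b'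
  else [:: 1].

(* The coefficient of [t ^ b] in [\prod_j (1 - 'X_j ^ l * t) ^ k], given by
   Newton's identities. *)
Definition newton b : P := head 0 (newton_seq b).

Lemma nth_newton_seq b s : (s <= b)%N -> (newton_seq b)`_s = newton (b - s).
Proof.
elim: b s => [|b IH] [|s] //= sb; first by rewrite subSS IH.
Qed.

Lemma newton0 : newton 0 = 1. Proof. by []. Qed.

(** The logarithmic derivative $t\Phi'=-k\,\Phi\sum_{s\ge1}p_st^s$, with $p_s$ the power sums of the
    $x_j^l$, read off at $t^{b+1}$. *)
Lemma newtonS b : b.+1%:R *: newton b.+1
  = - k *: conv (fun s => power_sum s.+1) newton b.
Proof.
rewrite {1}/newton /= scalerA mulrN mulrCA divff ?pnatr_eq0 // mulr1.
by congr (_ *: _); apply: eq_bigr => s _; rewrite nth_newton_seq // -ltnS.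
Qed.

Lemma newtonE b : b%:R *: newton b
  = - k *: shift (conv (fun s => power_sum s.+1) newton) b.
Proof. by case: b => [|b]; rewrite ?scale0r ?scaler0 // newtonS. Qed.

Lemma mderivXn i (f : P) m : (f ^+ m)^`M(i) = m%:R *: (f ^+ m.-1 * f^`M(i)).
Proof.
elim: m => [|m IH]; first by rewrite expr0 -mpolyC1 mderivC scale0r.
rewrite exprS mderivM IH -scalerAr mulrA -exprS.
case: m {IH} => [|m] /=; first by rewrite scale0r addr0 scale1r mulrC.
by rewrite -[in RHS]add1n natrD scalerDl scale1r mulrC.
Qed.

Lemma mderivXU i j : ('X_j : P)^`M(i) = (i == j)%:R.
Proof.
rewrite -lin_form_delta mderiv_lin_form mxE eqxx /=.
by case: eqP; rewrite ?mpolyC1 ?mpolyC0.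
Qed.

Lemma mderiv_power_sum i s : (power_sum s.+1)^`M(i)
  = (l * s.+1)%:R *: ('X_i ^+ l.-1 * ('X_i ^+ l) ^+ s).
Proof.
rewrite /power_sum linear_sum (bigD1 i) //= big1 ?addr0 => [|j ji].
  rewrite !mderivXn mderivXU eqxx mulr1 -scalerAr scalerA -natrM mulnC.
  by congr (_ *: _); rewrite mulrC.
by rewrite !mderivXn mderivXU eq_sym (negPf ji) mulr0 scaler0 mulr0 scaler0.
Qed.

(** Coefficientwise, $\partial_i\Phi=-kl\,x_i^{l-1}t\,\Phi/(1-x_i^lt)$. As the coefficients are
    given by a recursion, the proof is an induction through that recursion. *)
Lemma mderiv_newton i b : (newton b)^`M(i)
  = - (k * l%:R) *: ('X_i ^+ l.-1 *
      shift (conv (fun e => ('X_i ^+ l) ^+ e) newton) b).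
Proof.
have [m] := ubnP b; elim: m b => // m IHm [|b] bm.
  by rewrite newton0 -mpolyC1 mderivC mulr0 scaler0.
set g := fun e => ('X_i ^+ l) ^+ e; set p := fun s => power_sum s.+1.
have b0 : b.+1%:R != 0 :> C by rewrite pnatr_eq0.
apply: (scalerI b0); rewrite -linearZ newtonS /= linearZ linear_sum /=.
under eq_bigr => s _ do rewrite mderivM.
rewrite big_split /= -/(conv (fun s => (p s)^`M(i)) newton b).
rewrite -/(conv p (fun b => (newton b)^`M(i)) b).
have -> : conv p (fun b => (newton b)^`M(i)) b
    = l%:R *: ('X_i ^+ l.-1 * conv g (fun b => b%:R *: newton b) b).
  rewrite (eq_conv (b' := fun b => (- (k * l%:R))%:MP * 'X_i ^+ l.-1
     * shift (conv g newton) b) (fun _ _ => erefl)) => [|e eb]; last first.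
    by rewrite IHm -?mul_mpolyC ?mulrA // (leq_ltn_trans eb).
  rewrite (@eq_conv _ g g _ (fun b => (- k)%:MP * shift (conv p newton) b)) // => [|e _].
    rewrite !convZr !conv_shiftr -!mul_mpolyC; case: b {bm b0} => [|b] /=.
      by rewrite !mulr0.
    rewrite !convA (eq_conv (a' := conv g p) (b' := newton)) // => [|e _].
      by rewrite !mpolyCN mpolyCM; ring.
    exact: convC.
  by rewrite newtonE mul_mpolyC.
rewrite (eq_conv (a' := fun s => l%:R%:MP * 'X_i ^+ l.-1 * (s.+1%:R%:MP * g s))
  (b' := newton)) // => [|s _]; last first.
  by rewrite mderiv_power_sum natrM -mul_mpolyC mpolyCM /g; ring.
rewrite convZl -!mul_mpolyC.
(* Differentiating the power sums contributes the weight $s+1$, differentiating the earlier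
   coefficients the weight $b-s$; together they produce the factor $b+1$ to be cancelled. *)
have AB : conv (fun s => s.+1%:R%:MP * g s) newton b
    + conv g (fun b => b%:R *: newton b) b = b.+1%:R%:MP * conv g newton b.
  rewrite /conv -big_split mulr_sumr; apply: eq_bigr => s _ /=.
  have -> : b.+1%:R = (s.+1 + (b - s))%:R :> C.
    by congr (_%:R); have := ltn_ord s; lia.
  by rewrite natrD mpolyCD -mul_mpolyC; ring.
transitivity ((- k)%:MP * l%:R%:MP * 'X_i ^+ l.-1
  * (conv (fun s => s.+1%:R%:MP * g s) newton b
     + conv g (fun b => b%:R *: newton b) b)); first by ring.
by rewrite AB /= !mpolyCN mpolyCM; ring.
Qed.

Lemma power_sum_homog s : power_sum s \is (l * s).-homog.
Proof.
apply: rpred_sum => j _; rewrite -exprM mpolyXn dhomogX /=.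
by rewrite mdegMn mdeg1 mul1n.
Qed.

Lemma newton_homog b : newton b \is (l * b).-homog.
Proof.
have [m] := ubnP b; elim: m b => // m IHm [|b] bm.
  by rewrite muln0 newton0 dhomog1.
have b0 : b.+1%:R != 0 :> C by rewrite pnatr_eq0.
rewrite -[newton _](scalerK b0) newtonS rpredZ // rpredZ // rpred_sum // => s _.
have -> : (l * b.+1 = l * s.+1 + l * (b - s))%N.
  by rewrite -mulnDr; congr (_ * _)%N; have := ltn_ord s; lia.
apply: dhomogM; first exact: power_sum_homog.
by apply: IHm; rewrite (leq_ltn_trans (leq_subr _ _)).
Qed.

End Newton.

(** A pair containing [i] is determined by its other member. This passes from reflections, indexed
    by increasing pairs, to sums over $j\ne i$. *)
Lemma sum_pairs_through (V : nmodType) n (i : 'I_n) (G : 'I_n -> 'I_n -> V)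
    (H : 'I_n -> V) :
  (forall b : 'I_n, (i < b)%N -> G i b = H b) ->
  (forall a : 'I_n, (a < i)%N -> G a i = H a) ->
  (forall a b : 'I_n, (a < b)%N -> a != i -> b != i -> G a b = 0) ->
  \sum_(x : 'I_n * 'I_n | (x.1 < x.2)%N) G x.1 x.2 = \sum_(j | j != i) H j.
Proof.
move=> Gi Gi' G0.
rewrite -(pair_big_dep xpredT (fun a b : 'I_n => (a < b)%N) G) /=.
rewrite (bigD1 i) //= [RHS](bigID (fun j : 'I_n => (i < j)%N) (fun j => j != i)) /=.
congr (_ + _).
  apply: eq_big => [b|b ib]; last exact: Gi.
  by case: ltnP => [ib|]; rewrite ?andbF // andbT neq_ltn ib orbT.
rewrite [RHS]big_mkcond [LHS]big_mkcond; apply: eq_bigr => a _.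
have [->|ai] := eqVneq a i; first by [].
rewrite /= -leqNgt leq_eqVlt (negPf ai : (nat_of_ord a == i) = false) /=.
case: ltnP => [lai|]; last first.
  move=> lia; apply: big1 => b ab; apply: G0 => //; apply/eqP=> bi.
  by rewrite bi ltnNge lia in ab.
rewrite (bigD1 i) //= Gi' // big1 ?addr0 // => b /andP[ab bi].
exact: G0.
Qed.

Section SingularVectors.
Variables (C : numFieldType) (n l : nat) (eps : C).
Hypotheses (hl : (1 < l)%N) (heps : l.-primitive_root eps).
Variable c : l.-tuple C.
Local Notation k := (c`_0).
Local Notation W := (cyc_wreath n l).
Local Notation P := {mpoly C[n]}.
Local Notation act := (wact eps).
Local Notation D := (dk eps c).
Local Notation e_ i := (delta_mx i 0 : 'cV[C]_n).
Implicit Types (g : W) (i j : 'I_n).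

Let eps0 : eps != 0 := eps_neq0 hl heps.
Let l0 : (0 < l)%N := ltnW hl.

(** Orthogonality of the characters of $\mathbb{Z}/l$; it is what selects the exponents divisible by
    $l$ below. *)
Lemma eps_sum (u : nat) :
  \sum_(m : 'Z_l) eps ^+ (m * u) = (if (l %| u)%N then l%:R else 0).
Proof.
case: ifP => lu.
  rewrite (eq_bigr (fun _ => 1)) ?sumr_const ?card_ord ?Zp_cast // => m _.
  by case/dvdnP: lu => d ->; rewrite mulnA exprM exprAC (prim_expr_order heps) expr1n.
have eu : eps ^+ u != 1 by rewrite -(prim_order_dvd heps) lu.
have eu1 : eps ^+ u - 1 != 0 by rewrite subr_eq0.
apply: (mulfI eu1); rewrite mulr0.
transitivity ((eps ^+ u - 1) * \sum_(m < l) (eps ^+ u) ^+ m).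
  congr (_ * _); rewrite -(big_mkord xpredT (fun m => eps ^+ u ^+ m)).
  rewrite -[X in \sum_(0 <= _ < X) _](Zp_cast hl) big_mkord.
  by apply: eq_bigr => m _; rewrite -exprM mulnC.
by rewrite -subrX1 exprAC (prim_expr_order heps) expr1n subrr.
Qed.

Lemma wact_XnE g i N :
  act g ('X_i ^+ N) = eps ^- (cw_exp g (cw_perm g i) * N) *: 'X_(cw_perm g i) ^+ N.
Proof. by rewrite rmorphXn /= (wactX hl heps) exprZn exprVn exprM. Qed.

Lemma wact_XlE g i : act g ('X_i ^+ l) = 'X_(cw_perm g i) ^+ l.
Proof.
by rewrite wact_XnE mulnC exprM (prim_expr_order heps) expr1n invr1 scale1r.
Qed.

Lemma wact_power_sum g s : act g (power_sum C n l s) = power_sum C n l s.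
Proof.
rewrite /power_sum rmorph_sum [RHS](reindex_inj (@perm_inj _ (cw_perm g))) /=.
by apply: eq_bigr => j _; rewrite rmorphXn /= wact_XlE.
Qed.

Lemma wact_newton g b : act g (newton n l k b) = newton n l k b.
Proof.
have [m] := ubnP b; elim: m b => // m IHm [|b] bm; first by rewrite rmorph1.
have b0 : b.+1%:R != 0 :> C by rewrite pnatr_eq0.
apply: (scalerI b0); rewrite -linearZ newtonS /= linearZ linear_sum /=.
congr (_ *: _); apply: eq_bigr => s _; rewrite rmorphM /= wact_power_sum IHm //.
by rewrite (leq_ltn_trans (leq_subr _ _)).
Qed.

(** Divided differences are linear over $W$-invariants, so an invariant factor is only
    differentiated. It will be applied to the coefficients of $\Phi$. *)
Lemma dk_mul_inv y (f phi : P) : (forall g, act g phi = phi) ->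
  D y (f * phi) = D y f * phi + f * \sum_i y i 0 *: phi^`M(i).
Proof.
move=> hphi; rewrite !dk_sumE mulr_sumr mulrBl !mulr_suml addrAC; congr (_ - _).
  rewrite -big_split; apply: eq_bigr => i _ /=.
  by rewrite mderivM scalerDr scalerAl scalerAr.
apply: eq_bigr => s hs; rewrite (dquotM hl heps) // hphi (dquot_inv hl heps) //.
by rewrite mulr0 add0r scalerAl.
Qed.

Lemma root_delta_inr a b m j :
  pairing (refl_root eps (inr (a, b, m) : refl_index n l)) (e_ j)
  = (a == j)%:R - eps ^+ m * (b == j)%:R.
Proof.
by rewrite [refl_root _ _]addrC -scaleNr pairingPl !pairing_delta mulNr addrC.
Qed.

Lemma dquot_pow_inl (i i' : 'I_n) (m : 'Z_l) N : m != 0 ->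
  dquot eps (inl (i', m)) ('X_i ^+ N)
  = (if i' == i then (1 - eps ^- (m * N)) *: 'X_i ^+ N.-1 else 0).
Proof.
move=> m0; case: eqP => [->|ii']; last first.
  apply: (dquot_inv hl heps) => //.
  by rewrite wact_XnE /= perm1 ffunE; case: eqP => [/esym//|_];
    rewrite mul0n expr0 invr1 scale1r.
apply: (dquot_unique hl heps) => //; rewrite wact_XnE /= perm1 ffunE eqxx.
rewrite lin_form_delta -scalerAr; case: N => [|N].
  by rewrite muln0 !expr0 invr1 subrr scale0r scale1r subrr.
by rewrite -exprS scalerBl scale1r.
Qed.

Lemma dquot_pow_inr (a b i : 'I_n) (m : 'Z_l) N : (a < b)%N ->
  dquot eps (inr (a, b, m)) ('X_i ^+ N)
  = (if a == i then \sum_(u < N) eps ^+ (m * u) *: ('X_a ^+ (N.-1 - u) * 'X_b ^+ u)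
     else if b == i then - (\sum_(u < N) eps ^- (m * u.+1)
            *: ('X_b ^+ (N.-1 - u) * 'X_a ^+ u))
     else 0).
Proof.
move=> ab; have ab' : a != b by rewrite neq_ltn ab.
have rootE : lin_form (refl_root eps (inr (a, b, m) : refl_index n l))
    = 'X_a - eps ^+ m *: 'X_b by rewrite linearB linearZ /= !lin_form_delta.
have em0 : eps ^+ m != 0 by rewrite expf_neq0.
case: eqP => [<-|ai].
  apply: (dquot_unique hl heps) => //; rewrite rootE rmorphXn /= (wactX hl heps) /=.
  rewrite tpermL ffunE eq_sym (negPf ab') eqxx (eps_ZpN hl heps) invrK subrXX.
  congr (_ * _); apply: eq_bigr => u _.
  by rewrite exprZn -scalerAr exprM.
case: eqP => [<-|bi].
  apply: (dquot_unique hl heps) => //; rewrite rootE rmorphXn /= (wactX hl heps) /=.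
  rewrite tpermR ffunE eqxx subrXX.
  (* The root is written with $x_a$ first; the scalar $-\varepsilon^{-m}$ picked up here accounts
     for the sign and for the exponent [u.+1]. *)
  have -> : 'X_b - eps ^- m *: 'X_a = - (eps ^- m) *: ('X_a - eps ^+ m *: 'X_b) :> P.
    by rewrite scalerBr !scaleNr scalerA mulVf // scale1r opprK addrC.
  rewrite -!scalerAl scalerAr mulrN -mulrN; congr (_ * _).
  rewrite scaler_sumr -sumrN; apply: eq_bigr => u _.
  by rewrite exprZn -scalerAr scalerA mulNr scaleNr exprVn -exprM -invfM -exprD mulnS.
apply: (dquot_inv hl heps) => //; rewrite rmorphXn /= (wactX hl heps) /=.
rewrite tpermD; [|exact/eqP|exact/eqP].
by rewrite ffunE; do 2!(case: eqP => [/esym//|_]); rewrite expr0 invr1 scale1r.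
Qed.

(** At $N=q$ this is the sum in the equation of $E_r$. Twice it is what the reflections $s_i^m$
    subtract from the factor $N$ in $D_i(x_i^N)$; it depends only on $N$ modulo $l$. *)
Definition cyc_sum (N : nat) : C :=
  \sum_(1 <= m < l) c`_m * ((1 - eps ^- (m * N)) / (1 - eps ^- m)).

Lemma cyc_sumD q e : cyc_sum (q + l * e) = cyc_sum q.
Proof.
apply: eq_bigr => m _; rewrite mulnDr exprD mulnCA (exprM _ l) (prim_expr_order heps).
by rewrite expr1n mulr1.
Qed.

Lemma sum_Zp_neq0 (F : nat -> C) :
  \sum_(m : 'Z_l | m != 0) F m = \sum_(1 <= m < l) F m.
Proof.
rewrite -[X in \sum_(1 <= _ < X) _](Zp_cast hl) big_add1 /= big_mkord.
by rewrite big_mkcond [LHS]big_ord_recl /= add0r.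
Qed.

Lemma dk_sum_inl i j N :
  \sum_(x : 'I_n * 'Z_l | is_refl (inl x : refl_index n l))
    (refl_weight eps c (inl x : refl_index n l)
      * pairing (refl_root eps (inl x : refl_index n l)) (e_ j))
        *: dquot eps (inl x) ('X_i ^+ N)
  = ((i == j)%:R * (2%:R * cyc_sum N)) *: 'X_i ^+ N.-1.
Proof.
pose T (m : 'Z_l) : P :=
  ((i == j)%:R * (2%:R * (c`_m * ((1 - eps ^- (m * N)) / (1 - eps ^- m)))))
    *: 'X_i ^+ N.-1.
transitivity (\sum_(a : 'I_n) \sum_(m : 'Z_l | m != 0) if a == i then T m else 0).
  rewrite pair_big_dep /=; apply: eq_big => [[a m]|[a m] m0] //=.
  rewrite dquot_pow_inl //; case: eqP => [->|_]; last by rewrite scaler0.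
  rewrite pairing_delta scalerA /T; congr (_ *: _); rewrite /refl_weight /=.
  by move: (1 - eps ^- m)^-1 (1 - _) => z z'; ring.
rewrite (bigD1 i) //= [X in _ + X]big1 ?addr0; last first.
  by move=> a ai; rewrite big1 // => m _; rewrite (negPf ai).
rewrite eqxx -scaler_suml -!mulr_sumr /cyc_sum.
by rewrite (sum_Zp_neq0 (fun m => c`_m * ((1 - eps ^- (m * N)) / (1 - eps ^- m)))).
Qed.

(** Up to the factor $k$, what the reflections exchanging the coordinates $i$ and $j'$ subtract in
    $D_j(x_i^N)$, written in a way that does not depend on which index is smaller. *)
Definition pair_quot i j N (j' : 'I_n) : P := \sum_(m : 'Z_l)
  ((i == j)%:R - eps ^+ m * (j' == j)%:R)
    *: \sum_(u < N) eps ^+ (m * u) *: ('X_i ^+ (N.-1 - u) * 'X_j' ^+ u).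

Lemma dk_sum_inr i j N :
  \sum_(x : 'I_n * 'I_n * 'Z_l | is_refl (inr x : refl_index n l))
    (refl_weight eps c (inr x : refl_index n l)
      * pairing (refl_root eps (inr x : refl_index n l)) (e_ j))
        *: dquot eps (inr x) ('X_i ^+ N)
  = k *: \sum_(j' | j' != i) pair_quot i j N j'.
Proof.
have k_weight x : refl_weight eps c (inr x : refl_index n l) = k.
  case: x => [[a b] m]; rewrite /refl_weight /= opprK -[1 + 1](natrD _ 1 1).
  by rewrite mulrAC divff ?mul1r // pnatr_eq0.
pose G a b : P := \sum_(m : 'Z_l) ((a == j)%:R - eps ^+ m * (b == j)%:R)
  *: dquot eps (inr (a, b, m)) ('X_i ^+ N).
rewrite -(sum_pairs_through (G := G)); last 3 first.
- move=> b ib; apply: eq_bigr => m _.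
  by rewrite dquot_pow_inr // eqxx.
(* When [i] is the larger index, $m\mapsto-m$ brings the terms into the form they have when it is
   the smaller one. *)
- move=> a ai; rewrite /G (reindex_inj oppr_inj); apply: eq_bigr => m _ /=.
  rewrite dquot_pow_inr // eqxx (ltn_eqF ai : (a == i) = false) (eps_ZpN hl heps).
  rewrite scalerN -scaleNr opprB !scaler_sumr.
  apply: eq_bigr => u _; rewrite !scalerA; congr (_ *: _).
  have em0 : eps ^+ m != 0 by rewrite expf_neq0.
  rewrite !exprM (eps_ZpN hl heps) exprVn invrK exprS.
  by move: (eps ^+ m) em0 => z z0; field.
- move=> a b ab ai bi; apply: big1 => m _.
  by rewrite dquot_pow_inr // (negPf ai) (negPf bi) scaler0.
rewrite scaler_sumr /G.
under [RHS]eq_bigr => x _ do rewrite scaler_sumr.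
rewrite (pair_big_dep (fun x : 'I_n * 'I_n => (x.1 < x.2)%N) (fun _ _ => true)) /=.
apply: eq_big => [[[a b] m]|[[a b] m] _]; first by rewrite andbT.
by rewrite k_weight root_delta_inr scalerA.
Qed.

Lemma dk_pow i j N : D (e_ j) ('X_i ^+ N)
  = ((i == j)%:R * (N%:R - 2%:R * cyc_sum N)) *: 'X_i ^+ N.-1
    - k *: \sum_(j' | j' != i) pair_quot i j N j'.
Proof.
rewrite (dk_sumE eps c) big_sumType /= opprD addrA dk_sum_inl.
rewrite [X in _ - X](dk_sum_inr i j N); congr (_ - _).
rewrite mulrBr scalerBl; congr (_ - _).
rewrite (bigD1 j) //= big1 ?addr0 => [|j' jj']; last first.
  by rewrite mxE (negPf jj') scale0r.
rewrite mxE !eqxx scale1r mderivXn mderivXU eq_sym -scalerA.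
by case: eqP; rewrite ?mulr1 ?scale1r // mulr0 scaler0 scale0r.
Qed.

Local Notation geo j := (fun e : nat => ('X_j ^+ l) ^+ e : P).

(** The sum over $m$ keeps only the exponents [u] divisible by $l$, and these form the product of
    two geometric series. *)
Lemma pair_quot_diag i j' q e : i != j' -> (0 < q <= l)%N ->
  pair_quot i i (q + l * e) j'
  = l%:R *: ('X_i ^+ q.-1 * conv (geo i) (geo j') e).
Proof.
move=> ij' /andP[q0 ql]; rewrite /pair_quot eqxx eq_sym (negPf ij').
under eq_bigr => m _ do rewrite mulr0 subr0 scale1r.
rewrite exchange_big /=.
under eq_bigr => u _ do rewrite -scaler_suml eps_sum.
rewrite (eq_bigr (fun u : 'I__ => if (l %| u)%N then
  l%:R *: ('X_i ^+ ((q + l * e).-1 - u) * 'X_j' ^+ u) else 0)) => [|u _]; last first.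
  by case: ifP; rewrite ?scale0r.
rewrite -big_mkcond -(big_mkord (fun u => l %| u)%N
  (fun u => l%:R *: ('X_i ^+ ((q + l * e).-1 - u) * 'X_j' ^+ u))).
rewrite sum_multiples ?q0 // convC /conv mulr_sumr scaler_sumr.
apply: eq_bigr => b _; congr (_ *: _); rewrite -!exprM mulrCA -exprD mulrC.
by congr (_ * 'X_i ^+ _); have := ltn_ord b; nia.
Qed.

Lemma pair_quot_off i j q e : i != j -> (0 < q < l)%N ->
  pair_quot i j (q + l * e) j
  = - l%:R *: ('X_i ^+ q * 'X_j ^+ l.-1 * shift (conv (geo i) (geo j)) e).
Proof.
move=> ij /andP[q0 ql]; rewrite /pair_quot eqxx (negPf ij).
under eq_bigr => m _ do rewrite mulr1 sub0r scaleNr scaler_sumr -sumrN.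
rewrite exchange_big /=.
rewrite (eq_bigr (fun u : 'I__ => if (l %| u.+1)%N then
  - l%:R *: ('X_i ^+ ((q + l * e).-1 - u) * 'X_j ^+ u) else 0)) => [|u _]; last first.
  under eq_bigr => m _ do rewrite scalerA -exprD -mulnS.
  by rewrite sumrN -scaler_suml eps_sum; case: ifP; rewrite ?scale0r ?oppr0 ?scaleNr.
(* Here the surviving exponents have [u.+1] divisible by $l$. [F] is indexed by [u.+1], with value
   [0] at [0], so that [sum_multiples] applies with [q.+1] in place of [q]. *)
pose F v : P := if v is u.+1 then
  - l%:R *: ('X_i ^+ ((q + l * e).-1 - u) * 'X_j ^+ u) else 0.
rewrite -big_mkcond -(big_mkord (fun u => l %| u.+1)%N (fun u => F u.+1)).
have <- : \sum_(0 <= u < q.+1 + l * e | (l %| u)%N) F u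
    = \sum_(0 <= u < q + l * e | (l %| u.+1)%N) F u.+1.
  by rewrite addSn big_ltn_cond // dvdn0 add0r big_add1.
rewrite sum_multiples // big_ord_recl muln0 add0r.
case: e @F => [|e] F; first by rewrite big_ord0 mulr0 scaler0.
rewrite /shift convC /conv mulr_sumr scaler_sumr; apply: eq_bigr => b _.
rewrite lift0; have lb : (l * b.+1 = (l * b + l.-1).+1)%N by nia.
rewrite lb /F; congr (_ *: _); rewrite -!exprM exprD.
have -> : ((q + l * e.+1).-1 - (l * b + l.-1) = q + l * (e - b))%N.
  by have := ltn_ord b; nia.
by rewrite exprD; ring.
Qed.

(* The coefficient of [t ^ a] in
   ['X_i ^ q / (1 - 'X_i ^ l * t) * \prod_j (1 - 'X_j ^ l * t) ^ k]. *)
Definition sing q a i : P :=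
  conv (fun e => 'X_i ^+ (q + l * e)) (newton n l k) a.

(** Again the logarithmic derivative, now as $t\Phi'=-k\sum_jx_j^lt\,\Phi/(1-x_j^lt)$. *)
Lemma newton_euler b : b%:R%:MP * newton n l k b
  = - k%:MP * \sum_j 'X_j ^+ l * shift (conv (geo j) (newton n l k)) b.
Proof.
rewrite mul_mpolyC newtonE -mpolyCN mul_mpolyC; congr (_ *: _).
case: b => [|b] /=; first by rewrite big1 // => j _; rewrite mulr0.
rewrite /power_sum conv_suml; apply: eq_bigr => j _; rewrite -convZl.
by apply: eq_conv => // s _; rewrite exprS.
Qed.

Lemma dk_sing_expand q a i j : D (e_ j) (sing q a i)
  = conv (fun e => D (e_ j) ('X_i ^+ (q + l * e))) (newton n l k) a
    + conv (fun e => 'X_i ^+ (q + l * e)) (fun b => (newton n l k b)^`M(j)) a.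
Proof.
rewrite /sing /conv (dk_sum hl heps) -big_split; apply: eq_bigr => s _ /=.
rewrite dk_mul_inv; last by move=> g; apply: wact_newton.
congr (_ + _ * _); rewrite (bigD1 j) //= mxE !eqxx scale1r big1 ?addr0 // => j' jj'.
by rewrite mxE (negPf jj') scale0r.
Qed.

(** Put $g_j=1/(1-x_j^lt)$ and factor out $x_i^{q-1}$. At $b=a-e$ the hypothesis turns the degree
    factor into $l(n-1)k-lb$. By [newton_euler] the part with $b$ gives
    $kl\sum_jx_j^lt\,g_ig_j\Phi$, while the exchanges give $-kl\sum_{j\ne i}g_ig_j\Phi$.
    Substituting $g_j=1+x_j^lt\,g_j$ in the latter cancels everything except the term
    $kl\,x_i^lt\,g_i^2\Phi$, and $\partial_i\Phi$ contributes its negative. *)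
Lemma dk_sing_diag q a i : (0 < q < l)%N ->
  (q + l * a)%:R - 2%:R * cyc_sum q = l%:R * (n%:R - 1) * k ->
  D (e_ i) (sing q a i) = 0.
Proof.
move=> /andP[q0 ql] hc; set h := newton n l k.
set A := 2%:R * cyc_sum q in hc *; pose B : C := (q + l * a)%:R - A.
rewrite dk_sing_expand -/h.
pose x := 'X_i ^+ q.-1 : P; pose K := (k * l%:R)%:MP : P.
pose S e : P := \sum_(j | j != i) conv (geo i) (geo j) e.
have F e : D (e_ i) ('X_i ^+ (q + l * e))
    = x * (B%:MP * geo i e
           + - l%:R%:MP * ((a%:R - e%:R)%:MP * geo i e) + - K * S e).
  rewrite dk_pow eqxx mul1r cyc_sumD -/A -mul_mpolyC.
  have -> : 'X_i ^+ (q + l * e).-1 = x * geo i e.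
    by rewrite /x -exprM -exprD; congr (_ ^+ _); lia.
  rewrite (eq_bigr (fun j => l%:R%:MP * (x * conv (geo i) (geo j) e))) => [|j ji]; last first.
    by rewrite pair_quot_diag ?q0 1?ltnW 1?eq_sym // mul_mpolyC.
  rewrite -mul_mpolyC -!mulr_sumr -/(S e) /K !natrD !natrM.
  by rewrite !(mpolyCB, mpolyCD, mpolyCM); ring.
rewrite (eq_conv (fun e _ => F e) (fun _ _ => erefl)) convZl !convDl !convZl.
have -> : conv (fun e => 'X_i ^+ (q + l * e)) (fun b => (h b)^`M(i)) a
    = x * (- K * 'X_i ^+ l * shift (conv (geo i) (conv (geo i) h)) a).
  rewrite -conv_shiftr -convZr -convZl.
  apply: eq_bigr => s _; rewrite mderiv_newton -mul_mpolyC mpolyCN -/h.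
  move: (shift _ _) => z.
  have -> : 'X_i ^+ (q + l * s) = 'X_i * x * geo i s :> P.
    by rewrite /x -exprS prednK // -exprM -exprD.
  have xl : 'X_i * 'X_i ^+ l.-1 = 'X_i ^+ l :> P by rewrite -exprS prednK.
  by rewrite -[in RHS]xl /K xl; ring: xl.
have -> : conv (fun e => (a%:R - e%:R)%:MP * geo i e) h a
    = - k%:MP * \sum_j 'X_j ^+ l * shift (conv (geo i) (conv (geo j) h)) a.
  transitivity (conv (geo i) (fun b => b%:R%:MP * h b) a).
    apply: eq_bigr => s _; rewrite -natrB; first by ring.
    by rewrite -ltnS.
  rewrite (eq_conv (fun _ _ => erefl) (fun b _ => newton_euler b)) convZr conv_sumr.
  by congr (_ * _); apply: eq_bigr => j _; rewrite convZr conv_shiftr.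
have -> : conv S h a = \sum_(j | j != i) (conv (geo i) h a
    + 'X_j ^+ l * shift (conv (geo i) (conv (geo j) h)) a).
  rewrite conv_suml; apply: eq_bigr => j _.
  transitivity (conv (geo i) (conv (geo j) h) a); first exact/esym/convA.
  rewrite (eq_conv (fun _ _ => erefl) (fun b _ => conv_geometric _ h b)).
  by rewrite convDr convZr conv_shiftr.
rewrite big_split /= sumr_const cardC1 card_ord (bigD1 i) //=.
have -> : conv (geo i) h a *+ n.-1 = (n%:R - 1) * conv (geo i) h a.
  have n1 : n.-1%:R = n%:R - 1 :> P.
    by apply/eqP; rewrite -subr_eq opprK natr1 (ltn_predK (ltn_ord i)).
  by rewrite -n1 mulr_natl.
have -> : B = l%:R * (n%:R - 1) * k by exact: hc.
by rewrite /K !(mpolyCM, mpolyCB) !mpolyC_nat mpolyC1; ring.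
Qed.

(** Only the reflections exchanging $i$ and $j$ act nontrivially on $x_i^N$ in direction $j$. With
    $g_j=1/(1-x_j^lt)$ they contribute $kl\,x_i^qx_j^{l-1}t\,g_ig_j\Phi$, and $\partial_j\Phi$
    contributes the negative of this. *)
Lemma dk_sing_off q a i j : (0 < q < l)%N -> i != j -> D (e_ j) (sing q a i) = 0.
Proof.
move=> hq ij; set h := newton n l k.
rewrite dk_sing_expand -/h.
pose x := 'X_i ^+ q * 'X_j ^+ l.-1 : P; pose K := (k * l%:R)%:MP : P.
have F e : D (e_ j) ('X_i ^+ (q + l * e))
    = x * K * shift (conv (geo i) (geo j)) e.
  rewrite dk_pow (negPf ij) mul0r scale0r sub0r (bigD1 j) 1?eq_sym //=.
  rewrite pair_quot_off // big1 ?addr0 => [|j' /andP[j'i j'j]].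
    by rewrite -!mul_mpolyC /K /x mpolyCN mpolyCM; ring.
  apply: big1 => m _; rewrite (negPf ij) (negPf j'j) mulr0 subr0 scale0r //.
rewrite (eq_conv (fun e _ => F e) (fun _ _ => erefl)) convZl conv_shiftl.
rewrite (eq_conv (a' := fun e => 'X_i ^+ q * geo i e) (b' := fun b =>
  - K * 'X_j ^+ l.-1 * shift (conv (geo j) h) b)); first last.
- by move=> b _; rewrite mderiv_newton -mul_mpolyC mpolyCN mulrA.
- by move=> e _; rewrite exprD exprM.
rewrite convZl convZr conv_shiftr.
have -> : shift (conv (geo i) (conv (geo j) h)) a
    = shift (conv (conv (geo i) (geo j)) h) a by case: a => //= a; rewrite convA.
by rewrite /x; ring.
Qed.

Lemma dk_sing y q a i : (0 < q < l)%N ->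
  (q + l * a)%:R - 2%:R * cyc_sum q = l%:R * (n%:R - 1) * k ->
  D y (sing q a i) = 0.
Proof.
move=> hq hc; rewrite [y](matrix_sum_delta).
have Dsum (r : seq 'I_n) f :
    D (\sum_(j <- r) y j 0 *: e_ j) f = \sum_(j <- r) y j 0 *: D (e_ j) f.
  elim: r => [|j r IH]; last by rewrite !big_cons dkDl IH.
  by rewrite !big_nil -(scale0r 0) dkZl ?scale0r.
under eq_bigr => j _ do rewrite big_ord1.
rewrite Dsum big1 // => j _; have [->|ij] := eqVneq j i.
  by rewrite dk_sing_diag ?scaler0.
by rewrite dk_sing_off ?scaler0 // eq_sym.
Qed.

End SingularVectors.

(** * Degrees, and words in the Dunkl operators *)

Section Homogeneous.
Variables (C : numFieldType) (n l : nat) (eps : C).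
Hypotheses (hl : (1 < l)%N) (heps : l.-primitive_root eps).
Local Notation W := (cyc_wreath n l).
Local Notation P := {mpoly C[n]}.
Local Notation act := (wact eps).
Local Notation e_ i := (delta_mx i 0 : 'cV[C]_n).

Lemma dhomog_ind (Q : nat -> P -> Prop) :
  (forall d, Q d 0) -> (forall d a f f', Q d f -> Q d f' -> Q d (a *: f + f')) ->
  Q 0%N 1 -> (forall d i f, f \is d.-homog -> Q d f -> Q d.+1 ('X_i * f)) ->
  forall d f, f \is d.-homog -> Q d f.
Proof.
move=> Q0 QD Q1 QX.
have QXm d m : mdeg m = d -> Q d 'X_[m].
  elim: d m => [|d IH] m md.
    by move/eqP: md; rewrite mdeg_eq0 => /eqP->; rewrite mpolyX0.
  have [i mi] : exists i, m i != 0%N.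
    apply/existsP; rewrite -negb_forall; apply/negP=> /forallP m0.
    by move: md; rewrite mdegE big1 // => i _; apply/eqP.
  have mE : m = (U_(i) + (m - U_(i)))%MM.
    by rewrite addmC submK // lep1mP.
  have md' : mdeg (m - U_(i))%MM = d.
    by move: md; rewrite {1}mE mdegD mdeg1 add1n => -[].
  by rewrite mE mpolyXD; apply: QX; [rewrite dhomogX /= md'|apply: IH].
move=> d f /dhomogP hf; rewrite (mpolyE f).
elim: (msupp f) hf => [|m s IH] hf; rewrite ?big_nil ?big_cons //.
by apply: QD; [apply: QXm; apply: hf; rewrite mem_head|
  apply: IH => m' ms; apply: hf; rewrite inE ms orbT].
Qed.

Lemma mulX_homog d i (f : P) : f \is d.-homog -> 'X_i * f \is d.+1.-homog.
Proof. by rewrite -[d.+1]add1n; apply: dhomogM; rewrite dhomogX /= mdeg1. Qed.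

Lemma wact_homog d (g : W) f : f \is d.-homog -> act g f \is d.-homog.
Proof.
move: d f; apply: dhomog_ind => [d|d a f f' IH IH'||d i f _ IH].
- by rewrite linear0 rpred0.
- by rewrite wactP rpredD // rpredZ.
- by rewrite rmorph1 dhomog1.
- by rewrite rmorphM /= (wactX hl heps) -scalerAl rpredZ // mulX_homog.
Qed.

Variable c : l.-tuple C.
Local Notation D := (dk eps c).

Lemma dk_homog (y : 'cV[C]_n) d f : f \is d.-homog ->
  if d is d'.+1 then D y f \is d'.-homog else D y f = 0.
Proof.
move: d f; apply: dhomog_ind => [[|d]|[|d] a f f' IH IH'||d i f hf IH].
- by rewrite (dk0 hl heps).
- by rewrite (dk0 hl heps) rpred0.
- by rewrite (dkP hl heps) IH IH' scaler0 addr0.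
- by rewrite (dkP hl heps) rpredD // rpredZ.
- by rewrite (dk1 hl heps).
rewrite (dk_mulX hl heps) rpredB ?rpredD // ?rpredZ //.
  by case: d IH {hf} => [->|d IH]; rewrite ?mulr0 ?rpred0 // mulX_homog.
by rewrite /refl_op rpred_sum // => s _; rewrite rpredZ // wact_homog.
Qed.

Definition dk_word (m : 'X_{1..n}) (f : P) : P :=
  foldr (fun i g => iter (m i) (D (e_ i)) g) f (enum 'I_n).

Lemma dk_iterP i a b f f' : iter b (D (e_ i)) (a *: f + f')
  = a *: iter b (D (e_ i)) f + iter b (D (e_ i)) f'.
Proof. by elim: b => //= b ->; rewrite (dkP hl heps). Qed.

Lemma dk_wordP m a f f' :
  dk_word m (a *: f + f') = a *: dk_word m f + dk_word m f'.
Proof.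
by rewrite /dk_word; elim: (enum _) => //= i s ->; rewrite dk_iterP.
Qed.

Lemma dk_word_stable (K : P -> Prop) m f :
  (forall y f, K f -> K (D y f)) -> K f -> K (dk_word m f).
Proof.
move=> KD Kf; rewrite /dk_word; elim: (enum _) => //= i s.
by elim: (m i) => //= b IH Ks; apply/KD/IH.
Qed.

Lemma dk_word_homog e m f : f \is e.-homog ->
  if (mdeg m <= e)%N then is_true (dk_word m f \is (e - mdeg m).-homog)
  else dk_word m f = 0.
Proof.
move=> hf; pose H a (h : P) : Prop :=
  if (a <= e)%N then is_true (h \is (e - a).-homog) else h = 0.
have HD a h i : H a h -> H a.+1 (D (e_ i) h).
  rewrite /H; case: (ltngtP a e) => [ae|ae|ae].
  - move=> /(dk_homog (e_ i)); rewrite subnS.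
    by case: (e - a)%N (subn_gt0 a e) => [|d]; rewrite ae.
  - by move->; rewrite (dk0 hl heps).
  - by rewrite ae subnn => /(dk_homog (e_ i)).
rewrite -/(H (mdeg m) _).
suff : H (\sum_(i <- enum 'I_n) m i)%N (dk_word m f) by rewrite big_enum mdegE.
rewrite /dk_word; elim: (enum _) => [|i s IH]; first by rewrite big_nil /H subn0.
rewrite big_cons /=; elim: (m i) => [|b IHb] //=.
by rewrite addSn; apply: HD.
Qed.

Definition dk_form m f : C := (dk_word m f)@_0.

Lemma dk_formP m a f f' : dk_form m (a *: f + f') = a * dk_form m f + dk_form m f'.
Proof. by rewrite /dk_form dk_wordP mcoeffD mcoeffZ. Qed.

Lemma dk_form_homog e m f : f \is e.-homog -> e != mdeg m -> dk_form m f = 0.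
Proof.
move=> hf em; have := dk_word_homog m hf; rewrite /dk_form.
case: leqP => [me hw|_ ->]; rewrite ?mcoeff0 //.
apply: (dhomog_nemf_coeff hw).
by rewrite /= mdeg0 eq_sym subn_eq0 -ltnNge ltn_neqAle me andbT eq_sym.
Qed.

End Homogeneous.

(** * The base parameter *)

Section Decoupled.
Variables (C : numFieldType) (n l : nat) (eps : C).
Hypotheses (hl : (1 < l)%N) (heps : l.-primitive_root eps).
Local Notation W := (cyc_wreath n l).
Local Notation P := {mpoly C[n]}.
Local Notation e_ i := (delta_mx i 0 : 'cV[C]_n).

Section KZero.
Variable c : l.-tuple C.
Hypothesis k0 : c`_0 = 0.
Local Notation D := (dk eps c).

Lemma mpolyX_split (i : 'I_n) (m : 'X_{1..n}) :
  'X_[m] = 'X_i ^+ m i * \prod_(j | j != i) 'X_j ^+ m j :> P.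
Proof.
by rewrite mpolyXE_id (bigD1 i).
Qed.

Lemma mpolyX_predU (i : 'I_n) (m : 'X_{1..n}) : m i != 0%N ->
  'X_[m] = 'X_i * 'X_[m - U_(i)] :> P.
Proof. by move=> mi; rewrite -mpolyXD addmC submK // lep1mP. Qed.

Lemma wact_inl_mon i (a : 'Z_l) (m : 'X_{1..n}) :
  wact eps (refl (inl (i, a)) : W) 'X_[m] = eps ^- (a * m i) *: 'X_[m] :> P.
Proof.
rewrite (mpolyX_split i m) rmorphM rmorph_prod /= scalerAl; congr (_ * _).
  by rewrite (wact_XnE hl heps) /= perm1 ffunE eqxx.
apply: eq_bigr => j ji; rewrite (wact_XnE hl heps) /= perm1 ffunE (negPf ji).
by rewrite mul0n expr0 invr1 scale1r.
Qed.

Lemma dquot_mon_inl i (a : 'Z_l) (m : 'X_{1..n}) : a != 0 ->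
  dquot eps (inl (i, a)) 'X_[m] = (1 - eps ^- (a * m i)) *: 'X_[m - U_(i)] :> P.
Proof.
move=> a0; apply: (dquot_unique hl heps) => //; rewrite wact_inl_mon lin_form_delta.
have [mi|mi] := eqVneq (m i) 0%N.
  by rewrite mi muln0 expr0 invr1 subrr scale0r mulr0 scale1r subrr.
by rewrite -scalerAr -mpolyX_predU // scalerBl scale1r.
Qed.

(** In one variable, $D(x^N)$ is this multiple of $x^{N-1}$; for $k=0$ each variable behaves in this
    way independently of the others. *)
Definition lowering (N : nat) : C := N%:R - 2%:R * cyc_sum eps c N.

Lemma lowering0 : lowering 0 = 0.
Proof.
rewrite /lowering /cyc_sum big1 ?mulr0 ?subrr // => m _.
by rewrite muln0 expr0 invr1 subrr mul0r mulr0.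
Qed.

Lemma dk_mon j (m : 'X_{1..n}) :
  D (e_ j) 'X_[m] = lowering (m j) *: 'X_[m - U_(j)].
Proof.
rewrite dk_sumE big_sumType /= [X in - (_ + X)]big1 ?addr0; last first.
  by move=> [[a b] m'] _; rewrite /refl_weight /= k0 mulr0 !mul0r scale0r.
rewrite /lowering scalerBl; congr (_ - _).
  rewrite (bigD1 j) //= big1 ?addr0 => [|i ij]; last by rewrite mxE (negPf ij) scale0r.
  by rewrite mxE !eqxx scale1r mderivX.
transitivity (\sum_(i : 'I_n) \sum_(a : 'Z_l | a != 0) if i == j then
    ((2%:R * (c`_a * ((1 - eps ^- (a * m j)) / (1 - eps ^- a)))))
      *: 'X_[m - U_(j)] else 0 : P).
  rewrite pair_big_dep /=; apply: eq_big => [[i a]|[i a] a0] //=.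
  rewrite dquot_mon_inl // pairing_delta scalerA /refl_weight /=.
  case: eqP => [->|_]; last by rewrite mulr0 mul0r scale0r.
  by congr (_ *: _); rewrite mulr1; move: (1 - eps ^- a)^-1 (1 - _) => z z'; ring.
rewrite (bigD1 j) //= [X in _ + X]big1 ?addr0; last first.
  by move=> i ij; rewrite big1 // => a _; rewrite (negPf ij).
rewrite eqxx -scaler_suml -!mulr_sumr /cyc_sum.
by rewrite (sum_Zp_neq0 hl (fun a => c`_a * ((1 - eps ^- (a * m j)) / (1 - eps ^- a)))).
Qed.

Lemma dk_iter_mon i b (m : 'X_{1..n}) : iter b (D (e_ i)) 'X_[m]
  = (\prod_(a < b) lowering (m i - a)) *: 'X_[m - U_(i) *+ b].
Proof.
elim: b => [|b IH]; first by rewrite big_ord0 scale1r mulm0n subm0.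
rewrite iterS IH (dkZ hl heps) dk_mon scalerA big_ord_recr /= mnmBE mulmnE mnm1E eqxx.
by rewrite mul1n; congr (_ *: 'X_[_]); rewrite submDA mulmSr.
Qed.

Lemma dk_word_mon (m' m : 'X_{1..n}) : dk_word eps c m' 'X_[m]
  = (\prod_i \prod_(a < m' i) lowering (m i - a)) *: 'X_[m - m'].
Proof.
rewrite [in 'X_[m - m']](multinomUE_id m') -!big_enum /dk_word.
have : uniq (enum 'I_n) by apply: enum_uniq.
elim: (enum _) => [|i s IH] /=; first by rewrite !big_nil scale1r subm0.
move=> /andP[is_ us]; rewrite IH // !big_cons (_ : forall a f b, iter b (D (e_ i)) (a *: f)
  = a *: iter b (D (e_ i)) f); last first.
  by move=> a f; elim=> //= b ->; rewrite (dkZ hl heps).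
rewrite dk_iter_mon scalerA mulrC submDA addmC; congr (_ * _ *: _).
apply: eq_bigr => a _; congr (lowering (_ - _)).
rewrite mnmBE mnm_sumE big_seq big1 ?subn0 // => j js.
rewrite mulmnE mnm1E; case: eqP js => [->|_ _]; last by rewrite mul0n.
by rewrite (negPf is_).
Qed.

End KZero.

Variables (q r : nat).
Hypothesis hq : (0 < q < l)%N.

(* By Fourier inversion, this is the point with [k = 0] at which
   [2 * cyc_sum N] is [r] if [N = q] modulo [l], and [0] otherwise. *)
Definition base_param : l.-tuple C := [tuple if val i == 0%N then 0 else
  - (r%:R / (2%:R * l%:R)) * eps ^+ (i * q) * (1 - eps ^- i) | i < l].

Lemma base_param0 : base_param`_0 = 0.
Proof.
have l0 : (0 < l)%N := ltnW hl.
by rewrite (nth_mktuple _ _ (Ordinal l0) : base_param`_(Ordinal l0) = _).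
Qed.

Lemma cyc_sum_base N : 2%:R * cyc_sum eps base_param N
  = if N == q %[mod l] then r%:R else 0.
Proof.
have l0 : (0 < l)%N := ltnW hl.
have lR : l%:R != 0 :> C by rewrite pnatr_eq0 -lt0n.
have t0 : 2%:R != 0 :> C by rewrite pnatr_eq0.
(* [l.-1 * N] stands for $-N$ modulo $l$, so that all exponents are natural numbers, as in
   [eps_sum]. The term at [m = 0] vanishes and may be included. *)
pose F (m : nat) : C := - (r%:R / (2%:R * l%:R)) *
  (eps ^+ (m * q) - eps ^+ (m * (q + l.-1 * N))).
have -> : cyc_sum eps base_param N = \sum_(m : 'Z_l) F m.
  transitivity (\sum_(m : 'Z_l | m != 0) F m); last first.
    rewrite [RHS](bigID (fun m => m != 0)) /= [X in _ + X]big1 ?addr0 //.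
    by move=> m /negPn/eqP->; rewrite /F !mul0n subrr mulr0.
  rewrite (sum_Zp_neq0 hl); apply: eq_big_nat => m /andP[m0 ml].
  rewrite (nth_mktuple _ _ (Ordinal ml) : base_param`_(Ordinal ml) = _) /=.
  rewrite (gtn_eqF m0) /F -!mulrA; congr (_ * _).
  have em : 1 - eps ^- m != 0.
    rewrite subr_eq0 eq_sym invr_eq1 -(prim_order_dvd heps) gtnNdvd //.
  rewrite [X in _ * X]mulrCA mulfV // mulr1 mulrBr mulr1; congr (_ - _).
  rewrite mulnDr exprD mulnCA; congr (_ * _); apply: invr_inj; rewrite invrK.
  apply: (mulIf (expf_neq0 (l.-1 * (m * N)) (eps_neq0 hl heps))).
  rewrite mulVf ?expf_neq0 ?(eps_neq0 hl heps) // -exprD -mulSn prednK //.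
  by rewrite exprM (prim_expr_order heps) expr1n.
rewrite -mulr_sumr sumrB !(eps_sum hl heps).
have -> : (l %| q)%N = false by rewrite gtnNdvd //; case/andP: hq.
have -> : (l %| q + l.-1 * N)%N = (N == q %[mod l]).
  have e : (q + l.-1 * N + N = q + l * N)%N by rewrite -addnA -mulSnr prednK.
  rewrite -(eqn_modDr (l.-1 * N)) [(N + _)%N]addnC -mulSnr prednK // modnMr eq_sym.
  by rewrite /dvdn.
by case: ifP => _; rewrite ?subr0 ?mulr0 // sub0r; field; rewrite ?lR ?t0.
Qed.

Lemma base_param_hyperplane : param_hyperplane n eps base_param r q.
Proof.
rewrite /param_hyperplane base_param0 mulr0 add0r -/(cyc_sum eps base_param q).
by rewrite cyc_sum_base eqxx.
Qed.

(** The value is either [N] or [N - r]. *)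
Lemma lowering_base N : (0 < N < r)%N -> lowering base_param N != 0.
Proof.
case/andP=> N0 Nr; rewrite /lowering cyc_sum_base; case: ifP => _.
  by rewrite subr_eq0 eqr_nat ltn_eqF.
by rewrite subr0 pnatr_eq0 -lt0n.
Qed.

Definition mnm_of (J : {ffun 'I_n -> 'I_r}) : 'X_{1..n} := [multinom J i : nat | i < n].

(** If some [J' i] exceeds [J i], the factor [lowering 0] occurs and is zero. Otherwise a monomial
    of positive degree is left unless [J' = J], and then all factors are nonzero by
    [lowering_base]. *)
Lemma dk_form_base (J' J : {ffun 'I_n -> 'I_r}) :
  (dk_form eps base_param (mnm_of J') 'X_[mnm_of J] == 0) = (J' != J).
Proof.
rewrite /dk_form (dk_word_mon base_param0) mcoeffZ mcoeffX.
have [->|JJ'] := eqVneq J' J.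
  have -> : (mnm_of J - mnm_of J)%MM = 0%MM by apply/mnmP=> i; rewrite mnmBE subnn mnm0E.
  rewrite eqxx mulr1; apply/negbTE; apply/prodf_neq0 => i _; apply/prodf_neq0 => a _.
  have aJ : (a < J i)%N := leq_trans (ltn_ord a) (eq_leq (mnmE _ _)).
  apply: lowering_base; move: (nat_of_ord a) aJ => b bJ; rewrite mnmE subn_gt0 bJ /=.
  by apply: leq_ltn_trans (leq_subr _ _) (ltn_ord (J i)).
rewrite mulf_eq0; apply/orP.
have [/forallP le|] := boolP [forall i, J' i <= J i]%N.
  right; rewrite pnatr_eq0 eqb0; apply: contraNneq JJ' => /mnmP H.
  apply/eqP/ffunP=> i; apply: val_inj; apply/eqP; rewrite eqn_leq le /=.
  by have := H i; rewrite mnmBE !mnmE => /eqP; rewrite subn_eq0.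
case/forallPn=> i; rewrite -ltnNge => lt; left.
apply/prodf_eq0; exists i => //; rewrite mnmE.
by apply/prodf_eq0; exists (Ordinal lt) => //; rewrite mnmE subnn lowering0.
Qed.

End Decoupled.

(** * Dependence on the parameter *)

Section PolynomialFunctions.
Variables (C : numFieldType) (n l : nat) (eps : C).
Hypotheses (hl : (1 < l)%N) (heps : l.-primitive_root eps).
Local Notation P := {mpoly C[n]}.
Local Notation T := (l.-tuple C).

Definition polyfun (g : T -> C) : Prop :=
  exists q : {mpoly C[l]}, forall c, g c = q.@[tnth c].

Lemma polyfun_const a : polyfun (fun _ => a).
Proof. by exists a%:MP => c; rewrite mevalC. Qed.

Lemma polyfun_nth m : (m < l)%N -> polyfun (fun c => c`_m).
Proof.
by move=> ml; exists 'X_(Ordinal ml) => c; rewrite mevalXU (tnth_nth 0).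
Qed.

Lemma polyfunD g h : polyfun g -> polyfun h -> polyfun (fun c => g c + h c).
Proof. by move=> [q Hq] [q' Hq']; exists (q + q') => c; rewrite mevalD Hq Hq'. Qed.

Lemma polyfunM g h : polyfun g -> polyfun h -> polyfun (fun c => g c * h c).
Proof. by move=> [q Hq] [q' Hq']; exists (q * q') => c; rewrite mevalM Hq Hq'. Qed.

Lemma polyfun_sum (I : Type) (s : seq I) (Q : pred I) (F : I -> T -> C) :
  (forall i, Q i -> polyfun (F i)) -> polyfun (fun c => \sum_(i <- s | Q i) F i c).
Proof.
move=> HF; elim: s => [|i s IH].
  by under boolp.eq_fun do rewrite big_nil; apply: polyfun_const.
case Qi: (Q i); under boolp.eq_fun do rewrite big_cons Qi; last by [].
by apply: polyfunD; [apply: HF|].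
Qed.

Lemma polyfun_prod (I : Type) (s : seq I) (Q : pred I) (F : I -> T -> C) :
  (forall i, Q i -> polyfun (F i)) -> polyfun (fun c => \prod_(i <- s | Q i) F i c).
Proof.
move=> HF; elim: s => [|i s IH].
  by under boolp.eq_fun do rewrite big_nil; apply: polyfun_const.
case Qi: (Q i); under boolp.eq_fun do rewrite big_cons Qi; last by [].
by apply: polyfunM; [apply: HF|].
Qed.

Lemma polyfun_det m (A : T -> 'M[C]_m) :
  (forall i j, polyfun (fun c => A c i j)) -> polyfun (fun c => \det (A c)).
Proof.
move=> HA; apply: polyfun_sum => s _; apply: polyfunM; first exact: polyfun_const.
by apply: polyfun_prod => i _; apply: HA.
Qed.

Definition linear_form (L : P -> C) : Prop :=
  forall a f g, L (a *: f + g) = a * L f + L g.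

(** Polynomial dependence on the parameter is tested by all linear forms on $\mathbb{C}[x]$; closure
    under any linear operator independent of the parameter is then immediate. *)
Definition polyfam (F : T -> P) : Prop :=
  forall L, linear_form L -> polyfun (fun c => L (F c)).

Lemma linear_formD L : linear_form L -> {morph L : f g / f + g}.
Proof. by move=> hL f g; rewrite -[f in LHS]scale1r hL mul1r. Qed.
Lemma linear_form0 L : linear_form L -> L 0 = 0.
Proof. by move=> hL; have := hL (-1) 0 0; rewrite scaler0 addr0 mulN1r addNr. Qed.
Lemma linear_formZ L : linear_form L -> forall a f, L (a *: f) = a * L f.
Proof. by move=> hL a f; rewrite -[a *: f]addr0 hL linear_form0 // addr0. Qed.
Lemma linear_form_sum L : linear_form L -> forall (I : Type) (s : seq I) (Q : pred I) F,
  L (\sum_(i <- s | Q i) F i) = \sum_(i <- s | Q i) L (F i).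
Proof. by move=> hL I s Q F; apply: (big_morph L (linear_formD hL) (linear_form0 hL)). Qed.

Lemma polyfam_const f : polyfam (fun _ => f).
Proof. by move=> L _; apply: polyfun_const. Qed.

Lemma polyfam_map (A : P -> P) F :
  (forall a f g, A (a *: f + g) = a *: A f + A g) -> polyfam F ->
  polyfam (fun c => A (F c)).
Proof. by move=> hA hF L hL; apply: (hF (fun f => L (A f))) => a f g; rewrite hA hL. Qed.

Lemma polyfamZ g F : polyfun g -> polyfam F -> polyfam (fun c => g c *: F c).
Proof.
move=> hg hF L hL; under boolp.eq_fun do rewrite linear_formZ //.
exact: polyfunM (hF L hL).
Qed.

Lemma polyfamD F G : polyfam F -> polyfam G -> polyfam (fun c => F c + G c).
Proof.
move=> hF hG L hL; under boolp.eq_fun do rewrite linear_formD //.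
exact: polyfunD (hF L hL) (hG L hL).
Qed.

Lemma polyfam_sum (I : Type) (s : seq I) (Q : pred I) (F : I -> T -> P) :
  (forall i, Q i -> polyfam (F i)) -> polyfam (fun c => \sum_(i <- s | Q i) F i c).
Proof.
move=> HF L hL; under boolp.eq_fun do rewrite linear_form_sum //.
by apply: polyfun_sum => i Qi; apply: HF.
Qed.

Lemma polyfam_dk y F : polyfam F -> polyfam (fun c => dk eps c y (F c)).
Proof.
move=> hF; under boolp.eq_fun do rewrite dk_sumE.
apply: polyfamD.
  apply: polyfam_sum => i _; apply: polyfamZ; first exact: polyfun_const.
  by apply: polyfam_map hF => a f g; rewrite mderivD mderivZ.
under boolp.eq_fun do rewrite -scaleN1r.
apply: polyfamZ; first exact: polyfun_const.
apply: polyfam_sum => s hs; apply: polyfamZ; last first.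
  by apply: polyfam_map hF => a f g; rewrite (dquotP hl heps).
apply: polyfunM; last exact: polyfun_const.
apply: polyfunM; last exact: polyfun_const.
apply: polyfunM; first exact: polyfun_const.
case: s hs => [[i m]|x] _ /=; apply: polyfun_nth; last exact: ltnW.
by rewrite -[X in (_ < X)%N](Zp_cast hl).
Qed.

Lemma polyfun_dk_form m (f : P) : polyfun (fun c => dk_form eps c m f).
Proof.
suff : polyfam (fun c => dk_word eps c m f).
  by move=> H; apply: (H (fun g => g@_0)) => a g h; rewrite mcoeffD mcoeffZ.
rewrite /dk_word; elim: (enum _) => /= [|i s IH]; first exact: polyfam_const.
by elim: (m i) => //= b IHb; apply: polyfam_dk.
Qed.

Lemma polyfam_newton b : polyfam (fun c => newton n l c`_0 b).
Proof.
have [m] := ubnP b; elim: m b => // m IHm [|b] bm; first exact: polyfam_const.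
have -> : (fun c : T => newton n l c`_0 b.+1) = (fun c => b.+1%:R^-1 *: (- c`_0 *:
    \sum_(s < b.+1) power_sum C n l s.+1 * newton n l c`_0 (b - s))).
  by apply: boolp.funext => c; rewrite -newtonS scalerK // pnatr_eq0.
apply: polyfamZ; first exact: polyfun_const.
apply: polyfamZ.
  under boolp.eq_fun do rewrite -mulN1r.
  by apply: polyfunM; [exact: polyfun_const|apply: polyfun_nth; apply: ltnW].
apply: polyfam_sum => s _.
apply: (polyfam_map (A := fun f => power_sum C n l s.+1 * f)) => [a f g|].
  by rewrite mulrDr scalerAr.
by apply: IHm; rewrite (leq_ltn_trans (leq_subr _ _)).
Qed.

Lemma polyfam_sing q a (i : 'I_n) : polyfam (fun c => sing c q a i).
Proof.
apply: polyfam_sum => s _.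
apply: (polyfam_map (A := fun f => 'X_i ^+ (q + l * s) * f)) => [b f g|].
  by rewrite mulrDr scalerAr.
exact: polyfam_newton.
Qed.

Definition line (c1 c0 : T) (t : C) : T :=
  [tuple tnth c1 i + t * (tnth c0 i - tnth c1 i) | i < l].

Lemma polyfun_line c1 c0 g : polyfun g -> exists Q : {poly C}, forall t,
  g (line c1 c0 t) = Q.[t].
Proof.
move=> [q Hq].
exists (\sum_(m <- msupp q) q@_m *: \prod_i
  ((tnth c1 i)%:P + 'X * (tnth c0 i - tnth c1 i)%:P) ^+ m i) => t.
rewrite Hq mevalE horner_sum; apply: eq_bigr => m _.
rewrite hornerZ horner_prod; congr (_ * _); apply: eq_bigr => i _.
by rewrite horner_exp hornerD hornerM !hornerC hornerX tnth_mktuple.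
Qed.

End PolynomialFunctions.

(** * The ideal of singular vectors *)

Section BoundedCoordinates.
Variables (C : numFieldType) (n B : nat).
Local Notation P := {mpoly C[n]}.
Local Notation I := {: 'X_{1..n < B}}.
Local Notation N := #|I|.
Local Notation mon i := (bmnm (enum_val i : 'X_{1..n < B})).

(** Truncation to degrees below [B] replaces the infinite-dimensional polynomial ring by column
    vectors. *)
Definition coords (f : P) : 'cV[C]_N := \col_i f@_(mon i).
Definition of_coords (v : 'cV[C]_N) : P := \sum_i v i 0 *: 'X_[mon i].

Lemma coordsP a f g : coords (a *: f + g) = a *: coords f + coords g.
Proof. by apply/colP=> i; rewrite !mxE mcoeffD mcoeffZ. Qed.

Lemma of_coordsP a u v : of_coords (a *: u + v) = a *: of_coords u + of_coords v.
Proof.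
rewrite /of_coords scaler_sumr -big_split; apply: eq_bigr => i _ /=.
by rewrite !mxE scalerDl scalerA.
Qed.

Lemma coords0 : coords 0 = 0.
Proof. by apply/colP=> i; rewrite !mxE mcoeff0. Qed.

Lemma of_coords0 : of_coords 0 = 0.
Proof. by rewrite /of_coords big1 // => i _; rewrite mxE scale0r. Qed.

Lemma of_coordsK v : coords (of_coords v) = v.
Proof.
apply/colP=> i; rewrite mxE /of_coords raddf_sum (bigD1 i) //= big1 => [|j ji].
  by rewrite addr0 mcoeffZ mcoeffX eqxx mulr1.
rewrite mcoeffZ mcoeffX (_ : (_ == _) = false) ?mulr0 //.
apply/negbTE; apply: contraNneq ji => H; apply/eqP/enum_val_inj/val_inj.
exact: H.
Qed.

Lemma coordsK f : (forall m, m \in msupp f -> (mdeg m < B)%N) ->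
  of_coords (coords f) = f.
Proof.
move=> hf; apply/mpolyP => m; rewrite /of_coords raddf_sum /=.
have [mB|mB] := ltnP (mdeg m) B.
  pose i : 'I_N := enum_rank (BMultinom mB : 'X_{1..n < B}).
  rewrite (bigD1 i) //= big1 => [|j ji].
    by rewrite addr0 mcoeffZ mcoeffX mxE enum_rankK /= eqxx mulr1.
  rewrite mcoeffZ mcoeffX (_ : (_ == _) = false) ?mulr0 //.
  apply/negbTE; apply: contraNneq ji => H; rewrite /i; apply/eqP/enum_val_inj.
  by rewrite enum_rankK; apply: val_inj.
rewrite big1 => [|j _]; last first.
  rewrite mcoeffZ mcoeffX (_ : (_ == _) = false) ?mulr0 //.
  by apply/negbTE; apply: contraTneq (bmdeg (enum_val j)) => ->; rewrite -leqNgt.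
apply/esym/memN_msupp_eq0; apply/negP => /hf; rewrite ltnNge mB //.
Qed.

Lemma coords_homog d f : f \is d.-homog -> (d < B)%N -> of_coords (coords f) = f.
Proof. by move=> hf dB; apply: coordsK => m /(dhomog_mf hf) /= ->. Qed.

End BoundedCoordinates.

Section Family.
Variables (C : numFieldType) (n l : nat) (eps : C).
Hypotheses (hl : (1 < l)%N) (heps : l.-primitive_root eps).
Local Notation W := (cyc_wreath n l).
Local Notation P := {mpoly C[n]}.
Local Notation act := (wact eps).
Variables (p q r : nat).
Hypotheses (hq : (0 < q < l)%N) (hr : r = (p.-1 * l + q)%N).
Local Notation V := (U_tensor C n r).

Let r0 : (0 < r)%N. Proof. by rewrite hr; case/andP: hq => q0 _; rewrite addn_gt0 q0 orbT. Qed.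

Section Ideal.
Variable c : l.-tuple C.
Hypothesis hc : param_hyperplane n eps c r q.
Local Notation f_ := (sing c q p.-1 : 'I_n -> P).

Definition sing_ideal (f : P) : Prop := exists g : 'I_n -> P, f = \sum_i g i * f_ i.

Lemma dk_sing0 y i : dk eps c y (f_ i) = 0.
Proof.
apply: (dk_sing hl heps) => //; move: hc; rewrite /param_hyperplane -/(cyc_sum eps c q).
move=> H; have -> : (q + l * p.-1)%N = r by rewrite hr addnC mulnC.
by rewrite -H addrK.
Qed.

Lemma sing_homog i : f_ i \is r.-homog.
Proof.
rewrite rpred_sum // => s _.
have -> : r = (q + l * s + l * (p.-1 - s))%N 
    by rewrite hr; move: (ltn_ord s); clear; nia.
by apply: dhomogM; [rewrite mpolyXn dhomogX /= mdegMn mdeg1 mul1n|apply: newton_homog].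
Qed.

Lemma sing_idealP a f g : sing_ideal f -> sing_ideal g -> sing_ideal (a *: f + g).
Proof.
move=> [u ->] [v ->]; exists (fun i => a *: u i + v i).
rewrite scaler_sumr -big_split; apply: eq_bigr => i _ /=.
by rewrite mulrDl scalerAl.
Qed.

Lemma sing_ideal0 : sing_ideal 0.
Proof. by exists (fun _ => 0); rewrite big1 // => i _; rewrite mul0r. Qed.

Lemma sing_ideal_sum (J : Type) (s : seq J) (Q : pred J) F :
  (forall j, Q j -> sing_ideal (F j)) -> sing_ideal (\sum_(j <- s | Q j) F j).
Proof.
move=> HF; elim/big_rec: _ => [|j f /HF Fj IH]; first exact: sing_ideal0.
by have := sing_idealP 1 Fj IH; rewrite scale1r.
Qed.

Lemma sing_idealZ a f : sing_ideal f -> sing_ideal (a *: f).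
Proof. by move=> hf; have := sing_idealP a hf sing_ideal0; rewrite addr0. Qed.

Lemma sing_idealM h f : sing_ideal f -> sing_ideal (h * f).
Proof.
move=> [u ->]; exists (fun i => h * u i).
by rewrite mulr_sumr; apply: eq_bigr => i _; rewrite mulrA.
Qed.

Lemma sing_ideal_gen h i : sing_ideal (h * f_ i).
Proof.
exists (fun j => if j == i then h else 0); rewrite (bigD1 i) //= eqxx big1 ?addr0 //.
by move=> j /negPf->; rewrite mul0r.
Qed.

Lemma wact_sing (g : W) i : exists a, act g (f_ i) = a *: f_ (cw_perm g i).
Proof.
exists (eps ^- (cw_exp g (cw_perm g i) * q)).
rewrite /sing /conv rmorph_sum scaler_sumr; apply: eq_bigr => s _ /=.
rewrite rmorphM /= wact_newton // wact_XnE // scalerAl; congr (_ *: _ * _).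
rewrite mulnDr exprD mulnCA (exprM _ l) (prim_expr_order heps) expr1n mulr1 //.
Qed.

Lemma wact_sing_ideal (g : W) f : sing_ideal f -> sing_ideal (act g f).
Proof.
move=> [u ->]; rewrite rmorph_sum; apply: sing_ideal_sum => i _ /=.
rewrite rmorphM /=; have [a ->] := wact_sing g i.
by rewrite -scalerAr; apply/sing_idealZ/sing_ideal_gen.
Qed.

(** Moving $D_y$ past a variable produces reflections, and these send each $f_i$ to a multiple of
    some $f_j$; so the vanishing of $D_yf_i$ propagates to all multiples of $f_i$. *)
Lemma dk_sing_ideal y f : sing_ideal f -> sing_ideal (dk eps c y f).
Proof.
move=> [u ->]; rewrite (dk_sum hl heps); apply: sing_ideal_sum => i _.
elim/mpoly_mulX_ind: (u i) => [a f' g IH IH'||j g IH].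
- by rewrite mulrDl -scalerAl (dkP hl heps); apply: sing_idealP.
- by rewrite mul1r dk_sing0; apply: sing_ideal0.
rewrite -mulrA (dk_mulX hl heps) addrC -scaleN1r; apply: sing_idealP.
  rewrite /refl_op; apply: sing_ideal_sum => s _; apply/sing_idealZ/wact_sing_ideal.
  exact: sing_ideal_gen.
rewrite addrC; apply: sing_idealP; first exact: sing_ideal_gen.
exact: sing_idealM.
Qed.

(** Words in the Dunkl operators stay inside the ideal, whose elements have no constant term because
    the generators have degree $r>0$. *)
Lemma dk_form_sing_ideal m f : sing_ideal f -> dk_form eps c m f = 0.
Proof.
move=> hf; rewrite /dk_form.
have [u ->] := dk_word_stable (K := sing_ideal) m (@dk_sing_ideal) hf.
rewrite raddf_sum big1 // => i _; rewrite /= (rmorphM (mcoeff 0)) /=.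
rewrite (dhomog_nemf_coeff (sing_homog i)) ?mulr0 //=.
by rewrite mdeg0 eq_sym -lt0n.
Qed.

End Ideal.

End Family.

Section LineParam.
Variables (C : numFieldType) (n l : nat) (eps : C) (c1 c0 : l.-tuple C).
Hypotheses (hl : (1 < l)%N).

Lemma nth_line t m : (m < l)%N ->
  (line c1 c0 t)`_m = c1`_m + t * (c0`_m - c1`_m).
Proof.
move=> ml; have := tnth_mktuple (fun i => tnth c1 i + t * (tnth c0 i - tnth c1 i)) (Ordinal ml).
by rewrite !(tnth_nth 0).
Qed.

Lemma line1 : line c1 c0 1 = c0.
Proof. by apply: eq_from_tnth => i; rewrite tnth_mktuple mul1r addrC subrK. Qed.

Lemma line_hyperplane r q t : param_hyperplane n eps c1 r q ->
  param_hyperplane n eps c0 r q -> param_hyperplane n eps (line c1 c0 t) r q.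
Proof.
rewrite /param_hyperplane -!/(cyc_sum eps _ q) nth_line ?(ltnW hl) // => h1 h0.
have -> : cyc_sum eps (line c1 c0 t) q
    = cyc_sum eps c1 q + t * (cyc_sum eps c0 q - cyc_sum eps c1 q).
  rewrite /cyc_sum -sumrB mulr_sumr -big_split; apply: eq_big_nat => m /andP[_ ml].
  by rewrite /= nth_line //; move: (_ / _) => z; ring.
transitivity ((1 - t) * r%:R + t * r%:R : C); last by ring.
by rewrite -{1}h1 -h0; ring.
Qed.

(** The Dunkl operators are affine in the parameter, which is the shape [T0 + t T1] required by
    [limit_stable]. *)
Lemma dk_line t y (f : {mpoly C[n]}) : dk eps (line c1 c0 t) y f
  = dk eps c1 y f + t *: (dk eps c0 y f - dk eps c1 y f).
Proof.
rewrite !dk_sumE; set A := \sum_i _.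
have -> : A - \sum_(s | is_refl s) (refl_weight eps c0 s
      * pairing (refl_root eps s) y) *: dquot eps s f
    - (A - \sum_(s | is_refl s) (refl_weight eps c1 s
      * pairing (refl_root eps s) y) *: dquot eps s f)
    = \sum_(s | is_refl s) (refl_weight eps c1 s
      * pairing (refl_root eps s) y) *: dquot eps s f
    - \sum_(s | is_refl s) (refl_weight eps c0 s
      * pairing (refl_root eps s) y) *: dquot eps s f.
  by rewrite opprB addrC addrA subrK.
rewrite -addrA; congr (_ + _); rewrite -sumrB scaler_sumr -!sumrN -big_split.
apply: eq_bigr => s hs /=; rewrite -scalerBl scalerA -!scaleNr -scalerDl; congr (_ *: _).
have -> : refl_weight eps (line c1 c0 t) s = refl_weight eps c1 s
    + t * (refl_weight eps c0 s - refl_weight eps c1 s).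
  rewrite /refl_weight; move: (1 - _)^-1 => z.
  case: s hs => [[i m]|[[i j] m]] _ /=.
    by rewrite nth_line; [ring|rewrite -[X in (_ < X)%N](Zp_cast hl)].
  by rewrite nth_line ?(ltnW hl) //; ring.
by ring.
Qed.

End LineParam.

(** * Division by the singular vectors *)

Section Division.
Variables (C : numFieldType) (n l : nat) (eps : C).
Hypotheses (hl : (1 < l)%N) (heps : l.-primitive_root eps).
Local Notation P := {mpoly C[n]}.
Variables (p q r : nat).
Hypotheses (hq : (0 < q < l)%N) (hr : r = (p.-1 * l + q)%N).
Local Notation V := (U_tensor C n r).
Local Notation B := (n * r + 2)%N.
Local Notation N := #|{: 'X_{1..n < B}}|.
Local Notation mon i := (bmnm (enum_val i : 'X_{1..n < B})).

Let r0 : (0 < r)%N. Proof. by rewrite hr; case/andP: hq => q0 _; rewrite addn_gt0 q0 orbT. Qed.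

Definition uemb (T : V) : P := \sum_J T J *: 'X_[mnm_of J].

Lemma uembP a (T T' : V) : uemb (a *: T + T') = a *: uemb T + uemb T'.
Proof.
rewrite /uemb scaler_sumr -big_split; apply: eq_bigr => J _ /=.
by rewrite !ffunE scalerDl scalerA.
Qed.

Lemma mdeg_mnm_of (J : {ffun 'I_n -> 'I_r}) : mdeg (mnm_of J) = (\sum_i (J i : nat))%N.
Proof. by rewrite mdegE; apply: eq_bigr => i _; rewrite mnmE. Qed.

Lemma mdeg_mnm_of_le (J : {ffun 'I_n -> 'I_r}) : (mdeg (mnm_of J) <= n * r)%N.
Proof.
rewrite mdeg_mnm_of -[X in (_ <= X * _)%N]card_ord -sum_nat_const.
by apply: leq_sum => i _; apply/ltnW/ltn_ord.
Qed.

Lemma uemb_delta (J : {ffun 'I_n -> 'I_r}) :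
  uemb [ffun J' => (J' == J)%:R] = 'X_[mnm_of J].
Proof.
rewrite /uemb (bigD1 J) //= ffunE eqxx scale1r big1 ?addr0 // => J' /negPf JJ'.
by rewrite ffunE JJ' scale0r.
Qed.

Lemma uemb_reduced (m : 'X_{1..n}) : (forall i, m i < r)%N ->
  exists T, 'X_[m] = uemb T.
Proof.
move=> mr; pose J := [ffun i => Ordinal (mr i)].
exists [ffun J' => (J' == J)%:R]; rewrite uemb_delta; congr 'X_[_].
by apply/mnmP=> i; rewrite mnmE ffunE.
Qed.

Section OneParam.
Variable c : l.-tuple C.
Local Notation f_ := (sing c q p.-1 : 'I_n -> P).

(* At [base_param] this is ['X_[m]]; hence [reduce_mx] is invertible for generic
   parameters, and then every polynomial [decomposes]. *)
Definition reduce (m : 'X_{1..n}) : P :=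
  if [pick i | (r <= m i)%N] is Some i then 'X_[m - U_(i) *+ r] * f_ i else 'X_[m].

Lemma reduce_homog m : reduce m \is (mdeg m).-homog.
Proof.
rewrite /reduce; case: pickP => [i rm|_]; last by rewrite dhomogX.
have -> : mdeg m = (mdeg (m - U_(i) *+ r)%MM + r)%N.
  rewrite -{1}(@submK _ (U_(i) *+ r)%MM m); last first.
    apply/mnm_lepP => j; rewrite mulmnE mnm1E.
    by case: eqP => [<-|_]; rewrite ?mul1n ?mul0n.
  by rewrite mdegD mdegMn mdeg1 mul1n.
by apply: dhomogM; [rewrite dhomogX|apply: sing_homog hr _ _].
Qed.

Definition decomposes (f : P) : Prop :=
  exists j T, sing_ideal p q c j /\ f = j + uemb T.

Lemma decomposesP a f g : decomposes f -> decomposes g -> decomposes (a *: f + g).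
Proof.
move=> [j [T [hj ->]]] [j' [T' [hj' ->]]].
exists (a *: j + j'), (a *: T + T'); split; first exact: sing_idealP.
by rewrite uembP scalerDr addrACA.
Qed.

Lemma uemb0 : uemb 0 = 0.
Proof. by rewrite /uemb big1 // => J _; rewrite ffunE scale0r. Qed.

Lemma decomposes_reduce m : decomposes (reduce m).
Proof.
rewrite /reduce; case: pickP => [i _|mr].
  by exists ('X_[m - U_(i) *+ r] * f_ i), 0; split;
    [exact: sing_ideal_gen|rewrite uemb0 addr0].
have [T ->] : exists T, 'X_[m] = uemb T.
  by apply: uemb_reduced => i; rewrite ltnNge mr.
by exists 0, T; split; [exact: sing_ideal0|rewrite add0r].
Qed.

Definition reduce_mx : 'M[C]_N := \matrix_(i, j) (reduce (mon j))@_(mon i).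

(** When [reduce_mx] is invertible, the polynomials [reduce m] span all degrees below the bound, and
    each of them lies in the ideal or is a reduced monomial. *)
Lemma decomposes_low m : \det reduce_mx != 0 -> (mdeg m < B)%N -> decomposes 'X_[m].
Proof.
move=> dR mB; have uR : reduce_mx \in unitmx by rewrite unitmxE unitfE.
pose v := invmx reduce_mx *m coords B 'X_[m].
have -> : 'X_[m] = \sum_j v j 0 *: reduce (mon j).
  rewrite -[LHS](@coords_homog _ _ B (mdeg m)) ?dhomogX //.
  rewrite -[coords _ _](mulKVmx uR) -/v.
  have -> : reduce_mx *m v = coords B (\sum_j v j 0 *: reduce (mon j)).
    apply/colP=> i; rewrite !mxE raddf_sum; apply: eq_bigr => j _ /=.
    by rewrite mcoeffZ mxE mulrC.
  apply: coordsK => m' /msupp_sum_le /flatten_mapP [j _ /msuppZ_le hm'].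
  have := dhomog_mf (reduce_homog (mon j)) hm' => /= ->.
  exact: bmdeg.
elim/big_rec: _ => [|j f _ hf]; last exact/decomposesP/hf/decomposes_reduce.
by exists 0, 0; split; [exact: sing_ideal0|rewrite uemb0 addr0].
Qed.

(** Low degrees suffice: a variable times a reduced monomial has degree at most $nr+1$ and can be
    decomposed again. This is the origin of the bound $nr+2$. *)
Lemma decomposes_all f : \det reduce_mx != 0 -> decomposes f.
Proof.
move=> dR; elim/mpoly_mulX_ind: f => [a f g|| i f [j [T [hj ->]]]].
- exact: decomposesP.
- by rewrite -mpolyX0; apply: decomposes_low; rewrite // mdeg0 addn2.
rewrite mulrDr -[X in X + _]scale1r; apply: decomposesP.
  exists ('X_i * j), 0; split; first exact: sing_idealM.
  by rewrite uemb0 addr0.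
rewrite /uemb mulr_sumr; elim/big_rec: _ => [|J g _ hg].
  by exists 0, 0; split; [exact: sing_ideal0|rewrite uemb0 addr0].
rewrite -scalerAr; apply: decomposesP => //; rewrite -mpolyXD.
apply: decomposes_low => //; rewrite mdegD mdeg1 add1n addn2 ltnS ltnS.
exact: mdeg_mnm_of_le.
Qed.

Definition gram : 'M[C]_#|{ffun 'I_n -> 'I_r}| :=
  \matrix_(i, j) dk_form eps c (mnm_of (enum_val i)) 'X_[mnm_of (enum_val j)].

Lemma dk_form_uemb m (T : V) :
  dk_form eps c m (uemb T) = \sum_J T J * dk_form eps c m 'X_[mnm_of J].
Proof.
have fP := dk_formP hl heps c m; have f0 : dk_form eps c m (0 : P) = 0.
  by have := fP (-1) 0 0; rewrite scaler0 addr0 mulN1r addNr.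
have fD : {morph dk_form eps c m : f g / f + g >-> f + g}.
  by move=> f g; rewrite -[f in LHS]scale1r fP mul1r.
rewrite /uemb (big_morph _ fD f0); apply: eq_bigr => J _.
by rewrite -[_ *: _]addr0 fP f0 addr0.
Qed.

Lemma gram_inj (T : V) : \det gram != 0 ->
  (forall J : {ffun 'I_n -> 'I_r}, dk_form eps c (mnm_of J) (uemb T) = 0) -> T = 0.
Proof.
move=> dG H; have uG : gram \in unitmx by rewrite unitmxE unitfE.
pose v : 'cV[C]_#|{ffun 'I_n -> 'I_r}| := \col_i T (enum_val i).
have v0 : v = 0.
  rewrite -[v](mulKmx uG) (_ : gram *m v = 0) ?mulmx0 //.
  apply/colP=> i; rewrite mxE [RHS]mxE -[RHS](H (enum_val i)) dk_form_uemb.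
  rewrite [RHS](reindex (@enum_val _ xpredT)) /=; last first.
    by apply: onW_bij; apply: enum_val_bij.
  by apply: eq_bigr => j _; rewrite !mxE mulrC.
apply/ffunP=> J; have /colP/(_ (enum_rank J)) := v0.
by rewrite !mxE enum_rankK ffunE.
Qed.

Hypothesis hc : param_hyperplane n eps c r q.

(** The forms vanish on the ideal and are nondegenerate on the span of the reduced monomials, and
    these two together span everything. *)
Lemma form_kernel f : \det reduce_mx != 0 -> \det gram != 0 ->
  (forall J : {ffun 'I_n -> 'I_r}, dk_form eps c (mnm_of J) f = 0) <->
  sing_ideal p q c f.
Proof.
move=> dR dG; split=> [H|hf J]; last exact: (dk_form_sing_ideal hl heps hq hr hc).
have [j [T [hj fE]]] := decomposes_all f dR.
suff T0 : T = 0 by rewrite fE T0 uemb0 addr0.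
apply: gram_inj dG _ => J; have := H J; rewrite fE -[j]scale1r (dk_formP hl heps).
by rewrite (dk_form_sing_ideal hl heps hq hr hc) // mulr0 add0r.
Qed.

End OneParam.

Local Notation c0 := (base_param l eps q r).

Lemma det_gram_base : \det (gram c0) != 0.
Proof.
have -> : gram c0 = diag_mx (\row_i gram c0 i i).
  apply/matrixP=> i j; rewrite !mxE; case: eqP => [->|/eqP ij]; first by rewrite mulr1n.
  rewrite mulr0n; apply/eqP; rewrite (dk_form_base hl heps hq).
  by rewrite (inj_eq enum_val_inj).
rewrite det_diag; apply/prodf_neq0 => i _; rewrite !mxE.
by rewrite (dk_form_base hl heps hq) eqxx.
Qed.

Lemma sing_base (i : 'I_n) : sing c0 q p.-1 i = 'X_i ^+ r.
Proof.
have newton_base b : newton n l c0`_0 b = (b == 0%N)%:R.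
  case: b => [|b] //; have b0 : b.+1%:R != 0 :> C by rewrite pnatr_eq0.
  by apply: (scalerI b0); rewrite newtonS base_param0 // scaleNr scale0r oppr0 scaler0.
rewrite /sing /conv big_ord_recr /= subnn newton_base mulr1 big1 => [|s _].
  by rewrite add0r hr addnC mulnC.
by rewrite newton_base subn_eq0 leqNgt ltn_ord mulr0.
Qed.

Lemma det_reduce_base : \det (reduce_mx c0) != 0.
Proof.
suff -> : reduce_mx c0 = 1%:M by rewrite det1 oner_neq0.
apply/matrixP=> i j; rewrite !mxE.
have -> : reduce c0 (mon j) = 'X_[mon j].
  rewrite /reduce; case: pickP => // a ra; rewrite sing_base mpolyXn -mpolyXD submK //.
  apply/mnm_lepP => b; rewrite mulmnE mnm1E.
  by case: eqP => [<-|_]; rewrite ?mul1n ?mul0n.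
by rewrite mcoeffX eq_sym (inj_eq val_inj) (inj_eq enum_val_inj).
Qed.

Lemma polyfun_det_gram : polyfun (fun c => \det (gram c)).
Proof.
apply: polyfun_det => i j; under boolp.eq_fun do rewrite mxE.
exact: polyfun_dk_form.
Qed.

Lemma polyfun_det_reduce : polyfun (fun c : l.-tuple C => \det (reduce_mx c)).
Proof.
apply: polyfun_det => i j; under boolp.eq_fun do rewrite mxE /reduce.
case: pickP => [a _|_]; last exact: polyfun_const.
have H := @polyfam_sing C _ _ hl q p.-1 a.
apply: (H (fun f : P => ('X_[mon j - U_(a) *+ r] * f)@_(mon i))) => b f g.
by rewrite mulrDr -scalerAr mcoeffD mcoeffZ.
Qed.

End Division.

(** * The quotient module *)

Section Quotient.
Variables (C : numFieldType) (n l : nat) (eps : C).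
Hypotheses (hl : (1 < l)%N) (heps : l.-primitive_root eps).
Local Notation W := (cyc_wreath n l).
Local Notation P := {mpoly C[n]}.
Local Notation act := (wact eps).
Variables (p q r : nat).
Hypotheses (hq : (0 < q < l)%N) (hr : r = (p.-1 * l + q)%N).
Local Notation V := (U_tensor C n r).
Local Notation IJ := {ffun 'I_n -> 'I_r}.
Local Notation M := #|{: IJ}|.
Local Notation B := (n * r + 2)%N.
Local Notation N := #|{: 'X_{1..n < B}}|.
Local Notation mon i := (bmnm (enum_val i : 'X_{1..n < B})).
Local Notation coords := (coords B).
Local Notation c0 := (base_param l eps q r).
Variable c1 : l.-tuple C.
Hypothesis hc1 : param_hyperplane n eps c1 r q.
Local Notation ct := (line c1 c0).

Let hct t : param_hyperplane n eps (ct t) r q.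
Proof. by apply: line_hyperplane => //; apply: base_param_hyperplane. Qed.

Definition form_vec (c : l.-tuple C) (f : P) : 'cV[C]_M :=
  \col_i dk_form eps c (mnm_of (enum_val i : IJ)) f.

Lemma form_vecP c a f g : form_vec c (a *: f + g) = a *: form_vec c f + form_vec c g.
Proof. by apply/colP=> i; rewrite !mxE dk_formP. Qed.

Lemma form_vec0 c : form_vec c 0 = 0.
Proof. by have := form_vecP c (-1) 0 0; rewrite scaler0 addr0 scaleN1r addNr. Qed.

Lemma form_vecB c f g : form_vec c (f - g) = form_vec c f - form_vec c g.
Proof. by rewrite addrC -scaleN1r form_vecP scaleN1r addrC. Qed.

Lemma form_vec_eq0 c f : form_vec c f = 0 <->
  forall J : IJ, dk_form eps c (mnm_of J) f = 0.
Proof.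
split=> [/colP H J|H]; last by apply/colP=> i; rewrite !mxE H.
by have := H (enum_rank J); rewrite !mxE enum_rankK.
Qed.

(** A form indexed by [J] sees only the component of degree [mdeg (mnm_of J)], which is below the
    bound. *)
Lemma form_vec_coords c f : form_vec c (of_coords (coords f)) = form_vec c f.
Proof.
elim/mpolyind: f => [|a m f _ _ IH].
  by rewrite coords0 of_coords0.
rewrite coordsP of_coordsP !form_vecP IH; congr (_ *: _ + _).
have [mB|mB] := ltnP (mdeg m) B; first by rewrite (coords_homog (d := mdeg m)) ?dhomogX.
have -> : coords ('X_[m] : P) = 0.
  apply/colP=> i; rewrite !mxE mcoeffX; case: eqP => // mi.
  by move: mB; rewrite mi leqNgt bmdeg.
rewrite of_coords0 form_vec0; apply/esym/form_vec_eq0 => J.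
apply: (@dk_form_homog _ _ _ _ hl heps _ (mdeg m)); first by rewrite dhomogX.
apply: contraTneq mB => ->; rewrite -ltnNge.
by apply: leq_ltn_trans (mdeg_mnm_of_le J) _; rewrite addn2 ltnS leqnSn.
Qed.

Lemma form_mx_exists : exists Qp : 'M[{poly C}]_(M, N),
  forall t f, ev t Qp *m coords f = form_vec (ct t) f.
Proof.
have H (x : 'I_M * 'I_N) : exists Q : {poly C}, forall t,
    dk_form eps (ct t) (mnm_of (enum_val x.1 : IJ)) 'X_[mon x.2] = Q.[t].
  exact: (polyfun_line c1 c0 (polyfun_dk_form hl heps _ _)).
have [Q HQ] := boolp.choice H.
exists (\matrix_(i, j) Q (i, j)) => t f.
rewrite -form_vec_coords; apply/colP=> i; rewrite !mxE.
have fP := dk_formP hl heps (ct t) (mnm_of (enum_val i : IJ)).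
have f0 : dk_form eps (ct t) (mnm_of (enum_val i : IJ)) (0 : P) = 0.
  by have := fP (-1) 0 0; rewrite scaler0 addr0 mulN1r addNr.
rewrite /of_coords; elim/big_rec2: _ => [|j x y _ IH]; first by rewrite f0.
by rewrite fP -IH !mxE /horner_eval -HQ mulrC.
Qed.

(** [b] is the product of the two determinants along the line; it is nonzero because $t=1$ is the
    base parameter. *)
Lemma generic_kernel : exists2 b : {poly C}, b != 0 & forall t, b.[t] != 0 ->
  \det (gram n eps r (ct t)) != 0 /\
  forall f, form_vec (ct t) f = 0 <-> sing_ideal p q (ct t) f.
Proof.
have [bg Hg] := polyfun_line c1 c0 (polyfun_det_gram n hl heps r).
have [br Hr] := polyfun_line c1 c0 (@polyfun_det_reduce C n l hl p q r).
exists (bg * br).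
  have b1 : bg.[1] != 0 by rewrite -Hg line1; apply: det_gram_base.
  have b2 : br.[1] != 0 by rewrite -Hr line1; apply: det_reduce_base.
  by rewrite mulf_neq0 //; [apply: contraNneq b1 => ->|apply: contraNneq b2 => ->];
    rewrite horner0.
move=> t; rewrite hornerM mulf_eq0 negb_or -Hg -Hr => /andP[dG dR].
by split=> // f; rewrite form_vec_eq0; apply: form_kernel.
Qed.

Lemma dk_form_pihomog (c : l.-tuple C) m (f : P) :
  dk_form eps c m f = dk_form eps c m (pihomog mdeg (mdeg m) f).
Proof.
have fP := dk_formP hl heps c m.
have f0 : dk_form eps c m (0 : P) = 0.
  by have := fP (-1) 0 0; rewrite scaler0 addr0 mulN1r addNr.
elim/mpolyind: f => [|a m' f _ _ IH]; first by rewrite linear0.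
rewrite linearP /= !fP -IH pihomogX; congr (_ * _ + _); case: eqP => // mm'.
by rewrite f0 (@dk_form_homog _ _ _ _ hl heps _ (mdeg m')) ?dhomogX //; apply/eqP.
Qed.

Lemma form_vec_pihomog c d f : form_vec c f = 0 -> form_vec c (pihomog mdeg d f) = 0.
Proof.
move=> /form_vec_eq0 H; apply/form_vec_eq0 => J.
have [<-|dJ] := eqVneq (mdeg (mnm_of J)) d; first by rewrite -dk_form_pihomog.
apply: (@dk_form_homog _ _ _ _ hl heps _ d); first exact: pihomogP.
by rewrite eq_sym.
Qed.

Lemma coords_pihomog_sum (f : P) : coords (\sum_(d < B) pihomog mdeg d f) = coords f.
Proof.
elim/mpolyind: f => [|a m f _ _ IH].
  by rewrite big1 // => d _; rewrite linear0.
under eq_bigr => d _ do rewrite linearP /=.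
rewrite big_split /= -scaler_sumr !coordsP IH; congr (_ *: _ + _).
under eq_bigr => d _ do rewrite pihomogX.
have [mB|mB] := ltnP (mdeg m) B.
  rewrite (bigD1 (Ordinal mB)) //= eqxx big1 ?addr0 // => d dm.
  by case: eqP => // md; case/eqP: dm; apply: val_inj; rewrite /= md.
rewrite big1 ?coords0 => [|d _]; last first.
  by case: eqP => // md; have := ltn_ord d; rewrite -md ltnNge mB.
apply/colP=> i; rewrite !mxE mcoeffX; case: eqP => // mi.
by move: mB; rewrite mi leqNgt bmdeg.
Qed.

Lemma wact_mon (g : W) (m : 'X_{1..n}) : act g 'X_[m]
  = (\prod_i eps ^- (cw_exp g i * m ((cw_perm g)^-1%g i)))
      *: 'X_[ [multinom m ((cw_perm g)^-1%g i) | i < n] ] :> P.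
Proof.
rewrite !mpolyXE_id rmorph_prod /=.
under eq_bigr => i _ do rewrite (wact_XnE hl heps).
rewrite (reindex_inj (@perm_inj _ (cw_perm g)^-1%g)) /= -scaler_prod.
by apply: eq_bigr => i _; rewrite permKV mnmE.
Qed.

(** The variable $x_i$ transforms under $W$ exactly like $u$ in the $i$-th tensor factor, so the
    reduced monomials span a copy of $U_r^{\otimes n}$. *)
Lemma wact_uemb (g : W) (T : V) : act g (uemb T) = uemb (U_tensor_act eps g T).
Proof.
rewrite /uemb linear_sum.
pose h (J : IJ) : IJ := [ffun i => J (cw_perm g i)].
have h_inj : injective h.
  move=> J J' /ffunP H; apply/ffunP=> i; have := H ((cw_perm g)^-1%g i).
  by rewrite !ffunE permKV.
rewrite [LHS](reindex_inj h_inj) /=; apply: eq_bigr => J _.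
rewrite linearZ /= wact_mon scalerA ffunE mulrC; congr (_ * _ *: 'X_[_]).
  by apply: eq_bigr => i _; rewrite mnmE ffunE permKV.
by apply/mnmP=> i; rewrite !mnmE ffunE permKV.
Qed.

Let Wneq0 : #|{: W}|%:R != 0 :> C.
Proof.
by rewrite pnatr_eq0 -lt0n; apply/card_gt0P; exists (1%g : W).
Qed.

(** Averaging over $W$ of the degree-preserving part of [E0]: this turns a mere linear map into a
    graded and $W$-equivariant one. *)
Definition averaged (E0 : P -> P) (f : P) : P := #|{: W}|%:R^-1 *: \sum_(g : W)
  act g (\sum_(d < B) pihomog mdeg d (E0 (pihomog mdeg d (act g^-1%g f)))).

Section Averaging.
Variable E0 : P -> P.
Hypothesis E0P : forall a f f', E0 (a *: f + f') = a *: E0 f + E0 f'.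
Let E00 : E0 0 = 0.
Proof. by have := E0P (-1) 0 0; rewrite scaler0 addr0 scaleN1r addNr. Qed.

Lemma averagedP a f f' : averaged E0 (a *: f + f') = a *: averaged E0 f + averaged E0 f'.
Proof.
rewrite /averaged [a *: (_ *: _)]scalerA [a * _]mulrC -(scalerA _ a) -scalerDr.
rewrite [a *: \sum_(_ : W) _]scaler_sumr -big_split /=.
congr (_ *: _); apply: eq_bigr => g _; rewrite -wactP; congr (wact _ _ _).
rewrite scaler_sumr -big_split; apply: eq_bigr => d _ /=.
by rewrite wactP linearP /= E0P linearP.
Qed.

Lemma averaged_wact (h : W) f : averaged E0 (act h f) = act h (averaged E0 f).
Proof.
rewrite /averaged [RHS]linearZ; congr (_ *: _); rewrite [RHS]linear_sum /=.
rewrite (reindex_inj (mulgI h)) /=; apply: eq_bigr => g _.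
rewrite (wactM hl heps); do 2!congr (wact _ _ _).
by apply: eq_bigr => d _; rewrite -(wactM hl heps) invMg mulgKV.
Qed.

Lemma averaged_homog d f : f \is d.-homog -> averaged E0 f \is d.-homog.
Proof.
move=> hf; rewrite rpredZ // rpred_sum // => g _; apply: wact_homog => //.
rewrite rpred_sum // => e _; have [<-|de] := eqVneq d e; first exact: pihomogP.
by rewrite (pihomog_ne0 de (wact_homog hl heps _ hf)) E00 linear0 rpred0.
Qed.

Variables (k : nat) (L : P -> 'cV[C]_k).
Hypothesis LP : forall a f f', L (a *: f + f') = a *: L f + L f'.
Hypothesis Lcoords : forall f f', coords f = coords f' -> L f = L f'.
Hypothesis LH : forall d f, L f = 0 -> L (pihomog mdeg d f) = 0.
Hypothesis LW : forall (g : W) f, L f = 0 -> L (act g f) = 0.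
Hypothesis E0L : forall f, L f = 0 -> E0 f = 0.
Hypothesis LE0 : forall f, L (E0 f) = L f.

Let L0 : L 0 = 0.
Proof. by have := LP (-1) 0 0; rewrite scaler0 addr0 scaleN1r addNr. Qed.
Let LB f f' : L (f - f') = L f - L f'.
Proof. by have := linZB LP 1 f f'; rewrite !scale1r. Qed.
Let LD f f' : L (f + f') = L f + L f'.
Proof. by have := LP 1 f f'; rewrite !scale1r. Qed.

Lemma averaged_ker f : L f = 0 -> averaged E0 f = 0.
Proof.
move=> f0; rewrite /averaged big1 ?scaler0 // => g _.
rewrite big1 ?linear0 // => d _.
by rewrite E0L ?linear0 //; apply/LH/LW.
Qed.

(** [E0] moves a polynomial only within the kernel of [L]. Since this kernel is graded and
    $W$-stable, neither taking components nor conjugating by $W$ changes the value of [L]. *)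
Lemma averaged_id f : L (averaged E0 f) = L f.
Proof.
have E1 f' : L (\sum_(d < B) pihomog mdeg d (E0 (pihomog mdeg d f'))) = L f'.
  rewrite -(Lcoords (coords_pihomog_sum f')); apply/eqP; rewrite -subr_eq0 -LB -sumrB.
  apply/eqP; elim/big_rec: _ => [|d x _ x0]; first exact: L0.
  rewrite LD x0 addr0 -[X in _ - X](pihomog_id mdeg) -linearB /=.
  by apply: LH; rewrite LB LE0 subrr.
have E2 (g : W) : L (act g (\sum_(d < B)
    pihomog mdeg d (E0 (pihomog mdeg d (act g^-1%g f))))) = L f.
  apply/eqP; rewrite -subr_eq0 -LB -[X in _ - X](wactVK hl heps g) -linearB /=.
  by apply/eqP/LW; rewrite LB E1 subrr.
rewrite /averaged -[_ *: _]addr0 LP L0 addr0 (big_morph L LD L0).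
under eq_bigr => g _ do rewrite E2.
by rewrite sumr_const -scaler_nat scalerA mulVf // scale1r.
Qed.

End Averaging.

End Quotient.

(** * The quotient at an arbitrary parameter of $E_r$ *)

Section QuotientExists.
Variables (C : numFieldType) (n l : nat) (eps : C).
Hypotheses (hl : (1 < l)%N) (heps : l.-primitive_root eps).
Local Notation W := (cyc_wreath n l).
Local Notation P := {mpoly C[n]}.
Local Notation act := (wact eps).
Variables (p q r : nat).
Hypotheses (hq : (0 < q < l)%N) (hr : r = (p.-1 * l + q)%N).
Local Notation V := (U_tensor C n r).
Local Notation IJ := {ffun 'I_n -> 'I_r}.
Local Notation M := #|{: IJ}|.
Local Notation B := (n * r + 2)%N.
Local Notation N := #|{: 'X_{1..n < B}}|.
Local Notation coords := (coords B).
Local Notation c0 := (base_param l eps q r).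

Lemma pihomog_uemb d (T : V) : pihomog mdeg d (uemb T)
  = uemb [ffun J : IJ => if mdeg (mnm_of J) == d then T J else 0].
Proof.
rewrite /uemb linear_sum; apply: eq_bigr => J _ /=.
rewrite linearZ /= pihomogX ffunE; case: ifP => //.
by rewrite scale0r scaler0.
Qed.

Section Projection.
Variable c : l.-tuple C.
Hypothesis dG : \det (gram n eps r c) != 0.
Local Notation G := (gram n eps r c).

Definition tensor_vec (T : V) : 'cV[C]_M := \col_i T (enum_val i).

Lemma form_vec_uemb (T : V) : form_vec eps r c (uemb T) = G *m tensor_vec T.
Proof.
apply/colP=> i; rewrite mxE dk_form_uemb // mxE.
rewrite [LHS](reindex (@enum_val _ xpredT)) /=; last first.
  by apply: onW_bij; apply: enum_val_bij.
by apply: eq_bigr => j _; rewrite !mxE mulrC.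
Qed.

(** Projection along the common kernel of the forms onto the span of the reduced monomials, in the
    coordinates of the latter. *)
Definition proj (f : P) : V :=
  [ffun J => (invmx G *m form_vec eps r c f) (enum_rank J) 0].

Lemma tensor_vec_proj f : tensor_vec (proj f) = invmx G *m form_vec eps r c f.
Proof. by apply/colP=> i; rewrite mxE ffunE enum_valK. Qed.

Let uG : G \in unitmx. Proof. by rewrite unitmxE unitfE. Qed.

Lemma form_vec_proj f : form_vec eps r c (uemb (proj f)) = form_vec eps r c f.
Proof. by rewrite form_vec_uemb tensor_vec_proj mulKVmx. Qed.

Lemma projP a f g : proj (a *: f + g) = a *: proj f + proj g.
Proof.
by apply/ffunP=> J; rewrite !ffunE form_vecP // mulmxDr -scalemxAr !mxE.
Qed.

Lemma eq_proj f g : form_vec eps r c f = form_vec eps r c g -> proj f = proj g.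
Proof. by move=> H; apply/ffunP=> J; rewrite !ffunE H. Qed.

Lemma proj_uemb T : proj (uemb T) = T.
Proof.
apply/ffunP=> J; rewrite ffunE form_vec_uemb mulKmx // mxE enum_rankK //.
Qed.

Lemma proj_eq0 f : proj f = 0 -> form_vec eps r c f = 0.
Proof. by move=> f0; rewrite -form_vec_proj f0 uemb0 form_vec0. Qed.

Lemma proj_wact (g : W) f :
  (forall f, form_vec eps r c f = 0 -> form_vec eps r c (act g f) = 0) ->
  proj (act g f) = U_tensor_act eps g (proj f).
Proof.
move=> H; rewrite -[RHS]proj_uemb; apply: eq_proj; apply/eqP.
rewrite -subr_eq0 -form_vecB // -wact_uemb // -linearB /= H //.
by rewrite form_vecB // form_vec_proj subrr.
Qed.

Lemma proj_homog d f : f \is d.-homog -> U_tensor_homog d (proj f).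
Proof.
move=> hf; pose T := proj f.
have T'E := pihomog_uemb d T.
have TT' : T = [ffun J : IJ => if mdeg (mnm_of J) == d then T J else 0].
  rewrite -[RHS]proj_uemb; apply: eq_proj; apply/eqP; rewrite -subr_eq0 -form_vecB //.
  have : form_vec eps r c (pihomog mdeg d (f - uemb T)) = 0.
    by apply: form_vec_pihomog => //; rewrite form_vecB // form_vec_proj subrr.
  by rewrite linearB /= (pihomog_dE hf) T'E => ->.
move=> J; rewrite -/T TT' ffunE -mdeg_mnm_of.
by case: (mdeg (mnm_of J) =P d) => [->|_]; rewrite ?eqxx.
Qed.

End Projection.

Variable c1 : l.-tuple C.
Hypothesis hc1 : param_hyperplane n eps c1 r q.
Local Notation ct := (line c1 c0).

Let hct t : param_hyperplane n eps (ct t) r q.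
Proof. by apply: line_hyperplane => //; apply: base_param_hyperplane. Qed.

(* The kernel of [pi] is the limit at [t = 0] of the ideals generated by the
   singular vectors for the parameters [ct t].  The image of [averaged E0] is a
   graded [W]-stable complement of it; for all but finitely many [t] this is also
   a complement of the ideal at [t], and so is the span of the monomials with
   exponents less than [r], which makes both isomorphic. *)
Lemma quotient_exists : exists pi : P -> V,
  quotient_map eps c1 pi /\ forall d f, f \is d.-homog -> U_tensor_homog d (pi f).
Proof.
have [Qp HQ] := form_mx_exists n hl heps q r c1.
have [b b0 Hb] := generic_kernel hl heps hq hr hc1.
(* The columns are the reduced monomials, so [Qp *m S] evaluates to the matrices [gram (ct t)] and
   has nonzero determinant. *)
pose S : 'M[{poly C}]_(N, M) :=
  map_mx polyC (\matrix_(i, j) coords 'X_[mnm_of (enum_val j : IJ)] i 0).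
have evC t k k' (A : 'M[C]_(k, k')) : ev t (map_mx polyC A) = A.
  by rewrite -map_mx_comp map_mx_id // => a; rewrite /= /horner_eval hornerC.
have dQS : \det (Qp *m S) != 0.
  have [t bt] := poly_nonroot b0; have [dG _] := Hb t bt.
  apply: contraNneq dG => dQ; rewrite -[gram _ _ _ _](_ : ev t (Qp *m S) = _).
    by rewrite det_map_mx dQ rmorph0.
  rewrite map_mxM evC; apply/matrixP=> i j.
  transitivity (form_vec eps r (ct t) 'X_[mnm_of (enum_val j : IJ)] i 0).
    by rewrite -HQ !mxE; apply: eq_bigr => k _; rewrite !mxE.
  by rewrite !mxE.
have [G [Qs [QE dG rf]]] := saturation dQS.
pose L t (f : P) := ev t Qs *m coords f.
have LP t a (f g : P) : L t (a *: f + g) = a *: L t f + L t g.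
  by rewrite /L coordsP mulmxDr -scalemxAr.
have Lform t (f : P) : form_vec eps r (ct t) f = ev t G *m L t f.
  by rewrite -HQ QE map_mxM mulmxA.
(* Away from the zeros of $\det G$ the saturated matrix [Qs] has the same kernel as the forms, hence
   as the ideal. *)
pose b2 := b * \det G.
have b20 : b2 != 0 by rewrite mulf_neq0.
have b2P t : b2.[t] != 0 -> [/\ b.[t] != 0, ev t G \in unitmx &
    forall f, L t f = 0 <-> form_vec eps r (ct t) f = 0].
  rewrite hornerM mulf_eq0 negb_or => /andP[bt dGt].
  have uG : ev t G \in unitmx by rewrite unitmxE unitfE det_map_mx.
  split=> // f; rewrite Lform; split=> [->|H]; first by rewrite mulmx0.
  by rewrite -[L t f](mulKmx uG) H mulmx0.
have gen_ideal t (f : P) : b2.[t] != 0 ->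
    form_vec eps r (ct t) f = 0 <-> sing_ideal p q (ct t) f.
  by move=> /b2P[bt _ _]; have [_ H] := Hb t bt; exact: H.
have stab (T0 T1 : P -> P) :
    (forall a f g, T0 (a *: f + g) = a *: T0 f + T0 g) ->
    (forall a f g, T1 (a *: f + g) = a *: T1 f + T1 g) ->
    (forall t, b2.[t] != 0 -> forall f, form_vec eps r (ct t) f = 0 ->
       form_vec eps r (ct t) (T0 f + t *: T1 f) = 0) ->
    forall f, L 0 f = 0 -> L 0 (T0 f) = 0.
  move=> T0P T1P H; apply: (limit_stable (@coordsP _ _ _) (@of_coordsP _ _ _)
    (@of_coordsK _ _ _) rf T0P T1P b20) => t bt f.
  by have [_ _ LK] := b2P t bt; move=> /LK/(H t bt)/LK.
have stab0 (T0 : P -> P) :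
    (forall a f g, T0 (a *: f + g) = a *: T0 f + T0 g) ->
    (forall t, b2.[t] != 0 -> forall f, form_vec eps r (ct t) f = 0 ->
       form_vec eps r (ct t) (T0 f) = 0) ->
    forall f, L 0 f = 0 -> L 0 (T0 f) = 0.
  move=> T0P H; apply: (stab T0 (fun _ => 0)) => // [a f g|t bt f].
    by rewrite scaler0 addr0.
  by rewrite scaler0 addr0; apply: H.
have gen_W t (g : W) (f : P) : b2.[t] != 0 -> form_vec eps r (ct t) f = 0 ->
    form_vec eps r (ct t) (act g f) = 0.
  by move=> bt; rewrite !gen_ideal //; apply: wact_sing_ideal.
have LX x (f : P) : L 0 f = 0 -> L 0 (lin_form x * f) = 0.
  apply: (stab0 (fun f => lin_form x * f)) => [a f' g|t bt f'].
    by rewrite mulrDr scalerAr.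
  by rewrite !gen_ideal //; apply: sing_idealM.
have LW (g : W) (f : P) : L 0 f = 0 -> L 0 (act g f) = 0.
  by apply: (stab0 (act g)) => [a f' f''|t bt f']; [exact: wactP|exact: gen_W].
have LH d (f : P) : L 0 f = 0 -> L 0 (pihomog mdeg d f) = 0.
  apply: (stab0 (pihomog mdeg d)) => [a f' f''|t bt f']; first exact: linearP.
  exact: form_vec_pihomog.
have LD y (f : P) : L 0 f = 0 -> L 0 (dk eps c1 y f) = 0.
  apply: (stab (dk eps c1 y) (fun f => dk eps c0 y f - dk eps c1 y f)).
  - by move=> a f' g; rewrite (dkP hl heps).
  - move=> a f' g; rewrite !(dkP hl heps) scalerBr opprD.
    exact: addrACA.
  - move=> t bt f'; rewrite -dk_line // !gen_ideal //.
    exact: (dk_sing_ideal hl heps hq hr).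
have [S0 QS0] := row_freeP rf.
(* A linear projection with kernel that of [L 0], in general compatible neither with the grading nor
   with $W$; averaging restores both. *)
pose E0 (f : P) := of_coords (S0 *m L 0 f) : P.
have E0P a (f g : P) : E0 (a *: f + g) = a *: E0 f + E0 g.
  by rewrite /E0 LP mulmxDr -scalemxAr of_coordsP.
have E0L (f : P) : L 0 f = 0 -> E0 f = 0 by rewrite /E0 => ->; rewrite mulmx0 of_coords0.
have LE0 (f : P) : L 0 (E0 f) = L 0 f by rewrite /L of_coordsK mulmxA QS0 mul1mx.
pose E := averaged l eps r E0 : P -> P.
have EP a (f g : P) : E (a *: f + g) = a *: E f + E g by apply: (averagedP l eps r E0P).
have Eker (f : P) : L 0 f = 0 -> E f = 0 by apply: (averaged_ker r LH LW E0L).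
have Eid (f : P) : L 0 (E f) = L 0 f.
  by apply: (averaged_id hl heps (LP 0) _ LH LW LE0) => f1 f2; rewrite /L => ->.
have EE (f : P) : E f = E (of_coords (S0 *m L 0 f)).
  apply/eqP; rewrite -subr_eq0 -[E f]scale1r -(linZB EP) scale1r Eker //.
  by have := linZB (LP 0) 1 f (E0 f); rewrite !scale1r LE0 subrr.
have [ME HME] : exists A : 'M[C]_N, forall v, coords (E (of_coords v)) = A *m v.
  by apply: lin_mxP => a u v; rewrite of_coordsP EP coordsP.
(* The matrix of the map from the limit quotient at $0$ to the quotient at $t$ obtained by going
   through the image of [E]. It is the identity at $t=0$, hence invertible for all but finitely many
   $t$. *)
pose Pi := Qs *m map_mx polyC (ME *m S0).
have PiE t (f : P) : L t (E f) = ev t Pi *m L 0 f.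
  by rewrite EE /L HME map_mxM evC !mulmxA.
have Pi0 : \det Pi != 0.
  have Pi1 : ev 0 Pi = 1%:M.
    have H (v : 'cV[C]_M) : ev 0 Pi *m v = v.
      have Lv : L 0 (of_coords (S0 *m v)) = v.
        by rewrite /L of_coordsK mulmxA QS0 mul1mx.
      by rewrite -{1}Lv -PiE Eid Lv.
    apply/matrixP=> i j; have /colP/(_ i) := H (delta_mx j 0).
    by rewrite -colE !mxE andbT.
  apply: contraTneq isT => dPi; have := det_map_mx (horner_eval 0) Pi.
  by rewrite Pi1 det1 dPi rmorph0 => /eqP; rewrite oner_eq0.
have [t] := poly_nonroot (mulf_neq0 b20 Pi0).
rewrite hornerM mulf_eq0 negb_or => /andP[bt Pit].
have [bt' uG LK] := b2P t bt.
have uPi : ev t Pi \in unitmx by rewrite unitmxE unitfE det_map_mx.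
have [dGt _] := Hb t bt'.
(* At one such good $t$, the quotient at $0$ is carried by [E] to the quotient at $t$ and read there
   in reduced monomials. Both maps are graded and $W$-equivariant, while the kernel remains that of
   [L 0]. *)
pose pi (f : P) := proj (ct t) (E f).
have piK (f : P) : pi f = 0 <-> L 0 f = 0.
  split=> [/(proj_eq0 dGt)/LK|f0].
    by rewrite PiE => H; rewrite -[L 0 f](mulKmx uPi) H mulmx0.
  by rewrite /pi Eker // -(uemb0 C n r) proj_uemb.
exists pi; split; last first.
  by move=> d f hf; apply: proj_homog => //; apply: averaged_homog.
split.
- by move=> a f g; rewrite /pi EP projP.
- move=> g f; rewrite /pi /E averaged_wact // proj_wact // => f'.
  exact: gen_W.
- by move=> x f /piK H; apply/piK/LX.
- by move=> y f /piK H; apply/piK/LD.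
(* The preimage is found by inverting [Pi] at $t$ and lifting the result through [S0]. *)
- move=> T; exists (of_coords (S0 *m (invmx (ev t Pi) *m L t (uemb T)))).
  rewrite -[RHS](proj_uemb dGt); apply: eq_proj; rewrite !Lform PiE.
  by rewrite /L of_coordsK [ev 0 Qs *m _]mulmxA QS0 mul1mx mulKVmx.
Qed.

End QuotientExists.

(** * Irreducibility *)

Section Irreducible.
Variables (C : numFieldType) (n l : nat) (eps : C).
Hypotheses (hl : (1 < l)%N) (heps : l.-primitive_root eps).
Local Notation W := (cyc_wreath n l).
Local Notation P := {mpoly C[n]}.
Variables (r : nat) (c : l.-tuple C).
Hypothesis r0 : (0 < r)%N.
Local Notation V := (U_tensor C n r).
Local Notation IJ := {ffun 'I_n -> 'I_r}.
Local Notation M := #|{: IJ}|.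
Local Notation D := (dk eps c).

(** Components of degree below that of [m] are killed, and the one of equal degree becomes a
    constant. *)
Lemma dk_word_const m (f : P) :
  (forall e, (mdeg m < e)%N -> pihomog mdeg e f = 0) ->
  dk_word eps c m f = (dk_form eps c m f)%:MP.
Proof.
move=> hf; have wP := dk_wordP hl heps c m.
have w0 : dk_word eps c m (0 : P) = 0.
  by have := wP (-1) 0 0; rewrite scaler0 addr0 scaleN1r addNr.
have wD : {morph dk_word eps c m : f g / f + g >-> f + g}.
  by move=> f1 f2; rewrite -[f1 in LHS]scale1r wP scale1r.
apply/mpolyP=> m'; rewrite mcoeffC; case: eqP => [->|/eqP m'0].
  by rewrite mulr1.
rewrite mulr0 {1}(pihomog_partitionE (leqnn (mmeasure mdeg f))) (big_morph _ wD w0).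
rewrite raddf_sum big1 // => -[e _] _ /=.
have := dk_word_homog hl heps c m (pihomogP mdeg e f).
case: (ltngtP (mdeg m) e) => [/hf ->|_ ->|->].
- by rewrite w0 mcoeff0.
- by rewrite mcoeff0.
rewrite subnn => hw; apply: (dhomog_nemf_coeff hw).
by rewrite /= mdeg_eq0.
Qed.

Variables (Y : lmodType (cherednik n eps c)) (piY : P -> Y) (phi : Y -> V).
Hypotheses (hY : poly_rep_quotient piY) (hphi : graded_W_iso piY phi).
Hypothesis dG : \det (gram n eps r c) != 0.

Let piP a f g : piY (a *: f + g) = chC n eps c a *: piY f + piY g.
Proof. by case: hY. Qed.
Let piX x f : piY (lin_form x * f) = chX eps c x *: piY f.
Proof. by case: hY. Qed.
Let piD y f : piY (D y f) = chY eps c y *: piY f.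
Proof. by case: hY => _ _ _ H _; rewrite dkE. Qed.
Let pi0 : piY 0 = 0.
Proof.
have := piP 1 0 0; rewrite scale1r addr0 /chC /pres_scalar scale1r rmorph1 scale1r.
by rewrite -[LHS]addr0 => /addrI.
Qed.
Let phiP a v w : phi (chC n eps c a *: v + w) = a *: phi v + phi w.
Proof. by case: hphi. Qed.
Let phi0 : phi 0 = 0.
Proof. by have := phiP (-1) 0 0; rewrite scaler0 addr0 scaleN1r addNr. Qed.
Let phi_eq0 v : phi v = 0 -> v = 0.
Proof.
by case: hphi => _ bphi _ _ v0; apply: (bij_inj bphi); rewrite v0 phi0.
Qed.

Let pi_spanned (K : Y -> Prop) : (forall a v w, K v -> K w -> K (a *: v + w)) ->
  K (piY 1) -> forall v, K v.
Proof.
move=> KP K1 v; case: hY => _ _ _ _ /(_ v) [f <-{v}].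
elim/mpoly_mulX_ind: f => [a f g hf hg||i f hf] //.
  by rewrite piP; apply: KP.
rewrite -lin_form_delta piX -[_ *: _]addr0; apply: (KP) => //.
by have := KP (-1) _ _ hf hf; rewrite scaleN1r addNr.
Qed.

Let pi1_neq0 : piY 1 != 0.
Proof.
apply/eqP=> pi10; have H v : v = 0 :> Y.
  by apply: (pi_spanned (K := fun v => v = 0)) => // a x w -> ->; rewrite scaler0 addr0.
case: hphi => _ [psi _ psiK] _ _.
have := psiK [ffun=> 1]; rewrite (H (psi _)) phi0 => /ffunP/(_ [ffun=> Ordinal r0])/eqP.
by rewrite !ffunE eq_sym oner_eq0.
Qed.

Let pi_const a : piY a%:MP = chC n eps c a *: piY 1.
Proof.
by rewrite -[a%:MP]addr0 -alg_mpolyC piP pi0 addr0.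
Qed.

Let pi_const_eq0 a : piY a%:MP = 0 -> a = 0.
Proof.
rewrite pi_const => /(congr1 phi); rewrite -[_ *: _]addr0 phiP phi0 addr0.
move=> /eqP; rewrite scaler_eq0 => /orP[/eqP //|/eqP/phi_eq0/eqP].
by rewrite (negPf pi1_neq0).
Qed.

(** The kernel is graded, because components of different degrees have images with disjoint supports
    in $U_r^{\otimes n}$. *)
Let pi_pihomog d f : piY f = 0 -> piY (pihomog mdeg d f) = 0.
Proof.
move=> f0; apply: phi_eq0; case: hphi => _ _ _ hgr.
have H e : U_tensor_homog e (phi (piY (pihomog mdeg e f))).
  by apply/hgr; exists (pihomog mdeg e f) => //; exact: pihomogP.
pose T f := phi (piY f).
have TP a f1 f2 : T (a *: f1 + f2) = a *: T f1 + T f2 by rewrite /T piP phiP.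
have T0 : T 0 = 0 by rewrite /T pi0 phi0.
have TD : {morph T : f g / f + g >-> f + g}.
  by move=> f1 f2; rewrite -[f1 in LHS]scale1r TP scale1r.
have [k [dk fk]] : exists k, (d < k)%N /\ (mmeasure mdeg f <= k)%N.
  by exists (maxn d.+1 (mmeasure mdeg f)); rewrite leq_maxl leq_maxr.
have : T f = 0 by rewrite /T f0 phi0.
rewrite {1}(pihomog_partitionE fk) (big_morph T TD T0) (bigD1 (Ordinal dk)) //= => sum0.
apply/ffunP=> J; rewrite [RHS]ffunE; apply/eqP/contraT=> /[dup] /H Jd.
move/ffunP/(_ J): sum0; rewrite !ffunE sum_ffunE big1 ?addr0 => [->|[e ek] ed].
  by rewrite eqxx.
apply/eqP/contraT=> /H Je; case/eqP: ed; apply: val_inj => /=.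
by rewrite -Jd Je.
Qed.

Let pi_dk_word m f : piY f = 0 -> piY (dk_word eps c m f) = 0.
Proof.
apply: (dk_word_stable (K := fun f => piY f = 0)) => y g.
by rewrite piD => ->; rewrite scaler0.
Qed.

(** The component of degree [mdeg m] lies in the kernel as well, and the word sends it to a constant
    in the kernel; constants inject into [Y]. *)
Let dk_form_ker m f : piY f = 0 -> dk_form eps c m f = 0.
Proof.
move=> f0; rewrite (dk_form_pihomog hl heps); apply: pi_const_eq0.
rewrite -dk_word_const; first exact/pi_dk_word/pi_pihomog.
by move=> e me; rewrite (@pihomog_ne0 _ _ _ (mdeg m)) ?pihomogP // ltn_eqF.
Qed.

Let uemb_inj (T : V) : piY (uemb T) = 0 -> T = 0.
Proof. by move=> T0; apply: (gram_inj hl heps dG) => J; apply: dk_form_ker. Qed.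

(** A dimension count: composed with [phi], the injective map [uemb_inj] becomes an endomorphism of
    the finite-dimensional [V]. *)
Let uemb_surj v : exists T : V, v = piY (uemb T).
Proof.
pose toV (w : 'cV[C]_M) : V := [ffun J => w (enum_rank J) 0].
have toVP a w w' : toV (a *: w + w') = a *: toV w + toV w'.
  by apply/ffunP=> J; rewrite !ffunE !mxE.
have vecK (T : V) : toV (tensor_vec T) = T.
  by apply/ffunP=> J; rewrite ffunE mxE enum_rankK.
have toVK w : tensor_vec (toV w) = w.
  by apply/colP=> i; rewrite mxE ffunE enum_valK.
have [A HA] : exists A : 'M[C]_M, forall w, tensor_vec (phi (piY (uemb (toV w)))) = A *m w.
  apply: lin_mxP => a w w'; rewrite toVP uembP piP phiP.
  by apply/colP=> i; rewrite !mxE !ffunE.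
have uA : A \in unitmx.
  rewrite -unitmx_tr -row_free_unit; apply/inj_row_free => w wA.
  have : A *m w^T = 0 by rewrite -[A]trmxK -trmx_mul wA trmx0.
  rewrite -HA => /(congr1 toV); rewrite vecK => H.
  have T0 : toV w^T = 0.
    by apply/uemb_inj/phi_eq0; rewrite H; apply/ffunP=> J; rewrite !ffunE mxE.
  rewrite -[w]trmxK -(toVK w^T) T0; apply/rowP=> i; rewrite !mxE ffunE //.
exists (toV (invmx A *m tensor_vec (phi v))); case: hphi => _ bphi _ _.
by apply: (bij_inj bphi); rewrite -[RHS]vecK HA mulKVmx // vecK.
Qed.

Lemma irreducible_quotient : irreducible_module Y.
Proof.
split; first by exists (piY 1).
move=> S [S0 SP]; have [[v [vS v0]]|H] := pselect (exists v, v \in S /\ v != 0).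
  right=> w; rewrite inE; apply: (pi_spanned (K := fun w => w \in S)).
    by move=> a x x'; exact: SP.
  have [T vE] := uemb_surj v; have T0 : T != 0.
    by apply: contraNneq v0 => T0; rewrite vE T0 uemb0 pi0.
  have [J0 HJ0] : exists J : IJ, dk_form eps c (mnm_of J) (uemb T) != 0.
    apply: contrapT => /forallNP H; case/eqP: T0; apply: (gram_inj hl heps dG) => J.
    by apply/eqP/contraT=> /H.
  pose Q (J : IJ) := dk_form eps c (mnm_of J) (uemb T) != 0.
  (* With [J] of maximal degree among the forms not vanishing on [uemb T], nondegeneracy of [gram]
     excludes components of higher degree, so the word for [J] yields a nonzero constant. *)
  have [J QJ maxJ] := @arg_maxnP _ J0 Q (fun J => mdeg (mnm_of J)) HJ0.
  have top e : (mdeg (mnm_of J) < e)%N -> pihomog mdeg e (uemb T) = 0.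
    move=> Je; rewrite pihomog_uemb (_ : finfun _ = 0) ?uemb0 //.
    apply: (gram_inj hl heps dG) => J'; rewrite -pihomog_uemb.
    have [J'e|J'e] := eqVneq (mdeg (mnm_of J')) e.
      rewrite -J'e -dk_form_pihomog //; apply/eqP/contraT => /maxJ /=.
      by rewrite J'e leqNgt Je.
    apply: (@dk_form_homog _ _ _ _ hl heps _ e); first exact: pihomogP.
    by rewrite eq_sym.
  have : piY (dk_word eps c (mnm_of J) (uemb T)) \in S.
    apply: (dk_word_stable (K := fun f => piY f \in S)); last by rewrite -vE.
    by move=> y f fS; rewrite piD -[_ *: _]addr0; apply: SP.
  rewrite (dk_word_const top); set a := dk_form _ _ _ _ => aS.
  have -> : piY 1 = chC n eps c a^-1 *: piY a%:MP + 0.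
    by rewrite -pi0 -piP addr0 -mul_mpolyC -mpolyCM mulVf.
  exact: SP.
left=> v; rewrite inE; apply/idP/eqP=> [vS|->//].
by apply/eqP/contraT=> v0; case: H; exists v.
Qed.

End Irreducible.

Section Exists.
Variables (C : numFieldType) (n l : nat) (eps : C).
Hypotheses (hl : (1 < l)%N) (heps : l.-primitive_root eps).
Variables (p q r : nat).
Hypotheses (hq : (0 < q < l)%N) (hr : r = (p.-1 * l + q)%N).

(** The equation of $E_r$ is placed under the existential, so that choice yields a module for every
    parameter. *)
Lemma graded_quotient_exists (c : l.-tuple C) :
  exists Ypi : {Y : lmodType (cherednik n eps c) & {mpoly C[n]} -> Y},
  param_hyperplane n eps c r q ->
  poly_rep_quotient (projT2 Ypi) /\
  exists phi : projT1 Ypi -> U_tensor C n r, graded_W_iso (projT2 Ypi) phi.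
Proof.
have [hc|hc] := pselect (param_hyperplane n eps c r q).
  have [pi [hpi pi_gr]] := quotient_exists hl heps hq hr hc.
  have [Y [piY [phi [hY hphi]]]] := cherednik_quotient hl heps hpi pi_gr.
  by exists (existT (fun Y : lmodType _ => _ -> Y) Y piY) => _; split=> //; exists phi.
(* Off $E_r$ nothing is claimed, and the regular module with the zero map is a placeholder. *)
by exists (existT (fun Y : lmodType _ => _ -> Y)
  ((cherednik n eps c)^o : lmodType _) (fun=> 0)).
Qed.

End Exists.

Theorem theorem4p2 (R : realType) (n l p q r : nat) (eps : R[i])
    (hn : (1 <= n)%N) (hl : (2 <= l)%N)
    (hr : (0 < r)%N) (hlr : ~~ (l %| r)%N)
    (hp : (0 < p)%N) (hq : (1 <= q <= l - 1)%N)
    (hrpq : r = ((p - 1) * l + q)%N)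
    (heps : l.-primitive_root eps) :
  exists (Y : forall c : l.-tuple R[i], lmodType (cherednik n eps c))
         (pi : forall c : l.-tuple R[i], {mpoly R[i][n]} -> Y c),
    (forall c : l.-tuple R[i], param_hyperplane n eps c r q ->
       poly_rep_quotient (pi c) /\
       exists phi : Y c -> U_tensor R[i] n r, graded_W_iso (pi c) phi)
    /\
    (exists U : set (l.-tuple R[i]),
       [/\ zariski_open_in
             (fun c : l.-tuple R[i] => param_hyperplane n eps c r q) U,
           (exists c : l.-tuple R[i], U c)
         & forall c : l.-tuple R[i], U c -> irreducible_module (Y c)]).
Proof.
have hq' : (0 < q < l)%N by move: hq hl; clear; lia.
have hr' : r = (p.-1 * l + q)%N by rewrite hrpq subn1.
pose F c := cid (graded_quotient_exists n hl heps hq' hr' c).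
exists (fun c => projT1 (sval (F c))), (fun c => projT2 (sval (F c))).
split=> [c|]; first exact: (svalP (F c)).
have [f Hf] := polyfun_det_gram n hl heps r.
exists [set c | param_hyperplane n eps c r q /\ f.@[tnth c] != 0]%classic; split.
- exists [set f]%classic; apply/seteqP; split=> c /= [hc].
    by move=> fc; split=> //; exists f.
  by move=> [_ -> fc].
- exists (base_param l eps q r); split; first exact: base_param_hyperplane.
  by rewrite /= -Hf; apply: det_gram_base.
- move=> c [hc fc]; have [hY [phi hphi]] := svalP (F c) hc.
  by apply: (irreducible_quotient hl heps hr hY hphi); rewrite Hf.
Qed.
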